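(* Let $\Delta=0$. For the domain wall initial condition $Y=\mathbb{N}=\{1,2,3,\dots\}$, the left-most particle has the limiting distribution $$\lim_{t\to\infty}\mathbb{P}_{\mathbb{N}}\left(\frac{X_1(t)+2t}{t^{1/3}}\ge -y\right)=F_2(y),\qquad y\in\mathbb{R},$$ where $F_2$ is the $\beta=2$ Tracy-Widom distribution.
   Context: Let $\mathcal{X}_N$ be the set of all $X=\{x_1<\dots<x_N\}\subset\mathbb{Z}$ and $\mathcal{H}_N=\ell^2(\mathcal{X}_N)$ with orthonormal basis $e_X(Y)=\delta_{X,Y}$. The XXZ spin-$\frac12$ Hamiltonian with anisotropy $\Delta\in\mathbb{R}$ is $H_{XXZ}=\sum_{j\in\mathbb{Z}}h_{j,j+1}$, where $h_{j,j+1}e_X=0$ if both or neither of $j,j+1$ belong to $X$, and $h_{j,j+1}e_X=-\Delta e_X+e_{X'}$ if exactly one of them belongs to $X$, with $X'$ obtained from $X$ by exchanging the occupation of $j$ and $j+1$. It is self-adjoint on $\mathcal{H}_N$. For $Y\in\mathcal{X}_N$ write $e^{-itH_{XXZ}}e_Y=\sum_X\psi_N(X;t)e_X$ and $\mathbb{P}_Y(X_1(t)\ge x)=\sum_{X\in\mathcal{X}_N,\,x_1\ge x}|\psi_N(X;t)|^2$ for real $x$. For the domain wall initial condition, $\mathbb{P}_{\mathbb{N}}(X_1(t)\ge x)=\lim_{N\to\infty}\mathbb{P}_{\{1,\dots,N\}}(X_1(t)\ge x)$. $F_2(y)=\det(I-K_{\mathrm{Ai}})_{L^2(y,\infty)}$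 with $K_{\mathrm{Ai}}(u,v)=\dfrac{\mathrm{Ai}(u)\mathrm{Ai}'(v)-\mathrm{Ai}'(u)\mathrm{Ai}(v)}{u-v}$. *)

(* Defs.v *)
From mathcomp Require Import all_boot all_order all_algebra.
From mathcomp Require Import finmap complex.
From mathcomp Require Import all_classical all_reals all_analysis.
From mathcomp Require Import lra.

Set Implicit Arguments.
Unset Strict Implicit.
Unset Printing Implicit Defensive.

Import Order.TTheory GRing.Theory Num.Theory numFieldNormedType.Exports.

Local Open Scope classical_set_scope.
Local Open Scope ring_scope.

Definition config (N : nat) := {X : {fset int} | #|` X| == N}.

(* The transposition of the sites j and j + 1; its image of X exchanges the
   occupations of these two sites. *)
Definition exchange (j k : int) : int :=
  if k == j then j + 1 else if k == j + 1 then j else k.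

Lemma exchangeK (j : int) : involutive (exchange j).
Proof.
move=> k; rewrite /exchange; have j1 : (j + 1 == j) = false by rewrite -subr_eq0 addrC addKr.
case: (eqVneq k j) => [->|kj]; first by rewrite j1 eqxx.
case: (eqVneq k (j + 1)) => [->|kj1]; first by rewrite eqxx.
by rewrite (negbTE kj) (negbTE kj1).
Qed.

Lemma swap_subproof (N : nat) (j : int) (X : config N) :
  #|` [fset exchange j k | k in val X]%fset| == N.
Proof.
rewrite card_imfset /=; first exact: (valP X).
exact: inv_inj (@exchangeK j).
Qed.

Definition swap (N : nat) (j : int) (X : config N) : config N :=
  Sub [fset exchange j k | k in val X]%fset (swap_subproof j X).

Definition boundary (N : nat) (j : int) (X : config N) : bool :=
  (j \in val X) != (j + 1 \in val X).

Lemma mem_swap (N : nat) (j : int) (X : config N) (k : int) :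
  (k \in val (swap j X)) = (exchange j k \in val X).
Proof.
apply/imfsetP/idP => /= [[l lX ->]|kX]; first by rewrite exchangeK.
by exists (exchange j k); rewrite ?exchangeK.
Qed.

Lemma swapK (N : nat) (j : int) : involutive (@swap N j).
Proof.
by move=> X; apply/val_inj/fsetP => k; rewrite !mem_swap exchangeK.
Qed.

Lemma boundary_swap (N : nat) (j : int) (X : config N) :
  boundary j (swap j X) = boundary j X.
Proof.
have j1 : (j + 1 == j) = false by rewrite -subr_eq0 addrC addKr.
by rewrite /boundary !mem_swap /exchange !eqxx j1 eq_sym.
Qed.

Definition leftmost (N : nat) (X : config N) : int :=
  head 0 (sort <=%R (val X)).

Lemma initial_subproof (N : nat) :
  #|` [fset (i.+1)%:Z | i in iota 0 N]%fset| == N.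
Proof.
rewrite card_imfset /=; last by move=> i j [].
by rewrite undup_id ?iota_uniq ?size_iota.
Qed.

Definition initial (N : nat) : config N :=
  Sub [fset (i.+1)%:Z | i in iota 0 N]%fset (initial_subproof N).

Section dynamics.
Context {R : realType} (N : nat).
Local Open Scope complex_scope.

Definition basis (X : config N) : config N -> R[i] := fun Z => (X == Z)%:R.

(* The linear extension of h_{j,j+1} from the basis vectors (see
   local_hamiltonian_basis) to arbitrary amplitudes f. *)
Definition local_hamiltonian (D : R) (j : int) (f : config N -> R[i]) :
    config N -> R[i] :=
  fun Z => if boundary j Z then - D%:C * f Z + f (swap j Z) else 0.

Lemma local_hamiltonian_basis D (j : int) (X : config N) :
  local_hamiltonian D j (basis X) =
  if boundary j X then fun Z => - D%:C * basis X Z + basis (swap j X) Z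
  else fun=> 0.
Proof.
apply/funext => Z; rewrite /local_hamiltonian /basis.
have sE : (X == swap j Z) = (swap j X == Z) by rewrite -(inj_eq (inv_inj (@swapK N j))) swapK.
have [bZ|bZ] := ifPn; have [bX|bX] := ifPn => //; rewrite ?sE//.
- have /negbTE -> : X != Z by apply: contraNneq bX => ->.
  have /negbTE -> : swap j X != Z.
    by apply: contraNneq bX => e; rewrite -boundary_swap e.
  by rewrite mulr0 addr0.
- have /negbTE -> : X != Z by apply: contraNneq bZ => <-.
  have /negbTE -> : swap j X != Z.
    by apply: contraNneq bZ => <-; rewrite boundary_swap.
  by rewrite mulr0 addr0.
Qed.

(* For each Z only finitely many j contribute. *)
Definition hamiltonian (D : R) (f : config N -> R[i]) : config N -> R[i] :=
  fun Z => \sum_(j \in [set: int]) local_hamiltonian D j f Z.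

Definition sqmod (z : R[i]) : R := complex.Re z ^+ 2 + complex.Im z ^+ 2.

Definition sqnorm (f : config N -> R[i]) : \bar R :=
  \esum_(X in [set: config N]) (sqmod (f X))%:E.

Definition exp_partial (D t : R) (f : config N -> R[i]) (m : nat) :
    config N -> R[i] :=
  fun X => \sum_(n < m) (- ('i * t%:C)) ^+ n / n`!%:R * iter n (hamiltonian D) f X.

(* exp(-itH) f, as the sum in l^2(X_N) of the exponential series: H is a
   bounded operator on l^2(X_N). *)
Definition evolution (D t : R) (f : config N -> R[i]) : config N -> R[i] :=
  xget (fun=> 0) [set psi : config N -> R[i] |
    sqnorm (fun X => exp_partial D t f m X - psi X) @[m --> \oo] --> 0%E].

Definition psi (D t : R) (Y X : config N) : R[i] := evolution D t (basis Y) X.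

Definition prob_leftmost (D t : R) (Y : config N) (E : set int) : \bar R :=
  \esum_(X in [set X : config N | E (leftmost X)]) (sqmod (psi D t Y X))%:E.

End dynamics.

Definition prob_leftmost_domain_wall {R : realType} (D t : R) (E : set int) :
    \bar R :=
  lim (prob_leftmost D t (initial N) E @[N --> \oo]).

Section tracy_widom.
Context {R : realType}.
Local Notation mu := (@lebesgue_measure R).

Definition Ai (x : R) : R :=
  lim ((pi^-1 * \int[mu]_(u in `[0, A]) cos (u ^+ 3 / 3 + x * u))
    @[A --> +oo%R]).

Definition airy_quotient (u v : R) : R :=
  (Ai u * derive1 Ai v - derive1 Ai u * Ai v) / (u - v).

(* On the diagonal the kernel is its continuous extension. *)
Definition airy_kernel (u v : R) : R :=
  if u == v then lim (airy_quotient u w @[w --> u^']) else airy_quotient u v.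

(* The integral over D^n, as an iterated Lebesgue integral. *)
Fixpoint iterated_integral (D : set R) (n : nat) : (n.-tuple R -> R) -> R :=
  match n with
  | 0 => fun f => f [tuple]
  | m.+1 => fun f => \int[mu]_(x in D)
      iterated_integral D (fun v : m.-tuple R => f (cons_tuple x v))
  end.

(* det(I - K) on L^2(D), as the Fredholm series. *)
Definition fredholm_det (K : R -> R -> R) (D : set R) : R :=
  lim (series (fun n => (-1) ^+ n / n`!%:R *
    iterated_integral D (fun v : n.-tuple R =>
      \det (\matrix_(i < n, j < n) K (tnth v i) (tnth v j)))) @ \oo).

Definition F2 (y : R) : R := fredholm_det airy_kernel `]y, +oo[.

End tracy_widom.

(* The exponential series of the evolution converges in l^2, so that evolution
   is not the default value of xget: bounds in l^1, where l1 is the size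
   |Re z| + |Im z| of an amplitude. *)
Section evolution_convergence.
Context {R : realType} (N : nat).
Local Open Scope complex_scope.
Implicit Types (f : config N -> R[i]) (D : R).

Let l1 (z : R[i]) : R := `|complex.Re z| + `|complex.Im z|.

Let n1 f : \bar R := \esum_(X in [set: config N]) (l1 (f X))%:E.

Let l1_ge0 z : 0 <= l1 z. Proof. by rewrite addr_ge0. Qed.

Let l1_0 : l1 0 = 0. Proof. by rewrite /l1 normr0 addr0. Qed.

Let l1_1 : l1 1 = 1. Proof. by rewrite /l1 /= normr1 normr0; exact: addr0. Qed.

Let l1D z w : l1 (z + w) <= l1 z + l1 w.
Proof.
case: z w => [a b] [c d]; rewrite /l1 /= addrACA.
by rewrite lerD// ler_normD.
Qed.

Let l1M z w : l1 (z * w) <= l1 z * l1 w.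
Proof.
case: z w => [a b] [c d]; rewrite /l1 /=.
rewrite (le_trans (lerD (ler_normB _ _) (ler_normD _ _)))// !normrM.
nra.
Qed.

Let l1_sum (I : Type) (r : seq I) (g : I -> R[i]) :
  l1 (\sum_(i <- r) g i) <= \sum_(i <- r) l1 (g i).
Proof.
elim/big_rec2: _ => [|i x y _ h]; first by rewrite l1_0.
by rewrite (le_trans (l1D _ _))// lerD2l.
Qed.

Let sqmod_le z : sqmod z <= l1 z ^+ 2.
Proof.
rewrite /sqmod /l1 -(real_normK (num_real (complex.Re z))).
rewrite -(real_normK (num_real (complex.Im z))) sqrrD lerD2r lerDl.
by rewrite mulrn_wge0// mulr_ge0.
Qed.

Let l1_fsum (g : int -> R[i]) :
  ((l1 (\sum_(j \in [set: int]) g j))%:E <=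
   \esum_(j in [set: int]) (l1 (g j))%:E)%E.
Proof.
set r := finite_support _ _ _.
apply: esum_ge; exists [set` r]; first by split.
by rewrite -fsbig_seq ?finite_support_uniq// sumEFin lee_fin l1_sum.
Qed.

Let sum_mem (X : config N) (c : \bar R) (h : int -> int) :
  injective h -> (0 <= c)%E ->
  (\esum_(j in [set: int]) (if h j \in val X then c else 0) <= c *+ N)%E.
Proof.
move=> hinj c0.
apply: (@le_trans _ _ (\esum_(k in [set: int]) if k \in val X then c else 0)%E).
  rewrite -(@esum_image _ _ _ [set: int] h
    (fun k => if k \in val X then c else 0))%E; last by move=> ? ? _ _ /hinj.
  rewrite esum_mkcond; apply: le_esum => k _.
  by case: ifP => // _; case: ifP.
have -> : (\esum_(k in [set: int]) (if k \in val X then c else 0) =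
          \esum_(k in [set` val X]) c)%E.
  rewrite [RHS]esum_mkcond; apply: eq_esum => k _.
  by rewrite mem_setE.
rewrite esum_fset// fsbig_finite//= set_fsetK.
by rewrite big_const_seq count_predT iter_addr_0 (eqP (valP X)).
Qed.

Let esum_exchange (T1 T2 : choiceType) (a : T1 -> T2 -> \bar R) :
  (forall i j, 0 <= a i j)%E ->
  (\esum_(i in [set: T1]) \esum_(j in [set: T2]) a i j =
   \esum_(j in [set: T2]) \esum_(i in [set: T1]) a i j)%E.
Proof.
move=> a0; rewrite !esum_esum//.
apply: (@reindex_esum _ _ _ _ _ (fun k => (k.2, k.1))
  (fun k : T1 * T2 => a k.1 k.2)).
split => //; first by move=> [x y] [z t] _ _ /= [-> ->].
by move=> [x y] _; exists (y, x).
Qed.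

Let esumZ (T : choiceType) (k : R) (a : T -> R) : 0 <= k ->
  (forall i, 0 <= a i) ->
  (\esum_(i in [set: T]) (k * a i)%:E <=
   k%:E * \esum_(i in [set: T]) (a i)%:E)%E.
Proof.
move=> k0 a0; apply: ge_ereal_sup => _ [X [finX XT] <-].
apply: (@le_trans _ _ (k%:E * \sum_(i \in X) (a i)%:E)%E).
  by rewrite ge0_mule_fsumr.
apply: lee_wpmul2l; first by rewrite lee_fin.
by apply: esum_ge; exists X.
Qed.

Let n1_hamiltonian D f :
  (n1 (hamiltonian D f) <= ((`|D| + 1) *+ N *+ 2)%:E * n1 f)%E.
Proof.
have c0 Z : 0 <= (`|D| + 1) * l1 (f Z) by rewrite mulr_ge0// addr_ge0.
apply: (@le_trans _ _ (\esum_(Z in [set: config N]) \esum_(j in [set: int])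
    (l1 (local_hamiltonian D j f Z))%:E)%E).
  by apply: le_esum => Z _; exact: l1_fsum.
rewrite esum_exchange; last by move=> *; rewrite lee_fin.
apply: (@le_trans _ _ (\esum_(j in [set: int]) \esum_(Z in [set: config N])
    (if boundary j Z then (`|D| + 1) * l1 (f Z) else 0)%:E)%E).
  apply: le_esum => j _.
  pose A (Z : config N) := if boundary j Z then `|D| * l1 (f Z) else 0.
  pose B (Z : config N) := if boundary j Z then l1 (f Z) else 0.
  have A0 Z : 0 <= A Z by rewrite /A; case: ifP => // _; rewrite mulr_ge0.
  have B0 Z : 0 <= B Z by rewrite /B; case: ifP.
  apply: (@le_trans _ _ (\esum_(Z in [set: config N])
      ((A Z)%:E + (B (swap j Z))%:E))%E).
    apply: le_esum => Z _; rewrite -EFinD lee_fin /A /B boundary_swap.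
    rewrite /local_hamiltonian; case: ifP => _; last by rewrite l1_0 addr0.
    rewrite (le_trans (l1D _ _))// lerD2r (le_trans (l1M _ _))//.
    by rewrite /l1 /= oppr0 normr0 addr0 normrN.
  rewrite esumD; [|by move=> *; rewrite lee_fin..].
  rewrite -(@reindex_esum _ _ _ [set: config N] [set: config N]
    (@swap N j) (fun Z => (B Z)%:E)); last first.
    split => //; first by move=> ? ? _ _ /(inv_inj (@swapK N j)).
    by move=> Z _; exists (swap j Z); rewrite ?swapK.
  rewrite -esumD; [|by move=> *; rewrite lee_fin..].
  apply: le_esum => Z _; rewrite -EFinD lee_fin /A /B.
  by case: ifP => _; rewrite ?addr0// mulrDl mul1r.
rewrite esum_exchange; last by move=> j Z; rewrite lee_fin; case: ifP.
apply: le_trans (esumZ _ _); [|by rewrite !mulrn_wge0// addr_ge0|by []].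
apply: le_esum => Z _; set c := (`|D| + 1) * l1 (f Z).
apply: (@le_trans _ _ (\esum_(j in [set: int])
   ((if j \in val Z then c%:E else 0) +
    (if (j + 1)%R \in val Z then c%:E else 0)))%E).
  apply: le_esum => j _; rewrite /boundary.
  by case: (j \in val Z); case: (j + 1 \in val Z);
    rewrite ?adde0 ?add0e//= ?adde_ge0// lee_fin c0.
rewrite esumD; [|by move=> j _; case: ifP => //; rewrite lee_fin c0..].
rewrite !mulrnAl -/c mulr2n EFinD.
rewrite EFin_natmul.
apply: leeD; first by apply: (@sum_mem Z _ id) => //; rewrite lee_fin c0.
apply: (@sum_mem Z _ (fun j => j + 1)); last by rewrite lee_fin c0.
exact: addIr.
Qed.


Let n1_iter D f n :
  (n1 (iter n (hamiltonian D) f) <=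
   (((`|D| + 1) *+ N *+ 2) ^+ n)%:E * n1 f)%E.
Proof.
elim: n => [|n ih] /=; first by rewrite expr0 mul1e.
apply: (le_trans (n1_hamiltonian _ _)); rewrite exprS EFinM -muleA.
by rewrite lee_wpmul2l// lee_fin !mulrn_wge0// addr_ge0.
Qed.

Let n1_basis (Y : config N) : (n1 (basis Y) <= 1)%E.
Proof.
rewrite /n1 (_ : \esum_(X in _) _ = \esum_(X in [set Y]) 1%E)%E.
  by rewrite esum_set1.
rewrite [RHS]esum_mkcond; apply: eq_esum => X _; rewrite /basis eq_sym.
have [->|XY] := eqVneq X Y; first by rewrite mem_set// [l1 _]l1_1.
by rewrite l1_0 memNset//; exact/eqP.
Qed.

Section evolution.
Variables (D t : R) (Y : config N).

Let a n X := (- ('i * t%:C)) ^+ n / n`!%:R * iter n (hamiltonian D) (basis Y) X.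

Let e := exp_coeff (((`|D| + 1) *+ N *+ 2) * `|t|).

Let e_ge0 n : 0 <= e n.
Proof. by rewrite exp_coeff_ge0// mulr_ge0// !mulrn_wge0// addr_ge0. Qed.

Let l1_coef n : l1 ((- ('i * t%:C)) ^+ n / n`!%:R) <= `|t| ^+ n / n`!%:R.
Proof.
rewrite (le_trans (l1M _ _))// ler_pM//; last first.
  rewrite -(rmorph_nat (real_complex R)) -fmorphV /l1 /= normr0 addr0.
  by rewrite ger0_norm.
elim: n => [|n ih]; first by rewrite !expr0 [l1 _]l1_1.
rewrite !exprS (le_trans (l1M _ _))// ler_pM//.
by rewrite /l1 /= !mul0r !mul1r subr0 oppr0 normr0 !add0r normrN.
Qed.

Let n1_a n : (n1 (a n) <= (e n)%:E)%E.
Proof.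
have c0 : 0 <= `|t| ^+ n / n`!%:R by rewrite divr_ge0.
apply: (@le_trans _ _ (\esum_(X in [set: config N]) (`|t| ^+ n / n`!%:R *
    l1 (iter n (hamiltonian D) (basis Y) X))%:E)%E).
  apply: le_esum => X _; rewrite lee_fin (le_trans (l1M _ _))//.
  by rewrite ler_wpM2r.
apply: (le_trans (esumZ _ _)) => //.
have -> : e n = `|t| ^+ n / n`!%:R * (((`|D| + 1) *+ N *+ 2) ^+ n * 1).
  by rewrite /e /exp_coeff /= exprMn mulr1 [RHS]mulrC mulrA.
rewrite [leRHS]EFinM lee_wpmul2l// ?lee_fin//.
apply: (le_trans (n1_iter _ _ _)).
rewrite [leRHS]EFinM lee_wpmul2l ?n1_basis// lee_fin exprn_ge0// !mulrn_wge0//.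
Qed.

Let l1_le_n1 f X : ((l1 (f X))%:E <= n1 f)%E.
Proof.
by apply: esum_ge; exists [set X]; [split|rewrite fsbig_set1].
Qed.

Let l1_a n X : l1 (a n X) <= e n.
Proof. by rewrite -lee_fin (le_trans (l1_le_n1 _ _))// n1_a. Qed.

Let cvg_part (u : nat -> R) : (forall n, `|u n| <= e n) -> cvgn (series u).
Proof.
move=> ue; apply: normed_cvg; apply: series_le_cvg ue _ => //.
exact: is_cvg_series_exp_coeff.
Qed.

Let cvg_re X : cvgn (series (fun n => complex.Re (a n X))).
Proof. by apply: cvg_part => n; rewrite (le_trans _ (l1_a n X))// lerDl. Qed.

Let cvg_im X : cvgn (series (fun n => complex.Im (a n X))).
Proof. by apply: cvg_part => n; rewrite (le_trans _ (l1_a n X))// lerDr. Qed.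

Let sum := limn (series e).

Let tau m := sum - series e m.

Let S := exp_partial D t (basis Y).

Let SE m X : S m X = series (fun n => complex.Re (a n X)) m +i*
                     series (fun n => complex.Im (a n X)) m.
Proof.
rewrite /S /exp_partial !seriesEord /=.
elim: m => [|m ih]; first by rewrite !big_ord0.
by rewrite !big_ord_recr /= ih -/(a m X); case: (a m X).
Qed.

Let phi X := limn (series (fun n => complex.Re (a n X))) +i*
             limn (series (fun n => complex.Im (a n X))).

Let n1_S m k : (m <= k)%N -> (n1 (fun X => S m X - S k X)%R <= (tau m)%:E)%E.
Proof.
move=> mk; apply: (@le_trans _ _ (\esum_(X in [set: config N])
    \sum_(m <= n < k) (l1 (a n X))%:E)%E).
  apply: le_esum => X _; rewrite sumEFin lee_fin.
  have -> : l1 (S m X - S k X) = l1 (\sum_(m <= n < k) a n X).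
    have <- : S k X - S m X = \sum_(m <= n < k) a n X.
      have SE' j : S j X = \sum_(0 <= n < j) a n X by rewrite big_mkord.
      by rewrite !SE' (big_cat_nat (leq0n m) mk)/= [LHS]addrC addKr.
    by rewrite -opprB /l1; case: (S k X - S m X) => x y /=; rewrite !normrN.
  exact: l1_sum.
rewrite esum_sum; last by move=> *; rewrite lee_fin.
apply: (@le_trans _ _ (\sum_(m <= n < k) (e n)%:E)%E).
  by apply: lee_sum => n _; exact: n1_a.
rewrite sumEFin lee_fin -sub_series_geq// lerD2r.
apply: nondecreasing_cvgn_le; last exact: is_cvg_series_exp_coeff.
by apply: nondecreasing_series => n _ _; exact: e_ge0.
Qed.

Let cvg_dist (u : nat -> R) c : cvgn u ->
  `|c - u k| @[k --> \oo] --> `|c - limn u|.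
Proof. by move=> cu; apply: cvg_norm; apply: cvgB => //; exact: cvg_cst. Qed.

Let n1_phi m : (n1 (fun X => S m X - phi X)%R <= (tau m)%:E)%E.
Proof.
apply: ge_ereal_sup => _ [F [finF _] <-].
rewrite fsbig_finite//= sumEFin lee_fin.
have : \sum_(X <- fset_set F) l1 (S m X - S k X) @[k --> \oo] -->
       \sum_(X <- fset_set F) l1 (S m X - phi X).
  apply: cvg_big => [|X _]; first exact: add_continuous.
  rewrite SE.
  under eq_cvg do rewrite SE.
  by apply: cvgD; apply: cvg_dist; [exact: cvg_re|exact: cvg_im].
move/cvgr_to_le; apply; exists m => // k /= mk.
rewrite -lee_fin (le_trans _ (n1_S mk))//.
apply: esum_ge; exists F; first by split.
by rewrite fsbig_finite//= sumEFin.
Qed.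

Lemma evolution_cvg :
  sqnorm (fun X => exp_partial D t (basis Y) m X -
    evolution D t (basis Y) X) @[m --> \oo] --> 0%E.
Proof.
rewrite /evolution; case: xgetP => [psi _ //|/(_ phi)/=]; apply: contra_notP => _.
have tau0 : tau m @[m --> \oo] --> (0 : R).
  rewrite -(subrr sum); apply: cvgB; first exact: cvg_cst.
  exact: is_cvg_series_exp_coeff.
apply: (@squeeze_cvge _ _ _ _ (fun=> 0%E) _ (fun m => (tau m * tau m)%:E)).
- apply: nearW => m; apply/andP; split.
    by apply: esum_ge0 => X _; rewrite lee_fin addr_ge0// sqr_ge0.
  have tau_ge0 : 0 <= tau m.
    by rewrite -lee_fin (le_trans _ (n1_phi m))// esum_ge0// => X _; rewrite lee_fin.
  apply: (@le_trans _ _ (\esum_(X in [set: config N])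
      (tau m * l1 (S m X - phi X))%:E)%E).
    apply: le_esum => X _; rewrite lee_fin (le_trans (sqmod_le _))// expr2.
    rewrite ler_wpM2r// -lee_fin (le_trans _ (n1_phi m))//.
    exact: (l1_le_n1 (fun X => S m X - phi X)).
  apply: (le_trans (esumZ _ _)) => //.
  by rewrite EFinM lee_wpmul2l ?lee_fin ?n1_phi.
- exact: cvg_cst.
- apply: cvg_EFin; first exact: nearW.
  by rewrite -[X in _ --> X](mulr0 0); apply: cvgM.
Qed.

End evolution.

End evolution_convergence.

(* Main.v *)
Require Import Defs.
From mathcomp Require Import all_boot all_order all_algebra.
From mathcomp Require Import finmap complex perm.
From mathcomp Require Import all_classical all_reals all_analysis.
From mathcomp Require Import measurable_realfun.
From mathcomp Require Import ring lra zify.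

(** At anisotropy zero the chain is a system of free fermions. The amplitude from
    {1, ..., N} to X at time t is, up to a phase, the determinant of the
    Bessel functions J_{j - x_i}(2 t). Indeed, each entry solves the lattice
    equation of one particle, and a forbidden jump onto an occupied site would
    make two rows equal ([is_derive_amplitude]). The exponential series of the
    Hamiltonian has the same limit, because its partial sums solve the same
    system with one step of delay ([amplitude_walk_sum], [sqmod_psi]).

    The left-most particle is at x0 or to its right when all particles are in
    the half-line from x0 on. By Cauchy-Binet the sum of the squared
    amplitudes over these configurations is the determinant of the N by N Gram
    matrix of the half-line ([sum_window], [sum_half_line]). As the translates
    of the Bessel sequence are orthonormal ([bessel_window_cvg]), this matrix is
    1 - E^T E, where E has the entries J_{m + p + i + 1}(2 t), with m = 1 - x0
    and p, i >= 0 ([window_det_cvg]). The determinant of 1 - E^T E is that of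
    1 - E E^T, whose expansion into principal minors is the Fredholm series of a
    kernel on (y, +oo) that is constant on cells of length t^(- 1/3)
    ([fredholm_det_cell], [edge_det_cvg]).

    The length of the window, the number of particles and the time now go to
    infinity one after the other, each time by [fredholm_det_cvg]: pointwise
    convergence of the kernels together with an integrable bound on the
    determinants. The kernels are Gram kernels, hence by Hadamard's inequality
    a bound on the diagonal is enough. Both the bound and the limit come from
    moving the line of integration in Bessel's integral to height t^(- 1/3):
    with n = 2 t + r t^(1/3), the function t^(1/3) J_n(2 t) is at most a constant
    times exp(- r) ([bessel_edge_le]) and converges to Ai(r)
    ([bessel_edge_cvg], [Ai_shift]). The limit kernel is the integral of
    Ai(u + s) Ai(v + s) over s > 0, which is the Airy kernel by Airy's equation
    ([airy_kernelE]). *)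

Set Implicit Arguments.
Unset Strict Implicit.
Unset Printing Implicit Defensive.

Import Order.TTheory GRing.Theory Num.Theory numFieldNormedType.Exports.

Local Open Scope classical_set_scope.
Local Open Scope ring_scope.

(** * Determinants: Fredholm expansion, Cauchy-Binet, Hadamard *)

Section minors.
Variable R : comNzRingType.

(** Sylvester's identity, from two block triangular factorizations of one
    matrix. *)
Lemma det_1Dmul n m (A : 'M[R]_(n, m)) (B : 'M[R]_(m, n)) :
  \det (1%:M + A *m B) = \det (1%:M + B *m A).
Proof.
have e1 : block_mx 1%:M (- A) B 1%:M =
    block_mx 1%:M 0 B 1%:M *m block_mx 1%:M (- A) 0 (1%:M + B *m A).
  rewrite mulmx_block !mul1mx !mul0mx !addr0 !mulmx1.
  by rewrite mulmxN addrC addrK.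
have e2 : block_mx 1%:M (- A) B 1%:M =
    block_mx 1%:M (- A) 0 1%:M *m block_mx (1%:M + A *m B) 0 B 1%:M.
  rewrite mulmx_block !mul1mx !mul0mx !add0r !mulmx1.
  by rewrite mulNmx addrK.
have := congr1 determinant e1; rewrite e2 !det_mulmx.
by rewrite !det_lblock !det_ublock !det1 !mul1r !mulr1.
Qed.

(** The determinant of this matrix is the principal minor of M on S, without a
    change of size. *)
Definition rows_from N (M : 'M[R]_N) (S : {set 'I_N}) : 'M[R]_N :=
  \matrix_(i, j) if i \in S then M i j else (i == j)%:R.

(** Sylvester's identity, with the 0-1 matrix of f as one of the factors. *)
Lemma det_mxsub_inj n N (M : 'M[R]_N) (f : 'I_n -> 'I_N) : injective f ->
  \det (mxsub f f M) = \det (rows_from M (f @: 'I_n)).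
Proof.
move=> f_inj.
pose F := \matrix_(a < n, j < N) (f a == j)%:R : 'M[R]_(n, N).
have FM p (A : 'M[R]_(N, p)) : F *m A = rowsub f A.
  apply/matrixP => a j; rewrite !mxE (bigD1 (f a))//= !mxE eqxx mul1r.
  by rewrite big1 ?addr0// => k /negbTE kf; rewrite !mxE eq_sym kf mul0r.
have MF p (A : 'M[R]_(p, N)) : A *m F^T = colsub f A.
  apply/matrixP => a j; rewrite !mxE (bigD1 (f j))//= !mxE eqxx mulr1.
  by rewrite big1 ?addr0// => k /negbTE kf; rewrite !mxE eq_sym kf mulr0.
have -> : mxsub f f M = 1%:M + (F *m (M - 1%:M)) *m F^T.
  rewrite mulmxBr mulmx1 mulmxBl FM !MF.
  apply/matrixP => a b; rewrite !mxE (inj_eq f_inj).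
  by rewrite eq_sym addrC subrK.
rewrite (@det_1Dmul n N (F *m (M - 1%:M)) F^T); congr (\det _).
apply/matrixP => i j; rewrite mulmxA.
have -> : F^T *m F = \matrix_(i, j) ((i \in f @: 'I_n) && (i == j))%:R.
  apply/matrixP => k l; rewrite !mxE; case: imsetP => [[a _ ->]|/= kS].
    rewrite (bigD1 a)//= !mxE eqxx mul1r big1 ?addr0// => b ba.
    by rewrite !mxE (inj_eq f_inj) (negbTE ba) mul0r.
  rewrite big1// => a _; rewrite !mxE; case: eqP => [e|]; last by rewrite mul0r.
  by case: kS; exists a.
rewrite !mxE (bigD1 i)//= !mxE eqxx andbT big1 ?addr0; last first.
  by move=> k ki; rewrite !mxE eq_sym (negbTE ki) andbF mul0r.
by case: ifP => _; rewrite ?mul1r ?mul0r ?addr0// addrC subrK.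
Qed.

Lemma det_1D N (M : 'M[R]_N) :
  \det (1%:M + M) = \sum_(S : {set 'I_N}) \det (rows_from M S).
Proof.
rewrite /determinant exchange_big /=; apply: eq_bigr => s _.
rewrite -big_distrr /=; congr (_ * _).
under eq_bigr do rewrite !mxE addrC.
rewrite bigA_distr; apply: eq_big => // S _; apply: eq_bigr => i _.
by rewrite !mxE.
Qed.

Lemma det_mxsub_noninj n N (M : 'M[R]_N) (f : 'I_n -> 'I_N) :
  ~~ injectiveb f -> \det (mxsub f f M) = 0.
Proof.
move=> /injectivePn[a [b ab fab]].
by apply: (determinant_alternate ab) => j; rewrite !mxE fab.
Qed.

(** A set of size n is the image of exactly n`! injections. *)
Lemma sum_inj_ffun (V : nmodType) n N (h : {set 'I_N} -> V) :
  \sum_(f : {ffun 'I_n -> 'I_N} | injectiveb f) h (f @: 'I_n) =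
  (\sum_(S : {set 'I_N} | #|S| == n) h S) *+ n`!.
Proof.
rewrite (partition_big (fun f : {ffun 'I_n -> 'I_N} => f @: 'I_n)
  (fun S => #|S| == n)) /=; last first.
  by move=> f /injectiveP f_inj; rewrite card_imset// card_ord.
rewrite -sumrMnl; apply: eq_bigr => S /eqP cS.
under eq_bigr => f /andP[_ /eqP ->] do [].
rewrite sumr_const; congr (_ *+ _).
have -> : n`! = #|[set f : {ffun 'I_n -> 'I_N} in ffun_on (mem S) | injectiveb f]|.
  by rewrite card_inj_ffuns_on card_ord cS ffactnn.
apply: eq_card => f; rewrite !inE; apply/andP/andP => [[fi /eqP fS]|[/ffun_onP fS fi]].
  by split=> //; apply/ffun_onP => a; rewrite -fS imset_f.
split=> //; rewrite eqEcard cS card_imset ?card_ord ?leqnn ?andbT; last exact/injectiveP.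
by apply/fintype.subsetP => _ /imsetP[a _ ->]; exact: fS.
Qed.

End minors.

Section expansions.
Variable F : realFieldType.

Lemma sum_minors n N (M : 'M[F]_N) :
  \sum_(f : {ffun 'I_n -> 'I_N}) \det (mxsub f f M) =
  n`!%:R * \sum_(S : {set 'I_N} | #|S| == n) \det (rows_from M S).
Proof.
rewrite (bigID (fun f : {ffun 'I_n -> 'I_N} => injectiveb f)) /=.
rewrite [X in _ + X]big1 ?addr0; last by move=> f; exact: det_mxsub_noninj.
rewrite mulr_natl -sum_inj_ffun; apply: eq_bigr => f /injectiveP f_inj.
exact: det_mxsub_inj.
Qed.

(** The expansion of a determinant into principal minors, written as a Fredholm
    series: the sum over all index tuples replaces the one over sets, since
    repeated indices contribute zero and each set is hit n`! times. *)
Lemma det_fredholm N (M : 'M[F]_N) :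
  \det (1%:M + M) = \sum_(n < N.+1)
    (n`!%:R)^-1 * \sum_(f : {ffun 'I_n -> 'I_N}) \det (mxsub f f M).
Proof.
have cS (S : {set 'I_N}) : (#|S| < N.+1)%N by rewrite ltnS -[leqRHS]card_ord max_card.
rewrite det_1D (partition_big (fun S => Ordinal (cS S)) xpredT) //=.
apply: eq_bigr => n _.
by rewrite sum_minors mulKf ?pnatr_eq0 -?lt0n ?fact_gt0.
Qed.

Lemma sum_minors_gt n N (M : 'M[F]_N) : (N < n)%N ->
  \sum_(f : {ffun 'I_n -> 'I_N}) \det (mxsub f f M) = 0.
Proof.
move=> Nn; rewrite sum_minors big1 ?mulr0// => S /eqP cS.
by move: Nn; rewrite -cS ltnNge -[leqRHS]card_ord max_card.
Qed.

Lemma mxsub_opp n N (M : 'M[F]_N) (f : 'I_n -> 'I_N) :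
  \det (mxsub f f (- M)) = (-1) ^+ n * \det (mxsub f f M).
Proof. by rewrite -detZ; congr (\det _); apply/matrixP => i j; rewrite !mxE mulN1r. Qed.

(** Cauchy-Binet with row tuples in place of row sets: expand one of the two
    determinants and absorb its permutation into the summation variable f. *)
Lemma andreief n L (B : 'M[F]_(L, n)) :
  \sum_(f : {ffun 'I_n -> 'I_L}) \det (rowsub f B) ^+ 2 =
  n`!%:R * \det (B^T *m B).
Proof.
under eq_bigr => f _ do rewrite expr2 {1}/determinant big_distrl /=.
rewrite exchange_big /=.
transitivity (\sum_(s : 'S_n) \sum_(f : {ffun 'I_n -> 'I_L})
   (\prod_i B (f i) i) * \det (rowsub f B)).
  apply: eq_bigr => s _.
  rewrite (reindex (fun f : {ffun 'I_n -> 'I_L} => [ffun i => f (s i)])) /=; last first.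
    exists (fun f : {ffun 'I_n -> 'I_L} => [ffun i => f ((s^-1)%g i)]) => f _;
    by apply/ffunP => i; rewrite !ffunE ?permK ?permKV.
  apply: eq_bigr => f _.
  have -> : rowsub [ffun i => f (s i)] B = row_perm s (rowsub f B).
    by apply/matrixP => i j; rewrite !mxE ffunE.
  have -> : \det (row_perm s (rowsub f B)) = (-1) ^+ s * \det (rowsub f B).
    by rewrite row_permE det_mulmx det_perm.
  rewrite mulrACA -expr2 sqrr_sign mul1r.
  congr (_ * _); rewrite [RHS](reindex_inj (@perm_inj _ s)) /=.
  by apply: eq_bigr => i _; rewrite !mxE.
rewrite sumr_const card_Sn.
rewrite mulr_natl; congr (_ *+ _).
rewrite [RHS]/determinant.
under eq_bigr => f _ do rewrite /determinant big_distrr /=.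
rewrite exchange_big /=; apply: eq_bigr => s _.
under eq_bigr => f _ do rewrite mulrCA -big_split /=.
rewrite -big_distrr /=; congr (_ * _).
under [in RHS]eq_bigr => i _ do rewrite mxE.
rewrite bigA_distr_bigA /=; apply: eq_bigr => f _; apply: eq_bigr => i _.
by rewrite !mxE.
Qed.

Lemma mulmx_tr_ge0 N (v : 'rV[F]_N) : 0 <= (v *m v^T) 0 0.
Proof. by rewrite mxE sumr_ge0// => i _; rewrite mxE -expr2 sqr_ge0. Qed.

Lemma mulmx_tr_eq0 N (v : 'rV[F]_N) : (v *m v^T) 0 0 = 0 -> v = 0.
Proof.
move/eqP; rewrite mxE psumr_eq0 => [|i _]; last by rewrite mxE -expr2 sqr_ge0.
move=> /allP h; apply/rowP => i; have := h i (mem_index_enum _).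
by rewrite !mxE mulf_eq0 orbb => /eqP.
Qed.

Lemma mulmx_tr_le N (v w : 'rV[F]_N) : v *m w^T = 0 ->
  (v *m v^T) 0 0 <= ((v + w) *m (v + w)^T) 0 0.
Proof.
move=> vw; have wv : w *m v^T = 0 by rewrite -[LHS]trmxK trmx_mul trmxK vw trmx0.
rewrite linearD mulmxDl 2!mulmxDr vw wv addr0 add0r [leRHS]mxE lerDl.
exact: mulmx_tr_ge0.
Qed.

(** Replacing the first row by its component w' orthogonal to the others does
    not change the determinant and does not increase the norm of the row. If
    the other rows are dependent, the determinant is zero. *)
Lemma hadamard_gram n N (G : 'M[F]_(n, N)) :
  0 <= \det (G *m G^T) <= \prod_i (G *m G^T) i i.
Proof.
elim: n G => [|n ih] G; first by rewrite det_mx00 big_ord0 ler01 lexx.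
set w := usubmx (G : 'M[F]_(1 + n, N)); set W := dsubmx (G : 'M[F]_(1 + n, N)).
have G_split : G = col_mx w W by rewrite [RHS]vsubmxK.
have /andP[A0 A1] := ih W; set A := W *m W^T in A0 A1.
have GE : G *m G^T = block_mx (w *m w^T) (w *m W^T) (W *m w^T) A :> 'M[F]_(1 + n).
  by rewrite G_split (@tr_col_mx _ 1 n N); exact: mul_col_row.
have prodE : \prod_i (G *m G^T) i i = (w *m w^T) 0 0 * \prod_i A i i.
  rewrite GE (@big_split_ord _ _ _ 1 n) /= big_ord1; congr (_ * _).
    exact: block_mxEul.
  by apply: eq_bigr => i _; exact: block_mxEdr.
rewrite prodE.
have [uA|] := boolP (A \in unitmx); last first.
  rewrite unitmxE unitfE negbK => /det0P[x x0 xA].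
  have xW : x *m W = 0.
    by apply: mulmx_tr_eq0; rewrite trmx_mul mulmxA -(mulmxA x) xA mul0mx mxE.
  have -> : \det (G *m G^T) = 0.
    apply/eqP/det0P; exists (row_mx (0 : 'rV_1) x : 'rV_(1 + n)).
      by apply: contra_neq x0 => e; rewrite -[x](row_mxKr (0 : 'rV_1)) e linear0.
    have xG : row_mx (0 : 'rV_1) x *m (G : 'M[F]_(1 + n, N)) = 0.
      by rewrite G_split [LHS]mul_row_col mul0mx add0r.
    by rewrite mulmxA [X in X *m _]xG mul0mx.
  rewrite lexx mulr_ge0 ?mulmx_tr_ge0// prodr_ge0// => i _.
  have -> : A i i = (row i W *m (row i W)^T) 0 0.
    by rewrite !mxE; apply: eq_bigr => k _; rewrite !mxE.
  exact: mulmx_tr_ge0.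
pose c := w *m W^T *m invmx A; pose w' := w - c *m W.
have w'W : w' *m W^T = 0.
  by rewrite mulmxBl -[c *m W *m _]mulmxA -/A mulmxKV// subrr.
have w'w : w' *m w^T = w' *m w'^T.
  by rewrite [w'^T]linearB /= trmx_mul mulmxBr mulmxA w'W mul0mx subr0.
have dE : \det (G *m G^T) = (w' *m w'^T) 0 0 * \det A.
  have -> : G *m G^T = block_mx 1%:M c 0 1%:M *m
      block_mx (w' *m w'^T) 0 (W *m w^T) A :> 'M[F]_(1 + n).
    rewrite GE mulmx_block !mul1mx !mul0mx !add0r; congr block_mx.
    - by rewrite -w'w mulmxBl -[c *m W *m _]mulmxA subrK.
    - by rewrite mulmxKV.
  transitivity (\det (block_mx 1%:M c 0 1%:M : 'M[F]_(1 + n)) *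
     \det (block_mx (w' *m w'^T) 0 (W *m w^T) A : 'M[F]_(1 + n))).
    exact: det_mulmx.
  by rewrite (det_ublock 1%:M) (det_lblock (w' *m w'^T)) !det1 !mul1r det_mx11.
have ww : (w' *m w'^T) 0 0 <= (w *m w^T) 0 0.
  have -> : w = w' + c *m W by rewrite subrK.
  by apply: mulmx_tr_le; rewrite trmx_mul mulmxA w'W mul0mx.
rewrite dE; apply/andP; split; first by rewrite mulr_ge0 ?mulmx_tr_ge0.
by rewrite ler_pM ?mulmx_tr_ge0.
Qed.

End expansions.

(** * Calculus on the real line *)

Section derive_rules.
Context {R : realType}.
Implicit Types (f g : R -> R) (x c df dg : R).

Lemma is_derive_compR f g x df dg : is_derive x 1 g dg -> is_derive (g x) 1 f df ->
  is_derive x 1 (fun s => f (g s)) (df * dg).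
Proof. by move=> ? ?; apply: is_derive1_comp. Qed.

Lemma is_derive_addR f g x df dg : is_derive x 1 f df -> is_derive x 1 g dg ->
  is_derive x 1 (fun s => f s + g s) (df + dg).
Proof. by move=> ? ?; exact: is_deriveD. Qed.

Lemma is_derive_oppR f x df : is_derive x 1 f df -> is_derive x 1 (fun s => - f s) (- df).
Proof. by move=> ?; exact: is_deriveN. Qed.

Lemma is_derive_mulR f g x df dg : is_derive x 1 f df -> is_derive x 1 g dg ->
  is_derive x 1 (fun s => f s * g s) (df * g x + f x * dg).
Proof.
move=> ? ?; have := @is_deriveM R R f g x 1 df dg _ _ => h.
by apply: is_derive_eq; rewrite /GRing.scale /=; ring.
Qed.

Lemma is_derive_expXR f n x df : is_derive x 1 f df ->
  is_derive x 1 (fun s => f s ^+ n) (n%:R * f x ^+ n.-1 * df).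
Proof.
move=> fx; elim: n => [|n ih].
  by rewrite mul0r mul0r; exact: (is_derive_cst (1 : R)).
under eq_fun do rewrite exprS.
apply: (is_derive_eq (is_derive_mulR fx ih)).
by case: n {ih} => [|n] /=; rewrite ?expr0 ?exprS -?[n.+2]addn1 -?[n.+1]addn1 ?natrD; ring.
Qed.

Lemma is_derive_expR' f x df : is_derive x 1 f df ->
  is_derive x 1 (fun s => expR (f s)) (expR (f x) * df).
Proof. by move=> ?; apply: is_derive_compR. Qed.

Lemma is_derive_cosR f x df : is_derive x 1 f df ->
  is_derive x 1 (fun s => cos (f s)) (- sin (f x) * df).
Proof. by move=> ?; apply: is_derive_compR. Qed.

Lemma is_derive_sinR f x df : is_derive x 1 f df ->
  is_derive x 1 (fun s => sin (f s)) (cos (f x) * df).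
Proof. by move=> ?; apply: is_derive_compR. Qed.

Lemma is_derive_cstR x c : is_derive x 1 (fun _ : R => c) 0.
Proof. exact: is_derive_cst. Qed.

Lemma is_derive_idR x : is_derive x 1 (fun s : R => s) 1.
Proof. exact: is_derive_id. Qed.

Lemma is_derive_scaleR x c : is_derive x 1 ( *%R c) c.
Proof.
apply: (is_derive_eq (is_derive_mulR (is_derive_cstR x c) (is_derive_idR x))).
by rewrite mul0r add0r mulr1.
Qed.

Lemma is_derive_contR f x df : is_derive x 1 f df -> {for x, continuous f}.
Proof. by move=> h; apply/differentiable_continuous/derivable1_diffP; apply: ex_derive. Qed.

End derive_rules.

(** The shape of the function alone selects the rule: the rules are refined
    without type class resolution, and derivatives of unknown functions are
    taken from the context. *)
Ltac is_derive_step := first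
  [ match goal with
    | |- is_derive _ _ (fun s => s) _ => notypeclasses refine (is_derive_idR _)
    | |- is_derive _ _ (fun s => ?c) _ => notypeclasses refine (is_derive_cstR _ c)
    | |- is_derive _ _ (fun s => expR _) _ => notypeclasses refine (is_derive_expR' _)
    | |- is_derive _ _ (fun s => cos _) _ => notypeclasses refine (is_derive_cosR _)
    | |- is_derive _ _ (fun s => sin _) _ => notypeclasses refine (is_derive_sinR _)
    | |- is_derive _ _ (fun s => _ + _) _ => notypeclasses refine (is_derive_addR _ _)
    | |- is_derive _ _ (fun s => - _) _ => notypeclasses refine (is_derive_oppR _)
    | |- is_derive _ _ (fun s => _ * _) _ => notypeclasses refine (is_derive_mulR _ _)
    | |- is_derive _ _ (fun s => _ ^+ _) _ => notypeclasses refine (is_derive_expXR _ _)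
    | |- is_derive _ _ ( *%R _) _ => notypeclasses refine (is_derive_scaleR _ _)
    | |- is_derive _ _ -%R _ => notypeclasses refine (is_deriveNid _ _)
    | |- is_derive _ _ expR _ => notypeclasses refine (is_derive_expR _)
    | |- is_derive _ _ cos _ => notypeclasses refine (is_derive_cos _)
    | |- is_derive _ _ sin _ => notypeclasses refine (is_derive_sin _)
    end | eassumption ].

Ltac is_derive_tac := notypeclasses refine (is_derive_eq _ _); [repeat is_derive_step | ].

Ltac continuous_tac := let x := fresh "x" in move=> x;
  notypeclasses refine (@is_derive_contR _ _ _ _ _); is_derive_tac; reflexivity.

Section analysis_tools.
Context {R : realType}.
Local Notation mu := (@lebesgue_measure R).

Lemma derive_ge0_le (h h' : R -> R) (t : R) : 0 <= t ->
  (forall s : R, is_derive s 1 h (h' s)) ->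
  (forall s, 0 <= s <= t -> 0 <= h' s) -> h 0 <= h t.
Proof.
move=> t0 dh h0.
have [|c] := @MVT_segment R h h' 0 t t0 (fun s _ => dh s).
  apply: continuous_subspaceT => s; exact: is_derive_contR (dh s).
by rewrite in_itv /= => ct e; rewrite -subr_ge0 e subr0 mulr_ge0// h0.
Qed.

(** The mean value inequality with a variable bound g' on the speed. *)
Lemma derive_bound (f f' g g' : R -> R) (t : R) : 0 <= t ->
  (forall s : R, is_derive s 1 f (f' s)) -> (forall s : R, is_derive s 1 g (g' s)) ->
  (forall s, 0 <= s <= t -> `|f' s| <= g' s) -> `|f t - f 0| <= g t - g 0.
Proof.
move=> t0 df dg fg.
have h1 := derive_ge0_le t0 (h := fun s => f s + g s) (h' := fun s => f' s + g' s)
  (fun s => is_derive_addR (df s) (dg s)).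
have h2 := derive_ge0_le t0 (h := fun s => g s + - f s) (h' := fun s => g' s + - f' s)
  (fun s => is_derive_addR (dg s) (is_derive_oppR (df s))).
have {}h1 : f 0 + g 0 <= f t + g t.
  by apply: h1 => s /fg; rewrite ler_norml => /andP[? ?]; lra.
have {}h2 : g 0 - f 0 <= g t - f t.
  by apply: h2 => s /fg; rewrite ler_norml => /andP[? ?]; lra.
by rewrite ler_norml; apply/andP; split; lra.
Qed.

Lemma dominated_Rintegral (D : set R) (f_ : nat -> R -> R) (f g : R -> R) :
  measurable D -> (forall n, measurable_fun D (f_ n)) ->
  (forall x, D x -> f_ n x @[n --> \oo] --> f x) ->
  mu.-integrable D (EFin \o g) ->
  (forall n x, D x -> `|f_ n x| <= g x) ->
  mu.-integrable D (EFin \o f) /\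
  (\int[mu]_(x in D) f_ n x)%R @[n --> \oo] --> (\int[mu]_(x in D) f x)%R.
Proof.
move=> mD mf ff ig fg.
have mf' n : measurable_fun D (fun x => (f_ n x)%:E) by apply/measurable_EFinP.
have ff' x : D x -> (f_ n x)%:E @[n --> \oo] --> (f x)%:E.
  by move=> Dx; apply: cvg_EFin; [exact: nearW|exact: ff].
have mlim : measurable_fun D (fun x => (f x)%:E).
  by apply: emeasurable_fun_cvg ff' => m; exact: mf'.
have [||||| i1 _ i2] := @dominated_convergence _ _ _ mu D mD
    (fun n x => (f_ n x)%:E) (fun x => (f x)%:E) (fun x => (g x)%:E).
- exact: mf'.
- exact: mlim.
- by apply: aeW => x; exact: ff'.
- by [].
- by apply: aeW => x n Dx; rewrite lee_fin fg.
split=> //; apply: fine_cvg; rewrite /Rintegral fineK//.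
by apply: integrable_fin_num.
Qed.

Lemma is_derive_under (D : set R) (F dF : R -> R -> R) (G : R -> R) (u v a : R) :
  measurable D -> u < a < v ->
  (forall x, u < x < v -> mu.-integrable D (EFin \o F x)) ->
  (forall x y : R, u < x < v -> D y -> is_derive x 1 (F ^~ y) (dF x y)) ->
  (forall y, 0 <= G y) -> mu.-integrable D (EFin \o G) ->
  (forall x y, u < x < v -> D y -> `|dF x y| <= G y) ->
  is_derive a 1 (fun x => (\int[mu]_(y in D) F x y)%R) (\int[mu]_(y in D) dF a y)%R.
Proof.
move=> mD auv iF dFE G0 iG FG.
have pE x y : u < x < v -> D y -> partial1of2 F x y = dF x y.
  by move=> xuv Dy; rewrite /partial1of2 derive1E; have [] := dFE _ _ xuv Dy.
have H1 x : `]u, v[%classic x -> mu.-integrable D (EFin \o F x) by rewrite /= in_itv; exact: iF.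
have H2 x y : `]u, v[%classic x -> D y -> derivable (F ^~ y) x 1.
  by rewrite /= in_itv /= => xuv Dy; have [] := dFE _ _ xuv Dy.
have H3 x y : `]u, v[%classic x -> D y -> `|partial1of2 F x y| <= G y.
  by rewrite /= in_itv /= => xuv Dy; rewrite pE// FG.
have Ia : `]u, v[%classic a by rewrite /= in_itv.
apply: DeriveDef.
  exact: (@derivable_under_integral R _ _ mu F D mD a u v Ia H1 H2 G G0 iG H3).
rewrite -derive1E.
rewrite (@differentiation_under_integral R _ _ mu F D mD a u v Ia H1 H2 G G0 iG H3).
by apply: eq_Rintegral => y /set_mem Dy; exact: pE.
Qed.

Lemma integral_derive (Q q : R -> R) (a b : R) : a <= b ->
  (forall u : R, is_derive u 1 Q (q u)) -> continuous q ->
  (\int[mu]_(u in `[a, b]) q u)%R = Q b - Q a.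
Proof.
rewrite le_eqVlt => /predU1P[->|ab] dQ cq.
  by rewrite set_itv1 Rintegral_set1 subrr.
rewrite /Rintegral (@continuous_FTC2 R q Q)//.
- exact: continuous_subspaceT.
- split; first by move=> u _; apply: ex_derive.
  + by apply/cvg_at_right_filter; exact: is_derive_contR (dQ a).
  + by apply/cvg_at_left_filter; exact: is_derive_contR (dQ b).
- by move=> u _; rewrite derive1E; have [] := dQ u.
Qed.

Lemma integrable_itv (q : R -> R) (a b : R) : continuous q ->
  mu.-integrable `[a, b] (EFin \o q).
Proof.
move=> cq; apply: continuous_compact_integrable; first exact: segment_compact.
exact: continuous_subspaceT.
Qed.

Lemma Rintegral_cst_itv (a b c : R) : a <= b ->
  (\int[mu]_(x in `[a, b]) c)%R = (b - a) * c.
Proof.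
move=> ab; have h : fine (mu `[a, b]) = b - a.
  rewrite lebesgue_measure_itv /= lte_fin; case: ltP => //= ba.
  by apply/esym/eqP; rewrite subr_eq0 eq_le ba.
by rewrite Rintegral_cst// [X in _ * X]h mulrC.
Qed.

(** Green's formula on a rectangle: P and Q satisfy one Cauchy-Riemann
    equation, so that moving the line of integration of P costs only the values
    of Q at the two ends. *)
Lemma is_derive_shift_integral (P Q q : R -> R -> R) (a b u v e C : R) :
  a <= b -> u < e < v ->
  (forall x h : R, is_derive h 1 (P ^~ x) (- q h x)) ->
  (forall x h : R, is_derive x 1 (Q h) (q h x)) ->
  (forall h, continuous (q h)) -> (forall h, continuous (P h)) ->
  (forall x h, a <= x <= b -> u < h < v -> `|q h x| <= C) ->
  is_derive e 1 (fun h => (\int[mu]_(x in `[a, b]) P h x)%R) (Q e a - Q e b).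
Proof.
move=> ab euv dP dQ cq cP qC.
have h := @is_derive_under `[a, b] P (fun h x => - q h x) (fun=> `|C|) u v e.
apply: is_derive_eq.
  apply: h => //=.
  - by move=> x _; exact: integrable_itv.
  - by apply: integrable_itv => x; exact: cst_continuous.
  - move=> h x xuv; rewrite in_itv /= => xab; rewrite normrN.
    by rewrite (le_trans (qC _ _ xab xuv))// ler_norm.
rewrite -[RHS]opprB -(integral_derive ab (fun x => dQ x e) (cq e)).
rewrite -mulN1r -RintegralZl//; last exact: integrable_itv.
by apply: eq_Rintegral => x _; rewrite mulN1r.
Qed.

Lemma integrable_expRN (y k : R) : 0 < k ->
  mu.-integrable `[y, +oo[ (EFin \o (fun u => expR (- k * u))).
Proof.
move=> k0; have cE : continuous (fun u => expR (- k * u)).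
  move=> u; apply: (@is_derive_contR _ _ _ (expR (- k * u) * - k)).
  by is_derive_tac; rewrite /=; ring.
have dF (x : R) : is_derive x 1 (fun u => - k^-1 * expR (- k * u)) (expR (- k * x)).
  by is_derive_tac; rewrite /=; field; rewrite gt_eqF.
have mE : measurable_fun `[y, +oo[ (fun u => (expR (- k * u))%:E).
  apply/measurable_EFinP; apply: measurable_funTS; exact: continuous_measurable_fun.
apply/integrableP; split=> //.
under eq_integral do rewrite /= ger0_norm ?expR_ge0//.
rewrite (@ge0_continuous_FTC2y R _ (fun u => - k^-1 * expR (- k * u)) y 0).
- by rewrite -EFinD ltry.
- by move=> *; exact: expR_ge0.
- exact: continuous_subspaceT.
- rewrite -[X in _ --> X](mulr0 (- k^-1)); apply: cvgM; first exact: cvg_cst.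
  under eq_fun do rewrite mulNr.
  apply: (@cvg_comp _ _ _ ( *%R k) (fun z => expR (- z)) _ (pinfty_nbhs R)); last exact: cvgr_expR.
  exact: gt0_cvgMry.
- by move=> x _; have [] := dF x.
- by apply/cvg_at_right_filter; exact: (is_derive_contR (dF y)).
- by move=> x _; rewrite derive1E; have [] := dF x.
Qed.

End analysis_tools.

Section taylor.
Context {R : realType}.
Implicit Types x : R.

Definition sinh x : R := (expR x - expR (- x)) / 2.
Definition cosh x : R := (expR x + expR (- x)) / 2.

Lemma is_derive_sinh x : is_derive x 1 sinh (cosh x).
Proof. by rewrite /sinh /cosh; is_derive_tac; rewrite /=; ring. Qed.

Lemma is_derive_cosh x : is_derive x 1 cosh (sinh x).
Proof. by rewrite /sinh /cosh; is_derive_tac; rewrite /=; ring. Qed.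

Lemma sinh0 : sinh 0 = 0 :> R. Proof. by rewrite /sinh oppr0 subrr mul0r. Qed.
Lemma cosh0 : cosh 0 = 1 :> R. Proof. by rewrite /cosh oppr0 expR0; lra. Qed.

(** The polynomial bounds below come from one another by integration from 0. *)
Lemma sin_le x : 0 <= x -> sin x <= x.
Proof.
move=> x0; rewrite -subr_ge0.
have h := derive_ge0_le x0 (h := fun s => s - sin s) (h' := fun s => 1 - cos s).
rewrite /= sin0 subrr in h; notypeclasses refine (h _ _) => s; last by rewrite subr_ge0 cos_le1.
by is_derive_tac; rewrite /=; ring.
Qed.

Lemma cos_ge x : 0 <= x -> 1 - x ^+ 2 / 2 <= cos x.
Proof.
move=> x0; rewrite -subr_ge0.
have h := derive_ge0_le x0 (h := fun s => cos s - (1 - s ^+ 2 / 2)) (h' := fun s => s - sin s).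
rewrite /= cos0 expr0n mul0r subr0 subrr in h; notypeclasses refine (h _ _) => s; last first.
  by move=> /andP[s0 _]; rewrite subr_ge0 sin_le.
by is_derive_tac; rewrite /=; field.
Qed.

Lemma sin_ge x : 0 <= x -> x - x ^+ 3 / 6 <= sin x.
Proof.
move=> x0; rewrite -subr_ge0.
have h := derive_ge0_le x0 (h := fun s => sin s - (s - s ^+ 3 / 6))
  (h' := fun s => cos s - (1 - s ^+ 2 / 2)).
rewrite /= sin0 expr0n mul0r !subr0 in h; notypeclasses refine (h _ _) => s; last first.
  by move=> /andP[s0 _]; rewrite subr_ge0 cos_ge.
by is_derive_tac; rewrite /=; field.
Qed.

Lemma cos_le x : 0 <= x -> cos x <= 1 - x ^+ 2 / 2 + x ^+ 4 / 24.
Proof.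
move=> x0; rewrite -subr_ge0.
have h := derive_ge0_le x0 (h := fun s => 1 - s ^+ 2 / 2 + s ^+ 4 / 24 - cos s)
  (h' := fun s => sin s - (s - s ^+ 3 / 6)).
rewrite /= cos0 !expr0n !mul0r subr0 addr0 subrr in h; notypeclasses refine (h _ _) => s; last first.
  by move=> /andP[s0 _]; rewrite subr_ge0 sin_ge.
by is_derive_tac; rewrite /=; field.
Qed.

Lemma sin_le5 x : 0 <= x -> sin x <= x - x ^+ 3 / 6 + x ^+ 5 / 120.
Proof.
move=> x0; rewrite -subr_ge0.
have h := derive_ge0_le x0 (h := fun s => s - s ^+ 3 / 6 + s ^+ 5 / 120 - sin s)
  (h' := fun s => 1 - s ^+ 2 / 2 + s ^+ 4 / 24 - cos s).
rewrite /= sin0 !expr0n !mul0r !subr0 addr0 in h; notypeclasses refine (h _ _) => s; last first.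
  by move=> /andP[s0 _]; rewrite subr_ge0 cos_le.
by is_derive_tac; rewrite /=; field.
Qed.

Lemma cosh_ge1 x : 1 <= cosh x.
Proof.
have e : expR x * expR (- x) = 1 by rewrite -expRD subrr expR0.
rewrite /cosh ler_pdivlMr// mul1r.
move: (expR_gt0 x) (expR_gt0 (- x)) e; move: (expR x) (expR (- x)) => a b a0 b0 ab.
rewrite -(@ler_pXn2r _ 2) ?nnegrE ?(addr_ge0 (ltW a0) (ltW b0))//.
by have := sqr_ge0 (a - b); nra.
Qed.

Lemma sinh_ge x : 0 <= x -> x <= sinh x.
Proof.
move=> x0; rewrite -subr_ge0.
have h := derive_ge0_le x0 (h := fun s => sinh s - s) (h' := fun s => cosh s - 1).
rewrite /= sinh0 subrr in h; notypeclasses refine (h _ _) => s; last by rewrite subr_ge0 cosh_ge1.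
by have := is_derive_sinh s; move=> ?; is_derive_tac; rewrite /=; field.
Qed.

Lemma cosh_ge x : 0 <= x -> 1 + x ^+ 2 / 2 <= cosh x.
Proof.
move=> x0; rewrite -subr_ge0.
have h := derive_ge0_le x0 (h := fun s => cosh s - (1 + s ^+ 2 / 2))
  (h' := fun s => sinh s - s).
rewrite /= cosh0 expr0n mul0r addr0 subrr in h; notypeclasses refine (h _ _) => s; last first.
  by move=> /andP[s0 _]; rewrite subr_ge0 sinh_ge.
by have := is_derive_cosh s; move=> ?; is_derive_tac; rewrite /=; field.
Qed.

Lemma sinh_ge3 x : 0 <= x -> x + x ^+ 3 / 6 <= sinh x.
Proof.
move=> x0; rewrite -subr_ge0.
have h := derive_ge0_le x0 (h := fun s => sinh s - (s + s ^+ 3 / 6))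
  (h' := fun s => cosh s - (1 + s ^+ 2 / 2)).
rewrite /= sinh0 expr0n mul0r addr0 subrr in h; notypeclasses refine (h _ _) => s; last first.
  by move=> /andP[s0 _]; rewrite subr_ge0 cosh_ge.
by have := is_derive_sinh s; move=> ?; is_derive_tac; rewrite /=; field.
Qed.

(** A bound for cosh on [0, 1]; integrating it produces the remainder terms
    below. *)
Let K : R := expR 1.

Lemma cosh_leK x : 0 <= x <= 1 -> cosh x <= K.
Proof.
move=> /andP[x0 x1]; rewrite /cosh /K.
have h1 : expR x <= expR 1 by rewrite ler_expR.
have h2 : expR (- x) <= expR 1 by rewrite ler_expR; lra.
by lra.
Qed.

Lemma sinh_le1 x : 0 <= x <= 1 -> sinh x <= K * x.
Proof.
move=> /andP[x0 x1]; rewrite -subr_ge0.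
have h := derive_ge0_le x0 (h := fun s => K * s - sinh s) (h' := fun s => K - cosh s).
rewrite /= sinh0 mulr0 subrr in h; notypeclasses refine (h _ _) => s.
  by have := is_derive_sinh s; move=> ?; is_derive_tac; rewrite /=; field.
by move=> /andP[s0 s1]; rewrite subr_ge0 cosh_leK// s0 (le_trans s1).
Qed.

Lemma cosh_le2 x : 0 <= x <= 1 -> cosh x <= 1 + K * x ^+ 2 / 2.
Proof.
move=> /andP[x0 x1]; rewrite -subr_ge0.
have h := derive_ge0_le x0 (h := fun s => 1 + K * s ^+ 2 / 2 - cosh s)
  (h' := fun s => K * s - sinh s).
rewrite /= cosh0 expr0n mulr0 mul0r addr0 subrr in h; notypeclasses refine (h _ _) => s.
  by have := is_derive_cosh s; move=> ?; is_derive_tac; rewrite /=; field.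
by move=> /andP[s0 s1]; rewrite subr_ge0 sinh_le1// s0 (le_trans s1).
Qed.

Lemma sinh_le3 x : 0 <= x <= 1 -> sinh x <= x + K * x ^+ 3 / 6.
Proof.
move=> /andP[x0 x1]; rewrite -subr_ge0.
have h := derive_ge0_le x0 (h := fun s => s + K * s ^+ 3 / 6 - sinh s)
  (h' := fun s => 1 + K * s ^+ 2 / 2 - cosh s).
rewrite /= sinh0 expr0n mulr0 mul0r addr0 subrr in h; notypeclasses refine (h _ _) => s.
  by have := is_derive_sinh s; move=> ?; is_derive_tac; rewrite /=; field.
by move=> /andP[s0 s1]; rewrite subr_ge0 cosh_le2// s0 (le_trans s1).
Qed.

Lemma cosh_le4 x : 0 <= x <= 1 -> cosh x <= 1 + x ^+ 2 / 2 + K * x ^+ 4 / 24.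
Proof.
move=> /andP[x0 x1]; rewrite -subr_ge0.
have h := derive_ge0_le x0 (h := fun s => 1 + s ^+ 2 / 2 + K * s ^+ 4 / 24 - cosh s)
  (h' := fun s => s + K * s ^+ 3 / 6 - sinh s).
rewrite /= cosh0 !expr0n mulr0 !mul0r !addr0 subrr in h; notypeclasses refine (h _ _) => s.
  by have := is_derive_cosh s; move=> ?; is_derive_tac; rewrite /=; field.
by move=> /andP[s0 s1]; rewrite subr_ge0 sinh_le3// s0 (le_trans s1).
Qed.

Lemma sinh_le5 x : 0 <= x <= 1 -> sinh x <= x + x ^+ 3 / 6 + K * x ^+ 5 / 120.
Proof.
move=> /andP[x0 x1]; rewrite -subr_ge0.
have h := derive_ge0_le x0 (h := fun s => s + s ^+ 3 / 6 + K * s ^+ 5 / 120 - sinh s)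
  (h' := fun s => 1 + s ^+ 2 / 2 + K * s ^+ 4 / 24 - cosh s).
rewrite /= sinh0 !expr0n mulr0 !mul0r !addr0 subrr in h; notypeclasses refine (h _ _) => s.
  by have := is_derive_sinh s; move=> ?; is_derive_tac; rewrite /=; field.
by move=> /andP[s0 s1]; rewrite subr_ge0 cosh_le4// s0 (le_trans s1).
Qed.

(** The Taylor bound is enough up to 2, and beyond that point cos x is below
    cos 2 <= - 1/3. *)
Lemma one_minus_cos_ge x : 0 <= x <= pi -> x ^+ 2 / 12 <= 1 - cos x.
Proof.
move=> /andP[x0 xpi]; have pi4 : pi < 4 :> R by have := @pihalf_lt2 R; lra.
have [x2|x2] := leP x 2.
  have x4 : x ^+ 4 = x ^+ 2 * x ^+ 2 by rewrite -exprD.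
  have xx : x ^+ 2 <= 4 by rewrite expr2; nra.
  have xx0 : 0 <= x ^+ 2 by exact: sqr_ge0.
  by have := cos_le x0; rewrite x4; move: (x ^+ 2) xx xx0 (cos x) => X *; nra.
have c2 : cos 2 <= 1 - 2 ^+ 2 / 2 + 2 ^+ 4 / 24 :> R by apply: cos_le.
have pi2 : 2 <= pi :> R by exact: pi_ge2.
have : cos x < cos 2 by rewrite ltr_cos ?in_itv /= ?x0 ?xpi ?pi2 ?ler0n.
have xx : x ^+ 2 <= 16 by rewrite expr2; nra.
lra.
Qed.

End taylor.

(** * Bessel functions of integer order *)

Section bessel.
Context {R : realType}.
Local Notation mu := (@lebesgue_measure R).
Implicit Types (n : int) (t h x : R).

Lemma sin_intpi n : sin (n%:~R * pi) = 0 :> R.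
Proof.
suff h k : sin (k%:R * pi) = 0 :> R.
  by case: n => k; [exact: h|rewrite NegzE mulrNz mulNr sinN h oppr0].
elim: k => [|k ih]; first by rewrite mul0r sin0.
by rewrite -[k.+1]addn1 natrD mulrDl mul1r sinDpi ih oppr0.
Qed.

(** The Bessel function J_n at the argument 2 t. *)
Definition bessel n t : R :=
  pi^-1 * (\int[mu]_(x in `[0, pi]) cos (n%:~R * x - 2 * t * sin x))%R.

(** Modulus and argument of exp(i (n z - 2 t sin z)) at z = x + i h. *)
Definition bessel_mod n t h x : R :=
  expR (- n%:~R * h + 2 * t * sinh h * cos x).

Definition bessel_arg n t h x : R := n%:~R * x - 2 * t * cosh h * sin x.

(** The line of integration can be moved to any height h: the vertical sides at
    0 and pi contribute nothing, because the imaginary part of exp(i (n z - 2 t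
    sin z)) vanishes there. *)
Lemma bessel_shift n t h :
  bessel n t = pi^-1 *
    (\int[mu]_(x in `[0, pi]) (bessel_mod n t h x * cos (bessel_arg n t h x)))%R.
Proof.
congr (_ * _).
pose P h x := bessel_mod n t h x * cos (bessel_arg n t h x).
pose Q h x := bessel_mod n t h x * sin (bessel_arg n t h x).
pose q h x := bessel_mod n t h x * ((- 2 * t * sinh h * sin x) * sin (bessel_arg n t h x) +
  (n%:~R - 2 * t * cosh h * cos x) * cos (bessel_arg n t h x)).
pose G h := (\int[mu]_(x in `[0, pi]) P h x)%R.
have -> : (\int[mu]_(x in `[0, pi]) cos (n%:~R * x - 2 * t * sin x))%R = G 0.
  apply: eq_Rintegral => x _; rewrite /P /bessel_mod /bessel_arg sinh0 cosh0.
  by rewrite !mulr0 mul0r addr0 expR0 mul1r mulr1.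
have dP (x h0 : R) : is_derive h0 1 (P ^~ x) (- q h0 x).
  have ds := is_derive_sinh h0; have dc := is_derive_cosh h0.
  by rewrite /P /q /bessel_mod /bessel_arg; is_derive_tac; rewrite /=; ring.
have dQ (x h0 : R) : is_derive x 1 (Q h0) (q h0 x).
  by rewrite /Q /q /bessel_mod /bessel_arg; is_derive_tac; rewrite /=; ring.
have cP h0 : continuous (P h0).
  by rewrite /P /bessel_mod /bessel_arg; continuous_tac.
have cq h0 : continuous (q h0).
  by rewrite /q /bessel_mod /bessel_arg; continuous_tac.
have dG (e : R) : is_derive e 1 G 0.
  (* The bound is only used to differentiate under the integral sign, on a
     neighbourhood of e of radius 1. *)
  pose H := `|e| + 1; pose N : R := `|n%:~R|; pose E := expR H.
  have H0 : 0 <= H by rewrite addr_ge0.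
  have sE h0 : `|h0| <= H -> `|sinh h0| <= E /\ `|cosh h0| <= E.
    rewrite ler_norml => /andP[h1 h2].
    have a1 : expR h0 <= E by rewrite ler_expR.
    have a2 : expR (- h0) <= E by rewrite ler_expR; lra.
    have := expR_gt0 h0; have := expR_gt0 (- h0) => b1 b2.
    by split; rewrite ler_norml /sinh /cosh; apply/andP; split; lra.
  have := @is_derive_shift_integral R P Q q 0 pi (e - 1) (e + 1) e
    (expR (N * H + 2 * `|t| * E) * (2 * `|t| * E + (N + 2 * `|t| * E))) (pi_ge0 R).
  have -> : Q e 0 - Q e pi = 0.
    rewrite /Q /bessel_arg mulr0 sin0 sinpi !mulr0 !subr0 sin0 mulr0 sub0r.
    rewrite sin_intpi mulr0 oppr0//.
  apply => //; first by apply/andP; split; lra.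
  move=> x h0 _ /andP[h1 h2].
  have hH : `|h0| <= H.
    have := ler_norm e; have := ler_norm (- e); rewrite normrN => ? ?.
    by rewrite ler_norml /H; apply/andP; split; lra.
  have [s1 s2] := sE _ hH.
  have bT (a b : R) : `|a| <= E -> `|b| <= 1 -> `|2 * t * a * b| <= 2 * `|t| * E.
    move=> aE b1; rewrite !normrM ger0_norm//.
    rewrite -[leRHS]mulr1; by apply: ler_pM => //; rewrite ?mulr_ge0 ?ler_wpM2l ?mulr_ge0.
  rewrite /q normrM; apply: ler_pM => //.
    rewrite /bessel_mod ger0_norm ?expR_ge0// ler_expR.
    apply: (le_trans (ler_norm _)); apply: (le_trans (ler_normD _ _)).
    apply: lerD; first by rewrite normrM normrN ler_wpM2l// normr_ge0.
    exact: bT (cos_max _).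
  apply: (le_trans (ler_normD _ _)); apply: lerD.
    rewrite normrM -[leRHS]mulr1; apply: ler_pM => //; last exact: sin_max.
    by rewrite !mulNr normrN; exact: bT (sin_max _).
  rewrite normrM -[leRHS]mulr1; apply: ler_pM => //; last exact: cos_max.
  apply: (le_trans (ler_normB _ _)); apply: lerD => //.
  exact: bT (cos_max _).
exact: (@is_derive_0_is_cst _ G 0 h dG).
Qed.

(** The height h is free, and its sign selects the direction of decay in n. *)
Lemma bessel_le n t h : `|bessel n t| <= expR (- n%:~R * h + 2 * `|t| * `|sinh h|).
Proof.
rewrite (bessel_shift n t h) normrM ger0_norm ?invr_ge0 ?pi_ge0//.
rewrite ler_pdivrMl ?pi_gt0//.
set P := (X in Rintegral _ _ X).
have cP : continuous P.
  by rewrite /P /bessel_mod /bessel_arg; continuous_tac.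
have iP := @integrable_itv R P 0 pi cP.
apply: (le_trans (le_normr_Rintegral _ _)) => //=.
set M := expR _.
have -> : pi * M = (\int[mu]_(x in `[0, pi]) M)%R.
  by rewrite Rintegral_cst_itv ?pi_ge0// subr0.
apply: le_Rintegral => //.
- exact: (integrable_norm iP).
- by apply: integrable_itv => x; exact: cst_continuous.
move=> x _; rewrite /P normrM -[leRHS]mulr1; apply: ler_pM => //; last exact: cos_max.
rewrite /bessel_mod ger0_norm ?expR_ge0// ler_expR lerD2l.
apply: (le_trans (ler_norm _)); rewrite !normrM (@ger0_norm _ 2)//.
by rewrite -[leRHS]mulr1 ler_wpM2l ?mulr_ge0// cos_max.
Qed.

Lemma is_derive_bessel n t :
  is_derive t 1 (bessel n) (bessel (n - 1) t - bessel (n + 1) t).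
Proof.
pose F s x := cos (n%:~R * x - 2 * s * sin x).
pose dF s x := cos ((n - 1)%:~R * x - 2 * s * sin x) - cos ((n + 1)%:~R * x - 2 * s * sin x).
have cF (m : int) s : continuous (fun x => cos (m%:~R * x - 2 * s * sin x)).
  by continuous_tac.
have h := @is_derive_under R `[0, pi] F dF (fun=> 2) (t - 1) (t + 1) t.
have {h} dI : is_derive t 1 (fun s => (\int[mu]_(x in `[0, pi]) F s x)%R)
    (\int[mu]_(x in `[0, pi]) dF t x)%R.
  apply: h => //=.
  - by apply/andP; split; lra.
  - by move=> s _; apply: integrable_itv; exact: cF.
  - move=> s x _ _; rewrite /F /dF.
    have -> : (n - 1)%:~R * x - 2 * s * sin x = (n%:~R * x - 2 * s * sin x) - x.
      by rewrite rmorphB rmorph1; ring.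
    have -> : (n + 1)%:~R * x - 2 * s * sin x = (n%:~R * x - 2 * s * sin x) + x.
      by rewrite rmorphD rmorph1; ring.
    by is_derive_tac; rewrite /= (cosB _ x) (cosD _ x); ring.
  - by apply: integrable_itv => x; exact: cst_continuous.
  - move=> s x _ _; apply: (le_trans (ler_normB _ _)).
    by apply: (le_trans (lerD (cos_max _) (cos_max _))); lra.
have := is_derive_mulR (is_derive_cstR t pi^-1) dI; rewrite mul0r add0r => d.
rewrite /bessel; apply: (is_derive_eq d).
by rewrite -mulrBr /dF RintegralB//; apply: integrable_itv; exact: cF.
Qed.

Lemma bessel0 n : bessel n 0 = (n == 0)%:R.
Proof.
rewrite /bessel; under eq_Rintegral do rewrite mulr0 mul0r subr0.
have [->|n0] := eqVneq n 0.
  under eq_Rintegral do rewrite mul0r cos0.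
  by rewrite Rintegral_cst_itv ?pi_ge0// subr0 mulr1 mulVf// gt_eqF// pi_gt0.
have n0' : n%:~R != 0 :> R by rewrite intr_eq0.
have d (x : R) : is_derive x 1 (fun x => n%:~R^-1 * sin (n%:~R * x)) (cos (n%:~R * x)).
  by is_derive_tac; rewrite /=; field.
rewrite (integral_derive (pi_ge0 R) d); last first.
  by continuous_tac.
by rewrite sin_intpi !mulr0 sin0 mulr0 subrr mulr0.
Qed.

(** The partial sums of the orthogonality relation between the translates of
    the Bessel sequence telescope when differentiated in time, which leaves
    exponentially small boundary terms. *)
Definition bessel_window (i j : int) (L : nat) t : R :=
  \sum_(p < L) (bessel (i - 1 - p%:Z) t * bessel (j - 1 - p%:Z) t +
                bessel (i + p%:Z) t * bessel (j + p%:Z) t).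

Definition bessel_flux (i j : int) t : R :=
  bessel i t * bessel (j + 1) t + bessel (i + 1) t * bessel j t.

Lemma is_derive_bessel_window i j L t : is_derive t 1 (bessel_window i j L)
  (bessel_flux (i - 1 - L%:Z) (j - 1 - L%:Z) t - bessel_flux (i - 1 + L%:Z) (j - 1 + L%:Z) t).
Proof.
elim: L => [|L ih].
  rewrite /bessel_window; under eq_fun do rewrite big_ord0.
  apply: (is_derive_eq (is_derive_cstR t 0)).
  have e (k : int) : k - 1 - 0%:Z = k - 1 + 0%:Z by lia.
  by rewrite !e subrr.
rewrite /bessel_window; under eq_fun do rewrite big_ord_recr /=.
have b n := is_derive_bessel n t.
have d1 := is_derive_mulR (b (i - 1 - L%:Z)) (b (j - 1 - L%:Z)).
have d2 := is_derive_mulR (b (i + L%:Z)) (b (j + L%:Z)).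
apply: (is_derive_eq (is_derive_addR ih (is_derive_addR d1 d2))).
rewrite /bessel_flux.
have e1 (k : int) : k - 1 - L.+1%:Z = k - 1 - L%:Z - 1 by rewrite intS; ring.
have e2 (k : int) : k - 1 + L.+1%:Z = k + L%:Z by rewrite intS; ring.
have e3 (k : int) : k - 1 + L%:Z = k + L%:Z - 1 by ring.
have e4 (k : int) : k - 1 - L%:Z - 1 + 1 = k - 1 - L%:Z by ring.
have e5 (k : int) : k + L%:Z - 1 + 1 = k + L%:Z by ring.
by rewrite !e1 !e2 !e3 !e4 !e5; ring.
Qed.

Lemma sinhN x : sinh (- x) = - sinh x.
Proof. by rewrite /sinh opprK; lra. Qed.

Lemma bessel_flux_le i j t h : `|h| = 1 -> `|bessel_flux i j t| <=
  2 * expR (4 * `|t| * sinh 1) * expR (- h * (i + j + 1)%:~R).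
Proof.
move=> h1; have sh : `|sinh h| = sinh 1.
  have s1 : 0 <= sinh 1 :> R by rewrite (le_trans ler01)// sinh_ge.
  have [h0|h0] := lerP 0 h.
    by rewrite (_ : h = 1) ?ger0_norm// -h1 ger0_norm.
  rewrite (_ : h = - 1) ?sinhN ?normrN ?ger0_norm//.
  by rewrite -h1 ltr0_norm// opprK.
have b := bessel_le _ t h; rewrite sh in b.
have bb k l : k + l = i + j + 1 -> `|bessel k t * bessel l t| <=
    expR (4 * `|t| * sinh 1) * expR (- h * (i + j + 1)%:~R).
  move=> kl; rewrite normrM; apply: (le_trans (ler_pM _ _ (b k) (b l))) => //.
  by rewrite -!expRD ler_expR -kl intrD; lra.
apply: (le_trans (ler_normD _ _)); rewrite -mulrA mulr_natl mulr2n.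
by apply: lerD; apply: bb; ring.
Qed.

(** At time zero only the index 0 contributes, and it occurs exactly once among
    the indices i - 1 - p and i + p with p < L. *)
Lemma bessel_window0 i j L : (`|i|%N < L)%N -> bessel_window i j L 0 = (i == j)%:R.
Proof.
move=> iL; rewrite /bessel_window.
under eq_bigr do rewrite !bessel0 -!natrM !mulnb -natrD.
have [<-|ij] := eqVneq i j; last first.
  rewrite big1// => p _.
  have e c : (c + i == 0) && (c + j == 0) = false.
    by apply/negbTE/negP => /andP[/eqP h1 /eqP h2]; move/eqP: ij; apply; lia.
  have f1 (k : int) : k - 1 - p%:Z = (- 1 - p%:Z) + k by lia.
  by rewrite !f1 ![_ + p%:Z]addrC !e.
have [p pE] : {p : 'I_L | forall q : 'I_L,
   ((i - 1 - q%:Z == 0)%R + (i + q%:Z == 0)%R)%N = (q == p)}.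
  have [i0|i0] := lerP 1 i.
    have pL : (`|i - 1|%N < L)%N by lia.
    exists (Ordinal pL) => q; rewrite -val_eqE /=.
    by have [|] := eqVneq (i - 1 - q%:Z) 0; have [|] := eqVneq (i + q%:Z) 0; lia.
  have pL : (`|i|%N < L)%N by lia.
  exists (Ordinal pL) => q; rewrite -val_eqE /=.
  by have [|] := eqVneq (i - 1 - q%:Z) 0; have [|] := eqVneq (i + q%:Z) 0; lia.
under eq_bigr => q _ do rewrite !andbb pE.
rewrite (bigD1 p)//= eqxx big1 ?addr0// => q /negbTE ->//.
Qed.

(** The relation is exact at time zero once L exceeds the absolute value of i;
    later the flux through the two ends of the window is of order exp(- 2 L).
    *)
Lemma bessel_window_cvg i j t : 0 <= t ->
  bessel_window i j L t @[L --> \oo] --> ((i == j)%:R : R).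
Proof.
move=> t0; pose E : R := expR (4 * t * sinh 1); pose k := (i + j - 1)%:~R : R.
pose C := 2 * E * (expR k + expR (- k)).
have bnd L : (`|i|%N < L)%N ->
    `|bessel_window i j L t - (i == j)%:R| <= C * t * expR (- 2) ^+ L.
  move=> iL; rewrite -(bessel_window0 j iL).
  have dg (s : R) : is_derive s 1 (fun s => C * expR (- 2) ^+ L * s) (C * expR (- 2) ^+ L).
    exact: is_derive_scaleR.
  have := derive_bound t0 (is_derive_bessel_window i j L) dg _.
  rewrite mulr0 subr0 -[in leRHS]mulrA [_ ^+ _ * t]mulrC mulrA; apply.
  move=> s /andP[s0 st].
  have s1 : 0 <= sinh 1 :> R by rewrite (le_trans ler01)// sinh_ge.
  have sE : expR (4 * `|s| * sinh 1) <= E.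
    by rewrite ler_expR ger0_norm// ler_wpM2r// ler_wpM2l.
  have eL : expR (- 2) ^+ L = expR (- 2 * L%:R) :> R by rewrite mulrC expRM_natl.
  rewrite (le_trans (ler_normB _ _))// /C mulrDr mulrDl; apply: lerD.
    apply: (le_trans (@bessel_flux_le _ _ s (-1) _)); first by rewrite normrN normr1.
    rewrite -[leRHS]mulrA; apply: ler_pM; rewrite ?mulr_ge0 ?expR_ge0// ?ler_wpM2l//.
    rewrite eL -expRD ler_expR /k.
    have -> : i - 1 - L%:Z + (j - 1 - L%:Z) + 1 = i + j - 1 - 2 * L%:Z by ring.
    by rewrite opprK mul1r intrB intrM; lra.
  apply: (le_trans (@bessel_flux_le _ _ s 1 _)); first by rewrite normr1.
  rewrite -[leRHS]mulrA; apply: ler_pM; rewrite ?mulr_ge0 ?expR_ge0// ?ler_wpM2l//.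
  rewrite eL -expRD ler_expR /k.
  have -> : i - 1 + L%:Z + (j - 1 + L%:Z) + 1 = i + j - 1 + 2 * L%:Z by ring.
  by rewrite intrD intrM; lra.
apply/subr_cvg0; apply: norm_cvg0.
have cg : C * t * expR (- 2) ^+ L @[L --> \oo] --> 0.
  rewrite -[X in _ --> X](mulr0 (C * t)); apply: cvgM; first exact: cvg_cst.
  by apply: cvg_expr; rewrite ger0_norm ?expR_ge0// expR_lt1 oppr_lt0.
apply: (squeeze_cvgr _ (cvg_cst 0) cg).
by exists (`|i|%N).+1 => // L /= iL; rewrite normr_ge0 bnd.
Qed.

End bessel.

(** * Bessel functions at the edge *)

Section edge_scaling.
Context {R : realType}.
Local Notation mu := (@lebesgue_measure R).
Implicit Types (n m : int) (a r u x : R).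

Lemma integral_dilation (f : R -> R) a : continuous f -> 0 < a ->
  a * (\int[mu]_(x in `[0, pi]) f x)%R = (\int[mu]_(u in `[0, (pi * a)%R]) f (u / a))%R.
Proof.
move=> cf a0; have pa : 0 <= pi * a by rewrite mulr_ge0 ?pi_ge0 ?ltW.
have dF (x : R) : is_derive x 1 (fun u => u / a) a^-1.
  by is_derive_tac; rewrite /=; ring.
have dFE : derive1 (fun u : R => u / a) = fun=> a^-1.
  by apply/funext => x; rewrite derive1E; have [] := dF x.
have := @integration_by_substitution_increasing R (fun u => u / a) f 0 (pi * a) pa.
rewrite mul0r mulfK ?gt_eqF// dFE => h.
have {}h : (\int[mu]_(x in `[0%R, pi]) (f x)%:E =
    \int[mu]_(x in `[0%R, (pi * a)%R]) (f (x / a) * a^-1)%:E)%E.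
  apply: h => //.
  - by move=> x y _ _ xy; rewrite ltr_pM2r// invr_gt0.
  - by move=> x _; exact: cst_continuous.
  - exact: is_cvg_cst.
  - exact: is_cvg_cst.
  - split; first by move=> x _; have [] := dF x.
    + by apply/cvg_at_right_filter; exact: is_derive_contR (dF 0).
    + by apply/cvg_at_left_filter; exact: is_derive_contR (dF (pi * a)).
  - exact: continuous_subspaceT.
rewrite {1}/Rintegral h -/(Rintegral _ _ _) RintegralZr//; last first.
  apply: integrable_itv => x; apply: continuous_comp; last exact: cf.
  exact: is_derive_contR (dF x).
by rewrite mulrCA mulfV ?gt_eqF// mulr1.
Qed.

(** The integrand of the Bessel function of order m at time a^3, on the line of
    height 1/a and in the variable u = a x. *)
Definition edge_integrand a m u : R :=
  bessel_mod m (a ^+ 3) a^-1 (u / a) * cos (bessel_arg m (a ^+ 3) a^-1 (u / a)).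

Lemma bessel_edge a m : 0 < a -> a * bessel m (a ^+ 3) =
  pi^-1 * (\int[mu]_(u in `[0, +oo[) ((edge_integrand a m) \_ (`[0%R, (pi * a)%R])) u)%R.
Proof.
move=> a0; rewrite (bessel_shift m (a ^+ 3) a^-1) mulrCA; congr (_ * _).
rewrite integral_dilation//; last first.
  by rewrite /bessel_mod /bessel_arg; continuous_tac.
rewrite -Rintegral_mkcondr.
have -> // : [set` `[0, +oo[] `&` [set` `[0, pi * a]] = [set` `[0, pi * a]] :> set R.
apply/seteqP; split=> x /=; first by case.
by move=> h; split=> //; move: h; rewrite !in_itv /= => /andP[->].
Qed.

Definition edge_const : R := expR (expR 1 / 3 + 3 / 2).

(** With r = (m - 2 a^3) / a, the logarithm of the modulus is - r + 2 a^3
    (sinh(1/a) - 1/a) - 2 a^3 sinh(1/a) (1 - cos(u/a)). The middle term is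
    bounded, and the last one is at most - u^2/6 <= 3/2 - u. *)
Lemma edge_integrand_le a m u : 1 <= a -> 0 <= u ->
  `|((edge_integrand a m) \_ (`[0%R, (pi * a)%R])) u| <=
  edge_const * expR (- ((m%:~R - 2 * a ^+ 3) / a)) * expR (- 1 * u).
Proof.
move=> a1 u0; have a0 : 0 < a by exact: lt_le_trans a1.
rewrite patchE; case: ifP; last by rewrite normr0 !mulr_ge0// expR_ge0.
rewrite mem_setE in_itv /= u0 /= => ua.
rewrite /edge_integrand normrM -[leRHS]mulr1; apply: ler_pM => //; last exact: cos_max.
rewrite /bessel_mod ger0_norm ?expR_ge0// /edge_const -!expRD ler_expR.
have ai1 : 0 <= a^-1 <= 1 by rewrite invr_ge0 ltW//= invf_le1.
have c1 : (u / a) ^+ 2 / 12 <= 1 - cos (u / a).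
  by apply: one_minus_cos_ge; rewrite divr_ge0 ?(ltW a0)// ler_pdivrMr.
have s1 : a^-1 <= sinh a^-1 by apply: sinh_ge; case/andP: ai1.
have s2 := sinh_le3 ai1.
set s := sinh a^-1 in s1 s2 *; set c := cos (u / a) in c1 *; set K := expR 1 in s2 *.
have h1 : 2 * a ^+ 3 * s - 2 * a ^+ 2 <= K / 3.
  have -> : K / 3 = 2 * a ^+ 3 * (a^-1 + K * a^-1 ^+ 3 / 6) - 2 * a ^+ 2.
    by field; rewrite gt_eqF.
  by rewrite lerD2r ler_pM2l// mulr_gt0// exprn_gt0.
have h2 : u ^+ 2 / 6 <= 2 * a ^+ 3 * s * (1 - c).
  have -> : u ^+ 2 / 6 = 2 * a ^+ 3 * a^-1 * ((u / a) ^+ 2 / 12).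
    by field; rewrite gt_eqF.
  apply: ler_pM => //; first by rewrite !mulr_ge0 ?exprn_ge0// ?invr_ge0 ltW.
    by rewrite divr_ge0// sqr_ge0.
  by rewrite ler_pM2l// mulr_gt0// exprn_gt0.
have h3 : 0 <= (u - 3) ^+ 2 by exact: sqr_ge0.
have -> : - ((m%:~R - 2 * a ^+ 3) / a) = - m%:~R * a^-1 + 2 * a ^+ 2.
  by field; rewrite gt_eqF.
nra.
Qed.

Lemma measurable_edge_integrand a m :
  measurable_fun (`[0%R, +oo[%classic : set R) ((edge_integrand a m) \_ (`[0%R, (pi * a)%R])).
Proof.
apply: measurable_funTS; apply/(measurable_restrictT _ _).1 => //.
apply: measurable_funTS; apply: continuous_measurable_fun.
by rewrite /edge_integrand /bessel_mod /bessel_arg; continuous_tac.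
Qed.

Definition edge_bound : R :=
  pi^-1 * edge_const * (\int[mu]_(u in `[0, +oo[) expR (- 1 * u))%R.

Lemma bessel_edge_le a m : 1 <= a ->
  `|a * bessel m (a ^+ 3)| <= edge_bound * expR (- ((m%:~R - 2 * a ^+ 3) / a)).
Proof.
move=> a1; have a0 : 0 < a by exact: lt_le_trans a1.
rewrite bessel_edge// normrM ger0_norm ?invr_ge0 ?pi_ge0//.
rewrite /edge_bound -!mulrA ler_wpM2l ?invr_ge0 ?pi_ge0//.
set D : set R := `[0, +oo[%classic; have mD : measurable D by exact: measurable_itv.
have iE := @integrable_expRN R 0 1 ltr01.
set E := expR (- (_ / _)).
have iE' : mu.-integrable D (EFin \o (fun u => edge_const * E * expR (- 1 * u))).
  rewrite (_ : EFin \o _ = fun u => ((edge_const * E)%:E * (expR (- 1 * u))%:E)%E).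
    exact: integrableZl.
  by apply/funext => u; rewrite /= EFinM.
have iP : mu.-integrable D (EFin \o ((edge_integrand a m) \_ (`[0%R, (pi * a)%R]))).
  apply: (@le_integrable _ _ _ mu D mD _ (EFin \o (fun u => edge_const * E * expR (- 1 * u)))) => //=.
    by apply/measurable_EFinP; exact: measurable_edge_integrand.
  move=> u; rewrite /D /= in_itv /= andbT => u0; rewrite lee_fin.
  rewrite (@ger0_norm _ (_ * expR _)) ?mulr_ge0 ?expR_ge0//.
  exact: edge_integrand_le.
apply: (le_trans (le_normr_Rintegral _ _)) => //.
have -> : edge_const * ((\int[mu]_(u in D) expR (- 1 * u))%R * E) =
    (\int[mu]_(u in D) (edge_const * E * expR (- 1 * u)))%R.
  by rewrite RintegralZl// -mulrA (mulrC E).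
apply: le_Rintegral => //; first exact: (integrable_norm iP).
by move=> u; rewrite /D /= in_itv /= andbT => u0; exact: edge_integrand_le.
Qed.

(** The real part of exp(i (z^3/3 + r z)) at z = u + i. *)
Definition airy_integrand r u : R :=
  expR (3^-1 - r - u ^+ 2) * cos (u ^+ 3 / 3 - u + r * u).

Definition airy_shift r : R := pi^-1 * (\int[mu]_(u in `[0, +oo[) airy_integrand r u)%R.

Section limit.
Variables (a : nat -> R) (m : nat -> int) (r lo : R).
Hypothesis a1 : forall k, 1 <= a k.
Hypothesis ay : (a k)^-1 @[k --> \oo] --> (0 : R).
Hypothesis mr : ((m k)%:~R - 2 * a k ^+ 3) / a k @[k --> \oo] --> r.
Hypothesis mlo : forall k, lo <= ((m k)%:~R - 2 * a k ^+ 3) / a k.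

Let a0 k : 0 < a k. Proof. exact: lt_le_trans (a1 k). Qed.

Let ai k : 0 <= (a k)^-1 <= 1. Proof. by rewrite invr_ge0 ltW//= invf_le1. Qed.

Let cvg_err c e : c + e * (a k)^-1 ^+ 2 @[k --> \oo] --> c.
Proof.
rewrite -[X in _ --> X]addr0 -[X in _ --> _ + X](mulr0 e).
apply: cvgD; first exact: cvg_cst.
apply: cvgM; first exact: cvg_cst.
rewrite -[X in _ --> X](mulr0 0).
by under eq_fun do rewrite expr2; exact: cvgM.
Qed.

Let sinh_lim : a k ^+ 3 * sinh (a k)^-1 - a k ^+ 2 @[k --> \oo] --> (6^-1 : R).
Proof.
apply: (squeeze_cvgr _ (cvg_cst _) (@cvg_err 6^-1 (expR 1 / 120))).
apply: nearW => k; have ak := a0 k; have akn : a k != 0 by rewrite gt_eqF.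
have a3 : 0 < a k ^+ 3 by rewrite exprn_gt0.
have /andP[i0 _] := ai k.
have := sinh_ge3 i0; have := sinh_le5 (ai k).
rewrite -(ler_pM2l a3) => h1; rewrite -(ler_pM2l a3) => h2.
apply/andP; split.
  rewrite lerBrDr (le_trans _ h2)// le_eqVlt; apply/orP; left; apply/eqP.
  by field.
rewrite lerBlDr (le_trans h1)// le_eqVlt; apply/orP; left; apply/eqP.
by field.
Qed.

Let cosh_lim : a k ^+ 2 * (cosh (a k)^-1 - 1) @[k --> \oo] --> (2^-1 : R).
Proof.
apply: (squeeze_cvgr _ (cvg_cst _) (@cvg_err 2^-1 (expR 1 / 24))).
apply: nearW => k; have ak := a0 k; have akn : a k != 0 by rewrite gt_eqF.
have a2 : 0 < a k ^+ 2 by rewrite exprn_gt0.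
have /andP[i0 _] := ai k.
have := cosh_ge i0; have := cosh_le4 (ai k).
rewrite -(ler_pM2l a2) => h1; rewrite -(ler_pM2l a2) => h2.
rewrite mulrBr mulr1; apply/andP; split.
  rewrite lerBrDr (le_trans _ h2)// le_eqVlt; apply/orP; left; apply/eqP.
  by field.
rewrite lerBlDr (le_trans h1)// le_eqVlt; apply/orP; left; apply/eqP.
by field.
Qed.

Let cos_lim u : 0 <= u -> a k ^+ 2 * (1 - cos (u / a k)) @[k --> \oo] --> u ^+ 2 / 2.
Proof.
move=> u0; apply: (squeeze_cvgr _ (@cvg_err (u ^+ 2 / 2) (- (u ^+ 4 / 24))) (cvg_cst _)).
apply: nearW => k; have ak := a0 k; have akn : a k != 0 by rewrite gt_eqF.
have a2 : 0 < a k ^+ 2 by rewrite exprn_gt0.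
have uk : 0 <= u / a k by rewrite divr_ge0// ltW.
have := cos_ge uk; have := cos_le uk.
rewrite -(ler_pM2l a2) => h1; rewrite -(ler_pM2l a2) => h2.
rewrite mulrBr mulr1; apply/andP; split.
  rewrite lerBrDr addrC -lerBrDr (le_trans h1)// le_eqVlt; apply/orP; left; apply/eqP.
  by field.
rewrite lerBlDr addrC -lerBlDr (le_trans _ h2)// le_eqVlt; apply/orP; left; apply/eqP.
by field.
Qed.

Let sin_lim u : 0 <= u -> a k ^+ 3 * (u / a k - sin (u / a k)) @[k --> \oo] --> u ^+ 3 / 6.
Proof.
move=> u0; apply: (squeeze_cvgr _ (@cvg_err (u ^+ 3 / 6) (- (u ^+ 5 / 120))) (cvg_cst _)).
apply: nearW => k; have ak := a0 k; have akn : a k != 0 by rewrite gt_eqF.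
have a3 : 0 < a k ^+ 3 by rewrite exprn_gt0.
have uk : 0 <= u / a k by rewrite divr_ge0// ltW.
have := sin_ge uk; have := sin_le5 uk.
rewrite -(ler_pM2l a3) => h1; rewrite -(ler_pM2l a3) => h2.
rewrite mulrBr; apply/andP; split.
  rewrite lerBrDr addrC -lerBrDr (le_trans h1)// le_eqVlt; apply/orP; left; apply/eqP.
  by field.
rewrite lerBlDr addrC -lerBlDr (le_trans _ h2)// le_eqVlt; apply/orP; left; apply/eqP.
by field.
Qed.

Let ai2 : (a k)^-1 ^+ 2 @[k --> \oo] --> (0 : R).
Proof. by have := @cvg_err 0 1; under eq_fun do rewrite add0r mul1r. Qed.

Let cos_lim1 u : 0 <= u -> cos (u / a k) @[k --> \oo] --> (1 : R).
Proof.
move=> u0; rewrite (_ : (fun k => _) = fun k =>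
    1 - (a k)^-1 ^+ 2 * (a k ^+ 2 * (1 - cos (u / a k)))); last first.
  apply/funext => k; rewrite exprVn mulKf ?expf_neq0 ?gt_eqF//.
  by rewrite opprB addrC subrK.
rewrite -[X in _ --> X]subr0 -[X in _ --> _ - X](mul0r (u ^+ 2 / 2)).
by apply: cvgB; [exact: cvg_cst|apply: cvgM => //; exact: cos_lim].
Qed.

Let sin_lim1 u : 0 <= u -> a k * sin (u / a k) @[k --> \oo] --> u.
Proof.
move=> u0; rewrite (_ : (fun k => _) = fun k =>
    u - (a k)^-1 ^+ 2 * (a k ^+ 3 * (u / a k - sin (u / a k)))); last first.
  by apply/funext => k; field; rewrite gt_eqF.
rewrite -[X in _ --> X]subr0 -[X in _ --> _ - X](mul0r (u ^+ 3 / 6)).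
by apply: cvgB; [exact: cvg_cst|apply: cvgM => //; exact: sin_lim].
Qed.

Let integrand_lim u : 0 <= u ->
  edge_integrand (a k) (m k) u @[k --> \oo] --> airy_integrand r u.
Proof.
move=> u0; rewrite /edge_integrand /airy_integrand; apply: cvgM.
  have h : - (((m k)%:~R - 2 * a k ^+ 3) / a k) +
     2 * (a k ^+ 3 * sinh (a k)^-1 - a k ^+ 2) * cos (u / a k) -
     2 * (a k ^+ 2 * (1 - cos (u / a k))) @[k --> \oo] --> 3^-1 - r - u ^+ 2.
    have -> : 3^-1 - r - u ^+ 2 = - r + 2 * 6^-1 * 1 - 2 * (u ^+ 2 / 2) by field.
    apply: cvgB; last by apply: cvgM; [exact: cvg_cst|exact: cos_lim].
    apply: cvgD; first exact: cvgN.
    by apply: cvgM; [apply: cvgM => //; exact: cvg_cst|exact: cos_lim1].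
  apply: (@cvg_trans _ (expR (- (((m k)%:~R - 2 * a k ^+ 3) / a k) +
     2 * (a k ^+ 3 * sinh (a k)^-1 - a k ^+ 2) * cos (u / a k) -
     2 * (a k ^+ 2 * (1 - cos (u / a k)))) @[k --> \oo])); last first.
    by apply: continuous_cvg => //; exact: continuous_expR.
  apply: near_eq_cvg; apply: nearW => k /=; congr expR.
  by field; rewrite gt_eqF.
have h : ((m k)%:~R - 2 * a k ^+ 3) / a k * u +
   2 * (a k ^+ 3 * (u / a k - sin (u / a k))) -
   2 * (a k * sin (u / a k)) * (a k ^+ 2 * (cosh (a k)^-1 - 1)) @[k --> \oo] -->
   u ^+ 3 / 3 - u + r * u.
  have -> : u ^+ 3 / 3 - u + r * u = r * u + 2 * (u ^+ 3 / 6) - 2 * u * 2^-1 by field.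
  apply: cvgB; last first.
    by apply: cvgM => //; apply: cvgM; [exact: cvg_cst|exact: sin_lim1].
  apply: cvgD; first by apply: cvgM => //; exact: cvg_cst.
  by apply: cvgM; [exact: cvg_cst|exact: sin_lim].
apply: (@cvg_trans _ (cos (((m k)%:~R - 2 * a k ^+ 3) / a k * u +
   2 * (a k ^+ 3 * (u / a k - sin (u / a k))) -
   2 * (a k * sin (u / a k)) * (a k ^+ 2 * (cosh (a k)^-1 - 1))) @[k --> \oo])); last first.
  by apply: continuous_cvg => //; exact: continuous_cos.
apply: near_eq_cvg; apply: nearW => k /=; congr cos.
by rewrite /bessel_arg; field; rewrite gt_eqF.
Qed.

(** Each factor of the integrand converges by the Taylor bounds of sin, cos,
    sinh and cosh, and the exponential bound at the edge dominates. *)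
Lemma bessel_edge_cvg : a k * bessel (m k) (a k ^+ 3) @[k --> \oo] --> airy_shift r.
Proof.
under eq_fun do rewrite bessel_edge//.
apply: cvgM; first exact: cvg_cst.
apply: (dominated_Rintegral (g := fun u => edge_const * expR (- lo) * expR (- 1 * u)) _ _ _ _ _).2.
- exact: measurable_itv.
- by move=> k; exact: measurable_edge_integrand.
- move=> u; rewrite /= in_itv /= andbT => u0.
  apply: cvg_trans (integrand_lim u0); apply: near_eq_cvg.
  have [K _ hK] : \forall k \near \oo, (a k)^-1 * u < 1.
    apply: (cvgr_lt (0 * u)); first by apply: cvgM => //; exact: cvg_cst.
    by rewrite mul0r.
  exists K => // k /= Kk; rewrite patchE ifT// mem_setE in_itv /= u0 /=.
  have := hK k Kk; rewrite -(ltr_pM2l (a0 k)) mulVKf ?gt_eqF// mulr1 => /ltW h.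
  apply: (le_trans h); rewrite ler_peMl ?(ltW (a0 k))//.
  by rewrite (le_trans _ (pi_ge2 R))// ler1n.
- rewrite (_ : EFin \o _ = fun u => ((edge_const * expR (- lo))%:E * (expR (- 1 * u))%:E)%E).
    by apply: integrableZl => //; exact: (@integrable_expRN R 0 1 ltr01).
  by apply/funext => u; rewrite /= EFinM.
- move=> k u; rewrite /= in_itv /= andbT => u0.
  apply: (le_trans (edge_integrand_le _ (a1 k) u0)).
  rewrite ler_wpM2r ?expR_ge0// ler_wpM2l ?expR_ge0// ler_expR lerN2.
  exact: mlo.
Qed.

End limit.

End edge_scaling.

(** * The Airy function and the Airy kernel *)

Section airy.
Context {R : realType}.
Local Notation mu := (@lebesgue_measure R).
Implicit Types (x r u s : R).

Let D : set R := `[0, +oo[%classic.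
Let mD : measurable D. Proof. exact: measurable_itv. Qed.

Lemma cvg_Rintegral_itv (f : R -> R) : mu.-integrable D (EFin \o f) ->
  (\int[mu]_(u in `[0, A]) f u)%R @[A --> +oo] --> (\int[mu]_(u in D) f u)%R.
Proof.
move=> fi; apply/cvg_pinftyP => A Ay.
have mf : measurable_fun D f by have /integrableP[/measurable_EFinP] := fi.
have E n : (\int[mu]_(u in `[0, A n]) f u)%R =
    (\int[mu]_(u in D) (f \_ `[0, A n]) u)%R.
  rewrite -Rintegral_mkcondr.
  have -> // : D `&` [set` `[0, A n]] = [set` `[0, A n]] :> set R.
  apply/seteqP; split=> x /=; first by case.
  by move=> h; split=> //; move: h; rewrite /D /= !in_itv /= => /andP[->].
under eq_fun do rewrite E.
apply: (dominated_Rintegral (g := fun u => `|f u|) _ _ _ _ _).2 => //.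
- move=> n; apply/(measurable_restrict _ _ _).1 => //.
  by apply: measurable_funS mf => //; exact: subIsetl.
- move=> x Dx; have x0 : 0 <= x by move: Dx; rewrite /D /= in_itv /= andbT.
  apply: cvg_near_cst.
  have [N _ hN] : \forall n \near \oo, x <= A n by move/cvgryPge: Ay; exact.
  by exists N => // n /= Nn; rewrite patchE ifT// mem_setE in_itv /= x0 hN.
- exact: (integrable_norm fi).
- by move=> n x Dx; rewrite patchE; case: ifP; rewrite ?normr0// ?normr_id.
Qed.

Lemma integrable_dominated (f : R -> R) (c k : R) : 0 < k -> continuous f ->
  (forall u, 0 <= u -> `|f u| <= c * expR (- k * u)) -> mu.-integrable D (EFin \o f).
Proof.
move=> k0 cf fc; have ie := @integrable_expRN R 0 k k0.
have ic : mu.-integrable D (EFin \o (fun u => c * expR (- k * u))).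
  rewrite (_ : EFin \o _ = fun u => (c%:E * (expR (- k * u))%:E)%E).
    exact: integrableZl.
  by apply/funext => u; rewrite /= EFinM.
apply: (@le_integrable _ _ _ mu D mD _ (EFin \o (fun u => c * expR (- k * u)))) => //.
  by apply/measurable_EFinP; apply: measurable_funTS; exact: continuous_measurable_fun.
move=> u; rewrite /D /= in_itv /= andbT => u0; rewrite lee_fin.
by rewrite (le_trans (fc u u0))// ler_norm.
Qed.

Lemma pow_gauss_le k u : 0 <= u ->
  u ^+ k * expR (- u ^+ 2) <= (k`!%:R * expR 1) * expR (- 1 * u).
Proof.
move=> u0; have h1 : u ^+ k <= k`!%:R * expR u.
  case: k => [|k]; first by rewrite expr0 fact0 mul1r -expR0 ler_expR.
  have f0 : 0 < (k.+1)`!%:R :> R by rewrite ltr0n fact_gt0.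
  have := @expR_ge1Dxn R u k u0; rewrite -(ler_pM2l f0) => h.
  apply: le_trans h; rewrite mulrDr mulrCA mulfV ?gt_eqF// !mulr1 lerDr.
  exact: ltW.
have h2 : expR u * expR (- u ^+ 2) <= expR 1 * expR (- 1 * u).
  rewrite -!expRD ler_expR; have := sqr_ge0 (u - 1); nra.
rewrite (le_trans (ler_wpM2r (expR_ge0 _) h1))// -!mulrA ler_wpM2l//.
Qed.

Definition airy_phase r u : R := u ^+ 3 / 3 - u + r * u.

(** Up to the factor exp(1/3 - r) / pi the Airy function is the moment of order
    0, and differentiation in r raises the order. *)
Definition airy_cos k r : R :=
  (\int[mu]_(u in D) (u ^+ k * expR (- u ^+ 2) * cos (airy_phase r u)))%R.

Definition airy_sin k r : R :=
  (\int[mu]_(u in D) (u ^+ k * expR (- u ^+ 2) * sin (airy_phase r u)))%R.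

Let dom k (f : R -> R) : (forall u, `|f u| <= 1) -> forall u, 0 <= u ->
  `|u ^+ k * expR (- u ^+ 2) * f u| <= (k`!%:R * expR 1) * expR (- 1 * u).
Proof.
move=> f1 u u0; rewrite normrM -[leRHS]mulr1; apply: ler_pM => //.
by rewrite ger0_norm ?mulr_ge0 ?exprn_ge0 ?expR_ge0// pow_gauss_le.
Qed.

Let integrable_cos k r :
  mu.-integrable D (EFin \o (fun u => u ^+ k * expR (- u ^+ 2) * cos (airy_phase r u))).
Proof.
apply: (@integrable_dominated _ (k`!%:R * expR 1) 1) => //.
  by rewrite /airy_phase; continuous_tac.
by apply: dom => u; exact: cos_max.
Qed.

Let integrable_sin k r :
  mu.-integrable D (EFin \o (fun u => u ^+ k * expR (- u ^+ 2) * sin (airy_phase r u))).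
Proof.
apply: (@integrable_dominated _ (k`!%:R * expR 1) 1) => //.
  by rewrite /airy_phase; continuous_tac.
by apply: dom => u; exact: sin_max.
Qed.

Let integrable_dom k :
  mu.-integrable D (EFin \o (fun u : R => (k`!%:R * expR 1) * expR (- 1 * u))).
Proof.
apply: (@integrable_dominated _ (k`!%:R * expR 1) 1) => //; first by continuous_tac.
by move=> u _; rewrite ger0_norm// !mulr_ge0// expR_ge0.
Qed.

Let dom_bound k : R := (k`!%:R * expR 1) * (\int[mu]_(u in D) expR (- 1 * u))%R.

Lemma airy_cos_le k r : `|airy_cos k r| <= dom_bound k.
Proof.
rewrite /dom_bound -RintegralZl//; last exact: (@integrable_expRN R 0 1 ltr01).
apply: (le_trans (le_normr_Rintegral _ _)) => //; apply: le_Rintegral => //.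
  exact: (integrable_norm (integrable_cos _ _)).
move=> u; rewrite /D /= in_itv /= andbT => u0.
by apply: (@dom k (fun u => cos (airy_phase r u))) => // v; exact: cos_max.
Qed.

Lemma airy_sin_le k r : `|airy_sin k r| <= dom_bound k.
Proof.
rewrite /dom_bound -RintegralZl//; last exact: (@integrable_expRN R 0 1 ltr01).
apply: (le_trans (le_normr_Rintegral _ _)) => //; apply: le_Rintegral => //.
  exact: (integrable_norm (integrable_sin _ _)).
move=> u; rewrite /D /= in_itv /= andbT => u0.
by apply: (@dom k (fun u => sin (airy_phase r u))) => // v; exact: sin_max.
Qed.

Lemma is_derive_airy_cos k r : is_derive r 1 (airy_cos k) (- airy_sin k.+1 r).
Proof.
have h := @is_derive_under R D
  (fun r u => u ^+ k * expR (- u ^+ 2) * cos (airy_phase r u))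
  (fun r u => - (u ^+ k.+1 * expR (- u ^+ 2) * sin (airy_phase r u)))
  (fun u => `|((k.+1)`!%:R * expR 1) * expR (- 1 * u)|) (r - 1) (r + 1) r.
apply: (is_derive_eq (h _ _ _ _ _ _ _)) => //.
- by apply/andP; split; lra.
- move=> x y _ _; rewrite /airy_phase; is_derive_tac.
  by rewrite /= (exprS _ k); ring.
- exact: (integrable_norm (integrable_dom _)).
- move=> x u _; rewrite /D /= in_itv /= andbT => u0; rewrite normrN.
  apply: le_trans (ler_norm _).
  by apply: (@dom k.+1 (fun u => sin (airy_phase x u))) => // v; exact: sin_max.
- under eq_Rintegral do rewrite -mulN1r.
  by rewrite RintegralZl// mulN1r.
Qed.

Lemma is_derive_airy_sin k r : is_derive r 1 (airy_sin k) (airy_cos k.+1 r).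
Proof.
have h := @is_derive_under R D
  (fun r u => u ^+ k * expR (- u ^+ 2) * sin (airy_phase r u))
  (fun r u => u ^+ k.+1 * expR (- u ^+ 2) * cos (airy_phase r u))
  (fun u => `|((k.+1)`!%:R * expR 1) * expR (- 1 * u)|) (r - 1) (r + 1) r.
apply: (is_derive_eq (h _ _ _ _ _ _ _)) => //.
- by apply/andP; split; lra.
- move=> x y _ _; rewrite /airy_phase; is_derive_tac.
  by rewrite /= (exprS _ k); ring.
- exact: (integrable_norm (integrable_dom _)).
- move=> x u _; rewrite /D /= in_itv /= andbT => u0.
  apply: le_trans (ler_norm _).
  by apply: (@dom k.+1 (fun u => cos (airy_phase x u))) => // v; exact: cos_max.
Qed.

(** The function exp(- u^2) sin(u^3/3 - u + r u) vanishes at 0 and at infinity,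
    so its derivative has integral zero. Airy's equation follows from this
    relation. *)
Lemma airy_ibp r : airy_cos 0 r + 2 * airy_sin 1 r - airy_cos 2 r = r * airy_cos 0 r.
Proof.
pose f u := (1 - r) * (u ^+ 0 * expR (- u ^+ 2) * cos (airy_phase r u)) +
  2 * (u ^+ 1 * expR (- u ^+ 2) * sin (airy_phase r u)) -
  (u ^+ 2 * expR (- u ^+ 2) * cos (airy_phase r u)).
have iZ (c : R) (g : R -> R) : mu.-integrable D (EFin \o g) ->
    mu.-integrable D (EFin \o (fun u => c * g u)).
  move=> ig; rewrite (_ : EFin \o _ = fun u => (c%:E * (g u)%:E)%E).
    exact: integrableZl.
  by apply/funext => u; rewrite /= EFinM.
have iD (g h : R -> R) : mu.-integrable D (EFin \o g) -> mu.-integrable D (EFin \o h) ->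
    mu.-integrable D (EFin \o (fun u => g u + h u)).
  move=> ig ih; rewrite (_ : EFin \o _ = (fun u => (g u)%:E + (h u)%:E)%E).
    exact: (@integrableD _ _ _ mu D mD _ _ ig ih).
  by apply/funext => u; rewrite /= EFinD.
have iB (g h : R -> R) : mu.-integrable D (EFin \o g) -> mu.-integrable D (EFin \o h) ->
    mu.-integrable D (EFin \o (fun u => g u - h u)).
  move=> ig ih; rewrite (_ : EFin \o _ = (fun u => (g u)%:E - (h u)%:E)%E).
    exact: (@integrableB _ _ _ mu D mD _ _ ig ih).
  by apply/funext => u; rewrite /= EFinB.
have i1 := iZ (1 - r) _ (integrable_cos 0 r).
have i2 := iZ 2 _ (integrable_sin 1 r).
have i3 := integrable_cos 2 r.
have i12 : mu.-integrable D (EFin \o (fun u => (1 - r) * (u ^+ 0 * expR (- u ^+ 2) * cos (airy_phase r u)) +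
  2 * (u ^+ 1 * expR (- u ^+ 2) * sin (airy_phase r u)))).
  exact: iD.
have iF : mu.-integrable D (EFin \o f) by exact: iB.
have fE : (\int[mu]_(u in D) f u)%R = (1 - r) * airy_cos 0 r + 2 * airy_sin 1 r - airy_cos 2 r.
  rewrite RintegralB//; congr (_ - _).
  rewrite RintegralD//; congr (_ + _); exact: RintegralZl.
suff : (\int[mu]_(u in D) f u)%R = 0 by rewrite fE => h; lra.
pose F u := - (expR (- u ^+ 2) * sin (airy_phase r u)).
have dF u : is_derive u 1 F (f u).
  by rewrite /F /f /airy_phase; is_derive_tac; rewrite /=; field.
have F0 : F A @[A --> +oo] --> 0.
  apply/cvgr0Pnorm_le => e e0.
  have := @cvg_gauss_fun R => /cvgr0Pnorm_le/(_ e e0).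
  apply: filterS => A; apply: le_trans; rewrite /F normrN normrM.
  by rewrite -[leRHS]mulr1 ler_wpM2l// sin_max.
have := cvg_Rintegral_itv iF; set I := Rintegral _ _ _.
move=> /cvg_unique; apply => //.
apply: cvg_trans F0; apply: near_eq_cvg.
exists 0; split=> // A A0 /=.
rewrite (integral_derive (ltW A0) dF); last by rewrite /f /airy_phase; continuous_tac.
have p0 : airy_phase r 0 = 0 by rewrite /airy_phase; ring.
by rewrite [X in _ - X](_ : _ = 0) ?subr0// /F p0 sin0 mulr0 oppr0.
Qed.

End airy.

Section airy_function.
Context {R : realType}.
Local Notation mu := (@lebesgue_measure R).
Implicit Types (x r u s : R).

Let D : set R := `[0, +oo[%classic.
Let mD : measurable D. Proof. exact: measurable_itv. Qed.

Let integrable_airy r : mu.-integrable D (EFin \o airy_integrand r).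
Proof.
apply: (@integrable_dominated _ _ (expR (3^-1 - r) * (0`!%:R * expR 1)) 1) => //.
  by rewrite /airy_integrand; continuous_tac.
move=> u u0; rewrite /airy_integrand normrM -[leRHS]mulr1; apply: ler_pM => //; last exact: cos_max.
rewrite ger0_norm ?expR_ge0// expRD -mulrA ler_wpM2l ?expR_ge0//.
by have := @pow_gauss_le R 0 u u0; rewrite expr0 mul1r.
Qed.

Lemma airy_shiftE r : airy_shift r = pi^-1 * expR 3^-1 * (expR (- r) * airy_cos 0 r).
Proof.
rewrite /airy_shift -[RHS]mulrA; congr (_ * _).
rewrite mulrA -expRD /airy_cos -RintegralZl//; last first.
  apply: (@integrable_dominated _ _ (0`!%:R * expR 1) 1) => //.
    by rewrite /airy_phase; continuous_tac.
  move=> u u0; rewrite normrM -[leRHS]mulr1; apply: ler_pM => //; last exact: cos_max.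
  by rewrite ger0_norm ?pow_gauss_le// mulr_ge0 ?expR_ge0 ?exprn_ge0.
apply: eq_Rintegral => u _; rewrite /airy_integrand /airy_phase expr0 mul1r.
by rewrite mulrA -!expRD.
Qed.

(** Moving the line of integration of the oscillatory Airy integral from the
    real axis to height one costs only the vertical side of the rectangle, on
    which the integrand is at most a constant times exp(- A^2 h). *)
Lemma airy_truncation_shift x (A : R) : 0 < A ->
  `|(\int[mu]_(u in `[0, A]) airy_integrand x u)%R -
    (\int[mu]_(u in `[0, A]) cos (u ^+ 3 / 3 + x * u))%R| <=
  expR (3^-1 + `|x|) / A ^+ 2.
Proof.
move=> A0; have A0' := ltW A0.
pose md h u := expR (- (u ^+ 2 * h) + h ^+ 3 / 3 - x * h).
pose ar h u := u ^+ 3 / 3 - u * h ^+ 2 + x * u.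
pose P h u := md h u * cos (ar h u).
pose Q h u := md h u * sin (ar h u).
pose q h u := md h u * (- (2 * u * h) * sin (ar h u) +
  (u ^+ 2 - h ^+ 2 + x) * cos (ar h u)).
pose G h := (\int[mu]_(u in `[0, A]) P h u)%R.
have -> : (\int[mu]_(u in `[0, A]) airy_integrand x u)%R = G 1.
  apply: eq_Rintegral => u _; rewrite /P /md /ar /airy_integrand !expr1n !mulr1 mul1r.
  by congr (expR _ * _); ring.
have -> : (\int[mu]_(u in `[0, A]) cos (u ^+ 3 / 3 + x * u))%R = G 0.
  apply: eq_Rintegral => u _; rewrite /P /md /ar !expr0n /= !mulr0 mul0r oppr0 !addr0.
  by rewrite expR0 mul1r.
have dP (u h : R) : is_derive h 1 (P ^~ u) (- q h u).
  by rewrite /P /q /md /ar; is_derive_tac; rewrite /=; field.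
have dQ (u h : R) : is_derive u 1 (Q h) (q h u).
  by rewrite /Q /q /md /ar; is_derive_tac; rewrite /=; field.
have cP h : continuous (P h) by rewrite /P /md /ar; continuous_tac.
have cq h : continuous (q h) by rewrite /q /md /ar; continuous_tac.
have Q0 h : Q h 0 = 0.
  by rewrite /Q (_ : ar h 0 = 0) ?sin0 ?mulr0// /ar; ring.
have dG (e : R) : is_derive e 1 G (- Q e A).
  pose H := `|e| + 1; have H0 : 0 <= H by rewrite addr_ge0.
  have := @is_derive_shift_integral R P Q q 0 A (e - 1) (e + 1) e
    (expR (A ^+ 2 * H + H ^+ 3 / 3 + `|x| * H) *
     (2 * A * H + (A ^+ 2 + H ^+ 2 + `|x|))) A0'.
  rewrite Q0 sub0r; apply => //; first by apply/andP; split; lra.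
  move=> u h /andP[u0 uA] /andP[h1 h2].
  have hH : `|h| <= H.
    have := ler_norm e; have := ler_norm (- e); rewrite normrN => ? ?.
    by rewrite ler_norml /H; apply/andP; split; lra.
  have u2 : u ^+ 2 <= A ^+ 2 by rewrite ler_sqr.
  have h2' : `|h ^+ 2| <= H ^+ 2 by rewrite normrX ler_sqr ?nnegrE.
  rewrite /q normrM; apply: ler_pM => //.
    rewrite /md ger0_norm ?expR_ge0// ler_expR.
    apply: (le_trans (ler_norm _)); apply: (le_trans (ler_normB _ _)); apply: lerD.
      apply: (le_trans (ler_normD _ _)); apply: lerD.
        by rewrite normrN normrM ler_pM// ger0_norm// sqr_ge0.
      rewrite normrM normfV normrX (@ger0_norm _ 3)// ler_wpM2r//.
      by rewrite lerXn2r ?nnegrE.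
    by rewrite normrM ler_wpM2l.
  apply: (le_trans (ler_normD _ _)); apply: lerD.
    rewrite normrM -[leRHS]mulr1; apply: ler_pM => //; last exact: sin_max.
    rewrite normrN !normrM (@ger0_norm _ 2)// (@ger0_norm _ u)//.
    by apply: ler_pM; rewrite ?mulr_ge0// ler_pM2l.
  rewrite normrM -[leRHS]mulr1; apply: ler_pM => //; last exact: cos_max.
  apply: (le_trans (ler_normD _ _)); apply: lerD => //.
  apply: (le_trans (ler_normB _ _)); apply: lerD => //.
  by rewrite ger0_norm ?sqr_ge0.
pose c := expR (3^-1 + `|x|).
have dg (s : R) : is_derive s 1 (fun h => - (c / A ^+ 2) * expR (- A ^+ 2 * h))
    (c * expR (- A ^+ 2 * s)).
  by is_derive_tac; rewrite /=; field; rewrite gt_eqF.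
have := derive_bound ler01 dG dg; rewrite mulr1 mulr0 expR0 mulr1 => h.
apply: (le_trans (h _)).
  move=> s /andP[s0 s1]; rewrite normrN /Q normrM -[leRHS]mulr1.
  apply: ler_pM => //; last exact: sin_max.
  rewrite /md ger0_norm ?expR_ge0// /c -expRD ler_expR.
  have xs : - (x * s) <= `|x|.
    rewrite (le_trans (ler_norm _))// normrN normrM (ger0_norm s0).
    by rewrite -[leRHS]mulr1 ler_wpM2l.
  have s3 : s ^+ 3 <= 1 by rewrite exprn_ile1.
  by lra.
rewrite opprK -/c gerDr mulNr oppr_le0 mulr_ge0 ?expR_ge0//.
by rewrite divr_ge0 ?expR_ge0 ?exprn_ge0.
Qed.

Lemma Ai_shift : @Ai R = airy_shift.
Proof.
apply/funext => x; apply/cvg_lim => //; rewrite /airy_shift.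
apply: cvgM; first exact: cvg_cst.
have c1 := cvg_Rintegral_itv (integrable_airy x).
have c2 : (\int[mu]_(u in `[0, A]) cos (u ^+ 3 / 3 + x * u))%R -
    (\int[mu]_(u in `[0, A]) airy_integrand x u)%R @[A --> +oo] --> 0.
  apply: norm_cvg0.
  have c3 : expR (3^-1 + `|x|) / A ^+ 2 @[A --> +oo] --> (0 : R).
    apply/cvgr0Pnorm_le => e e0; exists (Num.max 1 (expR (3^-1 + `|x|) / e)).
    split=> [|A]; first exact: num_real.
    rewrite gt_max => /andP[A1 Ae]; have A0 : 0 < A by exact: lt_trans A1.
    rewrite ger0_norm ?divr_ge0 ?expR_ge0 ?exprn_ge0 ?(ltW A0)//.
    rewrite ler_pdivrMr ?exprn_gt0//.
    rewrite ltr_pdivrMr// in Ae; rewrite (le_trans (ltW Ae))// mulrC ler_pM2l//.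
    by rewrite expr2 ler_peMr ?(ltW A0) ?(ltW A1).
  apply: (squeeze_cvgr _ (cvg_cst 0) c3).
  exists 0; split=> // A A0 /=; rewrite normr_ge0 distrC /=.
  exact: airy_truncation_shift.
rewrite (_ : (fun A : R => _) = fun A : R =>
    ((\int[mu]_(u in `[0, A]) cos (u ^+ 3 / 3 + x * u))%R -
    (\int[mu]_(u in `[0, A]) airy_integrand x u)%R) +
    (\int[mu]_(u in `[0, A]) airy_integrand x u)%R); last first.
  by apply/funext => A; rewrite subrK.
by rewrite -[X in _ --> X]add0r; exact: cvgD.
Qed.

Definition airy_deriv r : R :=
  pi^-1 * expR 3^-1 * (expR (- r) * (- airy_cos 0 r - airy_sin 1 r)).

Lemma is_derive_airy r : is_derive r 1 airy_shift (airy_deriv r).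
Proof.
rewrite (_ : airy_shift = fun r => pi^-1 * expR 3^-1 * (expR (- r) * airy_cos 0 r)); last first.
  by apply/funext => s; exact: airy_shiftE.
have dc := is_derive_airy_cos 0 r.
by rewrite /airy_deriv; is_derive_tac; rewrite /=; ring.
Qed.

(** Airy's equation. *)
Lemma is_derive_airy_deriv r : is_derive r 1 airy_deriv (r * airy_shift r).
Proof.
rewrite airy_shiftE; have dc := is_derive_airy_cos 0 r; have ds := is_derive_airy_sin 1 r.
rewrite /airy_deriv; is_derive_tac.
have := airy_ibp r => h; rewrite /=.
have -> : airy_cos 2 r = airy_cos 0 r + 2 * airy_sin 1 r - r * airy_cos 0 r by lra.
ring.
Qed.

(** The factor exp(- r) comes from the height one of the line of integration;
    the moments are bounded uniformly in r. *)
Lemma airy_decay : exists M, 0 <= M /\ forall r,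
  `|airy_shift r| <= M * expR (- r) /\ `|airy_deriv r| <= M * expR (- r).
Proof.
pose c : R := pi^-1 * expR 3^-1; have c0 : 0 <= c.
  by rewrite mulr_ge0 ?expR_ge0// invr_ge0 pi_ge0.
pose I := (\int[mu]_(u in D) expR (- 1 * u))%R.
pose B k : R := (k`!%:R * expR 1) * I.
have B0 k : 0 <= B k by rewrite !mulr_ge0 ?expR_ge0// Rintegral_ge0// => u _; exact: expR_ge0.
exists (c * (B 0 + B 1)); split=> [|r]; first by rewrite mulr_ge0// addr_ge0.
have hc := airy_cos_le 0 r; have hs := airy_sin_le 1 r.
have key z b : `|z| <= b -> `|c * (expR (- r) * z)| <= c * b * expR (- r).
  move=> zb; rewrite normrM (ger0_norm c0) normrM (ger0_norm (expR_ge0 _)).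
  by rewrite -mulrA ler_wpM2l// mulrC ler_wpM2r ?expR_ge0.
rewrite airy_shiftE; split; apply: key; first by rewrite (le_trans hc)// lerDl.
by rewrite (le_trans (ler_normB _ _))// normrN; apply: lerD.
Qed.

Lemma continuous_airy : continuous (@airy_shift R).
Proof. by move=> r; exact: is_derive_contR (is_derive_airy r). Qed.

Definition airy_gram u v : R := (\int[mu]_(s in D) (airy_shift (u + s) * airy_shift (v + s)))%R.

Let gram_bound M : (forall r, `|airy_shift r| <= M * expR (- r)) -> forall u v s,
  `|airy_shift (u + s) * airy_shift (v + s)| <=
  M * expR (- u) * (M * expR (- v)) * expR (- 2 * s).
Proof.
move=> hM u v s; rewrite normrM (le_trans (ler_pM _ _ (hM _) (hM _)))//.
rewrite (_ : - 2 * s = - s + - s) ?expRD; last by ring.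
rewrite !opprD !expRD le_eqVlt; apply/orP; left; apply/eqP; ring.
Qed.

Let continuous_gram u v : continuous (fun s => airy_shift (u + s) * airy_shift (v + s)).
Proof.
move=> s; apply: cvgM; apply: continuous_comp; try exact: continuous_airy;
  by apply: cvgD; [exact: cvg_cst|exact: cvg_id].
Qed.

Lemma integrable_gram u v :
  mu.-integrable D (EFin \o (fun s => airy_shift (u + s) * airy_shift (v + s))).
Proof.
have [M [_ hM]] := airy_decay.
apply: (@integrable_dominated _ _ (M * expR (- u) * (M * expR (- v))) 2) => //.
by move=> s _; apply: gram_bound => r; have [] := hM r.
Qed.

(** By Airy's equation the Wronskian of two translates is a primitive of v - u
    times the product of these translates. *)
Lemma airy_gram_quotient u v : u != v -> airy_gram u v = airy_quotient u v.
Proof.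
move=> uv; rewrite /airy_quotient Ai_shift.
have dE r : derive1 airy_shift r = airy_deriv r.
  by rewrite derive1E; have [] := is_derive_airy r.
rewrite !dE.
pose W s := airy_shift (u + s) * airy_deriv (v + s) - airy_deriv (u + s) * airy_shift (v + s).
have dsh (w s : R) : is_derive s 1 (fun s => w + s) 1.
  by is_derive_tac; rewrite /= add0r.
have dA w s := is_derive_compR (dsh w s) (is_derive_airy (w + s)).
have dB w s := is_derive_compR (dsh w s) (is_derive_airy_deriv (w + s)).
have dW (s : R) : is_derive s 1 W ((v - u) * (airy_shift (u + s) * airy_shift (v + s))).
  apply: (is_derive_eq (is_derive_addR (is_derive_mulR (dA u s) (dB v s))
    (is_derive_oppR (is_derive_mulR (dB u s) (dA v s))))).
  by ring.
have [M [M0 hM]] := airy_decay.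
have W0 : W A @[A --> +oo] --> 0.
  apply: norm_cvg0.
  pose c := M * expR (- u) * (M * expR (- v)) + M * expR (- u) * (M * expR (- v)).
  have ce : c * expR (- A) @[A --> +oo] --> 0.
    by rewrite -[X in _ --> X](mulr0 c); apply: cvgM; [exact: cvg_cst|exact: cvgr_expR].
  apply: (squeeze_cvgr _ (cvg_cst 0) ce).
  exists 0; split=> // A A0 /=; rewrite normr_ge0 /=.
  have hp (p q : R) : `|p| <= M * expR (- (u + A)) -> `|q| <= M * expR (- (v + A)) ->
     `|p * q| <= M * expR (- u) * (M * expR (- v)) * expR (- A).
    move=> hp hq; rewrite normrM (le_trans (ler_pM _ _ hp hq))//.
    rewrite !opprD !expRD.
    have -> : M * (expR (- u) * expR (- A)) * (M * (expR (- v) * expR (- A))) =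
      (M * expR (- u) * (M * expR (- v)) * expR (- A)) * expR (- A) by ring.
    by rewrite ler_piMr ?mulr_ge0 ?expR_ge0// -expR0 ler_expR oppr_le0 ltW.
  rewrite /W (le_trans (ler_normB _ _))// /c mulrDl; apply: lerD.
    by apply: hp; [have [] := hM (u + A)|have [] := hM (v + A)].
  by apply: hp; [have [] := hM (u + A)|have [] := hM (v + A)].
have cW : continuous (fun s => (v - u) * (airy_shift (u + s) * airy_shift (v + s))).
  by move=> s; apply: cvgM; [exact: cvg_cst|exact: continuous_gram].
have c1 : (v - u) * (\int[mu]_(s in `[0, A]) (airy_shift (u + s) * airy_shift (v + s)))%R
     @[A --> +oo] --> (v - u) * airy_gram u v.
  by apply: cvgM; [exact: cvg_cst|exact: cvg_Rintegral_itv (integrable_gram u v)].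
have c2 : W A - W 0 @[A --> +oo] --> 0 - W 0 by apply: cvgB => //; exact: cvg_cst.
have e : (v - u) * airy_gram u v = 0 - W 0.
  apply: (cvg_unique _ c1) => //; apply: cvg_trans c2; apply: near_eq_cvg.
  exists 0; split=> // A A0 /=.
  rewrite -(integral_derive (ltW A0) dW cW) RintegralZl//.
  exact: integrable_itv.
have vu : v - u != 0 by rewrite subr_eq0 eq_sym.
apply: (mulfI vu); rewrite e /W !addr0 sub0r.
by field; rewrite subr_eq0.
Qed.

(** On the diagonal, the kernel is a limit of quotients and the Gram integral
    is continuous. *)
Lemma airy_kernelE u v : airy_kernel u v = airy_gram u v.
Proof.
rewrite /airy_kernel; case: eqVneq => [<-|uv]; last by rewrite airy_gram_quotient.
apply/cvg_lim => //.
have [M [M0 hM]] := airy_decay; have {}hM r := (hM r).1.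
have cA (s : R) : continuous (fun w => airy_shift (w + s)).
  move=> w; have d : is_derive w 1 (fun w => w + s) (1 + 0) by repeat is_derive_step.
  exact: is_derive_contR (is_derive_compR d (is_derive_airy (w + s))).
have c : {for u, continuous (airy_gram u)}.
  have h := @continuity_under_integral R _ _ mu
    (fun w s => airy_shift (u + s) * airy_shift (w + s)) D mD (u - 1) (u + 1).
  have : {in `]u - 1, u + 1[%classic, continuous (airy_gram u)}.
    apply: (h _ _ (fun s => M * expR (- u) * (M * expR (- (u - 1))) * expR (- 2 * s))).
    - by move=> w _; exact: integrable_gram.
    - apply: aeW => s _ w _; apply: cvgM; first exact: cvg_cst.
      exact: cA.
    - apply: (@integrable_dominated _ _ (M * expR (- u) * (M * expR (- (u - 1)))) 2) => //.
        by continuous_tac.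
      by move=> s _; rewrite ger0_norm// !mulr_ge0 ?expR_ge0.
    - move=> w; rewrite /= in_itv /= => /andP[w1 w2]; apply: aeW => s _.
      rewrite (le_trans (gram_bound hM _ _ _))// ler_wpM2r ?expR_ge0//.
      rewrite ler_wpM2l ?mulr_ge0 ?expR_ge0// ler_wpM2l// ler_expR; lra.
  apply; rewrite inE /= in_itv /=; apply/andP; split; lra.
move/continuous_withinNx: c; apply: cvg_trans; apply: near_eq_cvg.
have := @nbhs_dnbhs_neq R u; apply: filterS => w wu /=.
by rewrite airy_gram_quotient// eq_sym.
Qed.

End airy_function.

(** * Convergence of Fredholm determinants *)

Section series_dominated.
Context {R : realType}.

(** Tannery's theorem. *)
Lemma dominated_series (a : nat -> nat -> R) (l b : nat -> R) :
  (forall k n, `|a k n| <= b n) -> cvgn (series b) ->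
  (forall n, a k n @[k --> \oo] --> l n) ->
  limn (series (a k)) @[k --> \oo] --> limn (series l).
Proof.
move=> ab cb al.
have lb n : `|l n| <= b n.
  have h : `|a k n| @[k --> \oo] --> `|l n| by apply: cvg_norm; exact: al.
  by move/cvgr_to_le: h; apply; exact: nearW.
have b0 n : 0 <= b n by exact: le_trans (ab 0%N n).
have cvg_dom (u : nat -> R) : (forall n, `|u n| <= b n) -> cvgn (series u).
  by move=> ub; apply: normed_cvg; apply: series_le_cvg ub cb.
have tail (u : nat -> R) M : (forall n, `|u n| <= b n) ->
    `|limn (series u) - series u M| <= limn (series b) - series b M.
  move=> ub.
  have h : `|series u k - series u M| @[k --> \oo] --> `|limn (series u) - series u M|.
    by apply: cvg_norm; apply: cvgB; [exact: cvg_dom|exact: cvg_cst].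
  move/cvgr_to_le: h; apply; exists M => // k /= Mk.
  rewrite sub_series_geq// (le_trans (ler_norm_sum _ _ _))//.
  apply: (@le_trans _ _ (\sum_(M <= n < k) b n)); first by apply: ler_sum => n _; exact: ub.
  rewrite -sub_series_geq// lerD2r; apply: nondecreasing_cvgn_le => //.
  by apply: nondecreasing_series => n _ _; exact: b0.
apply/cvgrPdist_le => e e0; have e3 : 0 < e / 3 by rewrite divr_gt0.
have [M _ hM] : \forall M \near \oo, `|limn (series b) - series b M| <= e / 3.
  by move/cvgrPdist_le: (cb); apply.
have {}hM : limn (series b) - series b M <= e / 3.
  by rewrite (le_trans (ler_norm _))// hM /=.
have hfin : series (a k) M @[k --> \oo] --> series l M.
  rewrite /series /=; elim: (M) => [|m ih].
    by rewrite big_nil; under eq_fun do rewrite big_nil; exact: cvg_cst.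
  rewrite big_nat_recr//=; under eq_fun do rewrite big_nat_recr//=.
  by apply: cvgD.
move/cvgrPdist_le: hfin => /(_ _ e3); apply: filterS => k hk.
rewrite (_ : _ - _ = (limn (series l) - series l M) + (series l M - series (a k) M) +
   (series (a k) M - limn (series (a k)))); last by ring.
rewrite (le_trans (ler_normD _ _))// (_ : e = e / 3 + e / 3 + e / 3); last by field.
apply: lerD.
  by rewrite (le_trans (ler_normD _ _))//; apply: lerD => //; rewrite (le_trans (tail _ _ lb)).
by rewrite distrC (le_trans (tail _ _ (ab k))).
Qed.

End series_dominated.

Section iterated.
Context {R : realType}.
Local Notation mu := (@lebesgue_measure R).
Variables (D : set R) (g : R -> R).
Hypothesis mD : measurable D.
Hypothesis g0 : forall x, 0 <= g x.
Hypothesis ig : mu.-integrable D (EFin \o g).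

(** Every function of such a discretization is measurable, also after some of
    its arguments are integrated out; this is what makes the iterated integrals
    below tractable. *)
Definition discretizes (c : R -> nat) : Prop :=
  forall F : nat -> R, measurable_fun D (fun x => F (c x)).

Let I := (\int[mu]_(x in D) g x)%R.

Let integrableZ (k : R) : mu.-integrable D (EFin \o (fun x => k * g x)).
Proof.
rewrite (_ : EFin \o _ = fun x => (k%:E * (g x)%:E)%E); first exact: integrableZl.
by apply/funext => x; rewrite /= EFinM.
Qed.

Let tuple_seq (n : nat) (F : seq nat -> R) (c : R -> nat) : n.-tuple R -> R :=
  fun v => F [seq c x | x <- v].

Let measurable_iterated n F c : discretizes c ->
  measurable_fun D (fun x => iterated_integral D
    (fun v : n.-tuple R => tuple_seq F c (cons_tuple x v))).
Proof.
move=> dc.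
exact: (dc (fun z => iterated_integral D (tuple_seq (n := n) (fun s => F (z :: s)) c))).
Qed.

Lemma iterated_integral_le n (F : seq nat -> R) (c : R -> nat) (C : R) :
  discretizes c -> 0 <= C ->
  (forall v : n.-tuple R, (forall x, x \in v -> D x) ->
    `|F [seq c x | x <- v]| <= C * \prod_(x <- v) g x) ->
  `|iterated_integral D (fun v : n.-tuple R => F [seq c x | x <- v])| <= C * I ^+ n.
Proof.
move=> dc; elim: n F C => [|n ih] F C C0 FC /=.
  by have := FC [tuple]; rewrite big_nil expr0; apply.
pose h x := iterated_integral D (fun v : n.-tuple R => F [seq c z | z <- cons_tuple x v]).
have hC x : D x -> `|h x| <= C * I ^+ n * g x.
  move=> Dx; rewrite mulrAC; apply: (ih (fun s => F (c x :: s))); first by rewrite mulr_ge0.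
  move=> v Dv; have := FC (cons_tuple x v); rewrite /= big_cons mulrA; apply.
  by move=> z; rewrite inE => /predU1P[->//|]; exact: Dv.
have mh : measurable_fun D h by exact: measurable_iterated.
have ih' : mu.-integrable D (EFin \o h).
  apply: (@le_integrable _ _ _ mu D mD _ (EFin \o (fun x => C * I ^+ n * g x))) => //.
    exact/measurable_EFinP.
  by move=> x Dx; rewrite lee_fin (le_trans (hC _ Dx))// ler_norm.
suff : `|(\int[mu]_(x in D) h x)%R| <= C * I ^+ n.+1 by [].
have Z := @le_normr_Rintegral _ _ _ mu D h mD ih'; apply: (le_trans Z).
rewrite exprSr mulrA -RintegralZl//; apply: le_Rintegral => //.
  exact: integrable_norm ih'.
Qed.

Lemma iterated_integral_cvg n (F : nat -> seq nat -> R) (c : nat -> R -> nat)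
    (f : n.-tuple R -> R) (C : R) :
  (forall k, discretizes (c k)) -> 0 <= C ->
  (forall k (v : n.-tuple R), (forall x, x \in v -> D x) ->
    `|F k [seq c k x | x <- v]| <= C * \prod_(x <- v) g x) ->
  (forall v : n.-tuple R, (forall x, x \in v -> D x) ->
    F k [seq c k x | x <- v] @[k --> \oo] --> f v) ->
  iterated_integral D (fun v : n.-tuple R => F k [seq c k x | x <- v]) @[k --> \oo]
    --> iterated_integral D f.
Proof.
move=> dc; elim: n F f C => [|n ih] F f C C0 FC Ff /=.
  exact: (Ff [tuple]).
have Dcons x (v : n.-tuple R) : D x -> (forall z, z \in v -> D z) ->
    forall z, z \in cons_tuple x v -> D z.
  by move=> Dx Dv z; rewrite inE => /predU1P[->//|]; exact: Dv.
have FCx x : D x -> forall k (v : n.-tuple R), (forall z, z \in v -> D z) ->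
    `|F k (c k x :: [seq c k z | z <- v])| <= C * g x * \prod_(z <- v) g z.
  move=> Dx k v Dv; have := FC k (cons_tuple x v) (Dcons _ _ Dx Dv).
  by rewrite /= big_cons mulrA.
apply: (dominated_Rintegral (g := fun x => C * I ^+ n * g x) _ _ _ _ _).2 => //.
- by move=> k; exact: (@measurable_iterated n (F k) (c k) (dc k)).
- move=> x Dx; apply: (ih (fun k s => F k (c k x :: s)) _ (C * g x)).
  + by rewrite mulr_ge0.
  + by move=> k v; exact: FCx.
  + by move=> v Dv; exact: (Ff (cons_tuple x v) (Dcons _ _ Dx Dv)).
- move=> k x Dx; rewrite mulrAC.
  apply: (@iterated_integral_le n (fun s => F k (c k x :: s)) (c k)) => //.
  + by rewrite mulr_ge0.
  + by move=> v; exact: FCx.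
Qed.

Lemma cvg_det n (A : nat -> 'M[R]_n) (B : 'M[R]_n) :
  (forall i j, A k i j @[k --> \oo] --> B i j) ->
  \det (A k) @[k --> \oo] --> \det B.
Proof.
move=> AB; rewrite /determinant; apply: cvg_big => [|s _]; first exact: add_continuous.
apply: cvgM; first exact: cvg_cst.
by apply: cvg_big => [|i _]; [exact: mul_continuous|exact: AB].
Qed.

(** The bound on the determinants makes the n-th coefficient at most I ^+ n /
    n`!, so that pointwise convergence of the kernels suffices, by dominated
    convergence in every variable and then in n. *)
Lemma fredholm_det_cvg (k : nat -> nat -> nat -> R) (c : nat -> R -> nat) (K : R -> R -> R) :
  (forall p, discretizes (c p)) ->
  (forall p n (v : n.-tuple R), (forall x, x \in v -> D x) ->
    `|\det (\matrix_(i < n, j < n) k p (c p (tnth v i)) (c p (tnth v j)))| <=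
    \prod_(x <- v) g x) ->
  (forall u v, D u -> D v -> k p (c p u) (c p v) @[p --> \oo] --> K u v) ->
  fredholm_det (fun u v => k p (c p u) (c p v)) D @[p --> \oo] --> fredholm_det K D.
Proof.
move=> dc kg kK.
pose F n p (s : seq nat) := \det (\matrix_(i < n, j < n) k p (nth 0%N s i) (nth 0%N s j)).
have FE n p (v : n.-tuple R) : F n p [seq c p x | x <- v] =
    \det (\matrix_(i < n, j < n) k p (c p (tnth v i)) (c p (tnth v j))).
  congr (\det _); apply/matrixP => i j; rewrite !mxE.
  by rewrite !(nth_map 0) ?size_tuple// !(tnth_nth 0).
have FEe n p : (fun v : n.-tuple R =>
    \det (\matrix_(i < n, j < n) k p (c p (tnth v i)) (c p (tnth v j)))) =
    (fun v : n.-tuple R => F n p [seq c p x | x <- v]).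
  by apply/funext => v; rewrite FE.
have Fb n p (v : n.-tuple R) : (forall x, x \in v -> D x) ->
    `|F n p [seq c p x | x <- v]| <= 1 * \prod_(x <- v) g x.
  by move=> Dv; rewrite FE mul1r; exact: kg.
rewrite /fredholm_det.
apply: (@dominated_series R _ _ (exp_coeff I)).
- move=> p n; rewrite normrM /exp_coeff /= [leRHS]mulrC; apply: ler_pM => //.
    rewrite normrM normrX normrN normr1 expr1n mul1r ger0_norm ?invr_ge0//.
  by rewrite FEe -[leRHS]mul1r; apply: iterated_integral_le => //; exact: Fb.
- exact: is_cvg_series_exp_coeff.
move=> n; apply: cvgM; first exact: cvg_cst.
rewrite (_ : (fun p => _) = fun p => iterated_integral D
   (fun v : n.-tuple R => F n p [seq c p x | x <- v])); last first.
  by apply/funext => p; rewrite FEe.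
apply: (@iterated_integral_cvg n _ _ _ 1) => //.
  by move=> p v; exact: Fb.
move=> v Dv; rewrite (_ : (fun p => _) = fun p =>
   \det (\matrix_(i < n, j < n) k p (c p (tnth v i)) (c p (tnth v j)))); last first.
  by apply/funext => p; rewrite FE.
apply: cvg_det => i j; rewrite mxE; under eq_fun do rewrite mxE.
by apply: kK; apply: Dv; exact: mem_tnth.
Qed.

End iterated.

(** * Gram kernels and step kernels *)

Section gram_kernel.
Context {R : realType}.

Definition gram_kernel (w : nat -> nat -> R) (N p q : nat) : R :=
  \sum_(i < N) w i p * w i q.

(** Hadamard's inequality reduces every bound on the Fredholm coefficients to
    the diagonal of the kernel. *)
Lemma gram_kernel_det (w : nat -> nat -> R) N n (s : 'I_n -> nat) :
  `|\det (\matrix_(i < n, j < n) gram_kernel w N (s i) (s j))| <=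
  \prod_i gram_kernel w N (s i) (s i).
Proof.
pose G : 'M[R]_(n, N) := \matrix_(i, j) w j (s i).
have GE : \matrix_(i < n, j < n) gram_kernel w N (s i) (s j) = G *m G^T.
  by apply/matrixP => i j; rewrite !mxE; apply: eq_bigr => l _; rewrite !mxE.
have /andP[h0 h1] := hadamard_gram G.
rewrite GE ger0_norm// (le_trans h1)//; apply: ler_prod => i _.
by rewrite -GE mxE lexx andbT sumr_ge0// => l _; rewrite -expr2 sqr_ge0.
Qed.

End gram_kernel.

Section step_kernel.
Context {R : realType}.
Local Notation mu := (@lebesgue_measure R).
Variables (y a : R).
Hypothesis a0 : 0 < a.

Let D : set R := `]y, +oo[%classic.
Let mD : measurable D. Proof. exact: measurable_itv. Qed.

(** The cells have length 1/a and are numbered from y to the right. *)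
Definition cell (u : R) : nat := Num.truncn ((u - y) * a).

Let B (p : nat) : set R := `[(y + p%:R / a)%R, (y + p.+1%:R / a)%R[%classic.

Lemma cellE p u : y <= u -> (cell u == p) = (u \in B p).
Proof.
move=> yu; rewrite /cell truncn_eq; last by rewrite mulr_ge0 ?subr_ge0// ltW.
rewrite mem_setE in_itv /= -ler_pdivrMr// -ltr_pdivlMr//.
by rewrite lerBrDl ltrBlDl.
Qed.

Lemma discretizes_cell : discretizes D cell.
Proof.
move=> F _ A mA.
rewrite (_ : D `&` _ = \bigcup_p (if F p \in A then D `&` B p else set0)).
  by apply: bigcupT_measurable => p; case: ifP => // _; apply: measurableI => //; exact: measurable_itv.
apply/seteqP; split=> u /=.
  move=> [Du AF]; exists (cell u) => //; rewrite ifT ?inE//; split => //.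
  by apply/set_mem; rewrite -cellE// ltW//; move: Du; rewrite /D /= in_itv /= andbT.
move=> [p _]; case: ifP => //; rewrite inE => AF [Du Bu]; split => //.
suff -> : cell u = p by [].
by apply/eqP; rewrite cellE ?inE// ltW//; move: Du; rewrite /D /= in_itv /= andbT.
Qed.

Lemma integral_cell (F : nat -> R) L : (forall p, (L <= p)%N -> F p = 0) ->
  (\int[mu]_(u in D) F (cell u))%R = a^-1 * \sum_(p < L) F p.
Proof.
move=> FL; set D' : set R := `[y, +oo[%classic.
have mD' : measurable D' by exact: measurable_itv.
have -> : (\int[mu]_(u in D) F (cell u))%R = (\int[mu]_(u in D') F (cell u))%R.
  rewrite /Rintegral /D' -integral_itv_obnd_cbnd//.
  by apply/measurable_EFinP; exact: discretizes_cell.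
have BD p : B p `<=` D'.
  move=> u; rewrite /B /D' /= !in_itv /= andbT => /andP[pu _].
  by rewrite (le_trans _ pu)// lerDl divr_ge0// ltW.
have muB p : mu (B p) = (a^-1)%:E.
  rewrite /B lebesgue_measure_itv /= lte_fin ltrD2l ltr_pM2r ?invr_gt0// ltr_nat ltnSn.
  by rewrite -EFinD; congr EFin; rewrite -[p.+1]addn1 natrD; field; rewrite gt_eqF.
have mB p : measurable (B p) by exact: measurable_itv.
have eB p : (\int[mu]_(u in D') (\1_(B p) u)%:E = (a^-1)%:E)%E.
  have := @integral_indic _ _ _ mu D' mD' (B p) (mB p).
  by rewrite setIidl; [move=> ->; exact: muB|exact: BD].
have iB p : mu.-integrable D' (EFin \o \1_(B p)).
  apply/integrableP; split.
    by apply/measurable_EFinP; apply: measurable_indic; exact: mB.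
  under eq_integral do rewrite /= ger0_norm//.
  by rewrite eB ltry.
have iB1 p : (\int[mu]_(u in D') \1_(B p) u)%R = a^-1 by rewrite /Rintegral eB.
have iBZ c p : mu.-integrable D' (EFin \o (fun u => c * \1_(B p) u)).
  rewrite (_ : EFin \o _ = fun u => (c%:E * (\1_(B p) u)%:E)%E).
    exact: (@integrableZl _ _ _ mu D' mD' _ _ (iB p)).
  by apply/funext => u; rewrite /= EFinM.
have [iS IS] : mu.-integrable D' (EFin \o (fun u => \sum_(p < L) F p * \1_(B p) u)) /\
    (\int[mu]_(u in D') (\sum_(p < L) F p * \1_(B p) u))%R = a^-1 * \sum_(p < L) F p.
  elim: (L) => [|l [ihi ih]].
    rewrite big_ord0 mulr0; split.
      rewrite (_ : EFin \o _ = cst 0%E); first exact: integrable0.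
      by apply/funext => u; rewrite /= big_ord0.
    by under eq_Rintegral do rewrite big_ord0; rewrite Rintegral_cst// mul0r.
  split.
    rewrite (_ : EFin \o _ = fun u => ((\sum_(p < l) F p * \1_(B p) u)%:E + (F l * \1_(B l) u)%:E)%E).
      exact: (@integrableD _ _ _ mu D' mD' _ _ ihi (iBZ _ _)).
    by apply/funext => u; rewrite /= big_ord_recr /= EFinD.
  under eq_Rintegral do rewrite big_ord_recr /=.
  rewrite RintegralD// ih big_ord_recr mulrDr /=; congr (_ + _).
  by rewrite RintegralZl// iB1 mulrC.
rewrite -IS; apply: eq_Rintegral => u /set_mem; rewrite /D' /= in_itv /= andbT => yu.
have ind p : \1_(B p) u = (cell u == p)%:R :> R by rewrite indicE cellE.
have [cL|Lc] := ltnP (cell u) L; last first.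
  rewrite FL// big1// => p _; rewrite ind gtn_eqF ?mulr0//.
  exact: leq_trans (ltn_ord p) Lc.
rewrite (bigD1 (Ordinal cL))//= ind eqxx mulr1 big1 ?addr0// => p pc.
by rewrite ind eq_sym -val_eqE in pc *; rewrite (negbTE pc) mulr0.
Qed.

Lemma sum_tuple_cons L n (G : seq nat -> R) :
  \sum_(p < L) \sum_(s : n.-tuple 'I_L) G (val p :: map val s) =
  \sum_(s : n.+1.-tuple 'I_L) G (map val s).
Proof.
rewrite pair_big /=.
rewrite (reindex (fun ps : 'I_L * n.-tuple 'I_L => cons_tuple ps.1 ps.2)) //=.
exists (fun s => (thead s, [tuple of behead s])) => [[p s] _|s _] /=.
  by congr pair; apply/val_inj.
by rewrite [RHS]tuple_eta; apply/val_inj.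
Qed.

Lemma iterated_cell n (F : seq nat -> R) L :
  (forall s p, p \in s -> (L <= p)%N -> F s = 0) ->
  iterated_integral D (fun v : n.-tuple R => F [seq cell u | u <- v]) =
  a^-1 ^+ n * \sum_(s : n.-tuple 'I_L) F (map val s).
Proof.
elim: n F => [|n ih] F FL /=.
  rewrite expr0 mul1r (big_pred1 [tuple])//= => s.
  by rewrite [s]tuple0; exact/esym/eqP.
pose h z := iterated_integral D (fun v : n.-tuple R => F (z :: [seq cell u | u <- v])).
have hE z : h z = a^-1 ^+ n * \sum_(s : n.-tuple 'I_L) F (z :: map val s).
  apply: (ih (fun s => F (z :: s))) => s p ps pL.
  by apply: (FL _ p) => //; rewrite inE ps orbT.
rewrite [LHS](@integral_cell h L); last first.
  by move=> p Lp; rewrite hE big1 ?mulr0// => s _; apply: (FL _ p); rewrite ?inE ?eqxx.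
rewrite exprS -mulrA -sum_tuple_cons; congr (_ * _).
by rewrite big_distrr /=; apply: eq_bigr => p _; exact: hE.
Qed.

(** For a kernel supported on finitely many cells the iterated integrals are
    sums over index tuples, so that the Fredholm series is the finite expansion
    of a determinant. *)
Lemma fredholm_det_cell (k : nat -> nat -> R) L :
  (forall p q, (L <= p)%N -> k p q = 0) ->
  fredholm_det (fun u v => a * k (cell u) (cell v)) D =
  \det (1%:M - \matrix_(p < L, q < L) k p q).
Proof.
move=> kL; set M := \matrix_(p < L, q < L) k p q.
have coefE n : iterated_integral D (fun v : n.-tuple R =>
     \det (\matrix_(i < n, j < n) (a * k (cell (tnth v i)) (cell (tnth v j))))) =
   \sum_(f : {ffun 'I_n -> 'I_L}) \det (mxsub f f M).
  pose F (s : seq nat) := if size s == n then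
    \det (\matrix_(i < n, j < n) (a * k (nth 0%N s i) (nth 0%N s j))) else 0.
  rewrite (_ : (fun v => _) = fun v : n.-tuple R => F [seq cell u | u <- v]); last first.
    apply/funext => v; rewrite /F size_map size_tuple eqxx.
    congr (\det _); apply/matrixP => i j; rewrite !mxE.
    by rewrite !(nth_map 0) ?size_tuple// !(tnth_nth 0).
  rewrite (@iterated_cell n F L); last first.
    move=> s p ps Lp; rewrite /F; case: eqP => // sn.
    have /(nthP 0%N)[i isz pE] := ps; rewrite sn in isz.
    rewrite (expand_det_row _ (Ordinal isz)) big1// => j _.
    by rewrite mxE /= pE kL ?mulr0 ?mul0r.
  rewrite (reindex (fun f : {ffun 'I_n -> 'I_L} => [tuple f i | i < n])) /=; last first.
    exists (fun s : n.-tuple 'I_L => [ffun i => tnth s i]) => [f _|s _].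
      by apply/ffunP => i; rewrite ffunE tnth_mktuple.
    by apply/eq_from_tnth => i; rewrite tnth_mktuple ffunE.
  rewrite big_distrr /=; apply: eq_bigr => f _.
  rewrite /F size_map size_tuple card_ord eqxx.
  set s := [seq val i | i <- _].
  have nthE (i : 'I_n) : nth 0%N s i = f i.
    rewrite (nth_map (f i)) ?size_map -?enumT ?size_enum_ord//.
    by rewrite (nth_map i) -?enumT ?size_enum_ord// nth_ord_enum.
  transitivity (a^-1 ^+ n * \det (a *: mxsub f f M)).
    by congr (_ * \det _); apply/matrixP => i j; rewrite !mxE !nthE.
  by rewrite detZ mulrA -exprMn mulVf ?gt_eqF// expr1n mul1r.
rewrite /fredholm_det det_fredholm; apply: lim_near_cst => //.
exists L.+1 => // m /= Lm.
rewrite /series /= (big_cat_nat (leq0n L.+1) Lm)/= [X in _ + X]big_nat_cond.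
rewrite [X in _ + X]big1 => [|n /andP[/andP[Ln _] _]]; last first.
  by rewrite coefE sum_minors_gt// mulr0.
rewrite addr0 big_mkord; apply: eq_bigr => n _; rewrite coefE -mulrA mulrCA; congr (_ * _).
by rewrite big_distrr /=; apply: eq_bigr => f _; rewrite mxsub_opp.
Qed.

End step_kernel.

(** * The edge kernel and its limits *)

Section edge_kernel.
Context {R : realType}.
Local Notation mu := (@lebesgue_measure R).
Variable y : R.

Let D : set R := `]y, +oo[%classic.
Let mD : measurable D. Proof. exact: measurable_itv. Qed.
Let P : set R := `]0, +oo[%classic.
Let mP : measurable P. Proof. exact: measurable_itv. Qed.

(** The least integer m with (m - 2 a^3) / a > y. *)
Definition edge_site (a : R) : int := Num.floor (2 * a ^+ 3 + y * a) + 1.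

(** The one-particle amplitude at time a^3 from i + 1 to - edge_site a - p, the
    p-th site to the left of the half-line that starts at 1 - edge_site a. *)
Definition edge_wave (a : R) (i p : nat) : R :=
  bessel (edge_site a + p%:Z + i.+1%:Z) (a ^+ 3).

Lemma edge_site_itv a : 2 * a ^+ 3 + y * a < (edge_site a)%:~R <= 2 * a ^+ 3 + y * a + 1.
Proof.
by rewrite /edge_site floorD1_gt /= rmorphD rmorph1 lerD2r floor_le.
Qed.

Let cell_itv (c a u : R) : 0 < a -> c < u -> u - a^-1 < c + (cell c a u)%:R / a <= u.
Proof.
move=> a0 cu; have := cellE a0 (cell c a u) (ltW cu); rewrite eqxx => /esym.
rewrite mem_setE in_itv /= => /andP[h1 h2]; rewrite h1 andbT.
by rewrite -[(cell c a u).+1]addn1 natrD mulrDl mul1r addrA in h2; lra.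
Qed.

(** The order of the Bessel function in the cell of u, seen from the edge, is u
    plus the rescaled index i, up to the mesh 1/a. *)
Lemma edge_position a u i : 1 <= a -> y < u ->
  u - a^-1 + i%:R / a <= ((edge_site a + (cell y a u)%:Z + i%:Z)%:~R - 2 * a ^+ 3) / a
    <= u + a^-1 + i%:R / a.
Proof.
move=> a1 yu; have a0 : 0 < a by exact: lt_le_trans a1.
have /andP[h1 h2] := cell_itv a0 yu; have /andP[m1 m2] := edge_site_itv a.
have an : a != 0 by rewrite gt_eqF.
have m1' : y <= ((edge_site a)%:~R - 2 * a ^+ 3) / a.
  by rewrite ler_pdivlMr//; lra.
have m2' : ((edge_site a)%:~R - 2 * a ^+ 3) / a <= y + a^-1.
  by rewrite ler_pdivrMr// (mulrDl y) mulVf//; lra.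
have -> : ((edge_site a + (cell y a u)%:Z + i%:Z)%:~R - 2 * a ^+ 3) / a =
   ((edge_site a)%:~R - 2 * a ^+ 3) / a + (cell y a u)%:R / a + i%:R / a.
  by rewrite !rmorphD /=; field.
by rewrite !lerD2r; apply/andP; split; lra.
Qed.

Definition edge_mass : R := edge_bound * expR 1.

Let bound0 : 0 <= @edge_bound R.
Proof.
rewrite /edge_bound !mulr_ge0 ?expR_ge0 ?invr_ge0 ?pi_ge0//.
by rewrite Rintegral_ge0// => u _; exact: expR_ge0.
Qed.

Let mass0 : 0 <= edge_mass.
Proof. by rewrite /edge_mass mulr_ge0 ?expR_ge0. Qed.

Let mu0 u : 0 <= edge_mass * expR (- u).
Proof. exact: mulr_ge0 mass0 (expR_ge0 _). Qed.

Lemma edge_wave_le a i u : 1 <= a -> y < u ->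
  `|a * edge_wave a i (cell y a u)| <= edge_mass * expR (- u) * expR (- (i.+1%:R / a)).
Proof.
move=> a1 yu; have a0 : 0 < a by exact: lt_le_trans a1.
apply: (le_trans (bessel_edge_le _ a1)).
rewrite /edge_mass -!(mulrA edge_bound); apply: (ler_wpM2l bound0).
rewrite -!expRD ler_expR; have /andP[h _] := edge_position i.+1 a1 yu.
have ai : a^-1 <= 1 by rewrite invf_le1.
by lra.
Qed.

(** A bound for the edge kernel on the diagonal, uniform in the scale and in
    the number of particles. *)
Definition edge_dominant u : R := edge_mass ^+ 2 / 2 * expR (- 2 * u).

Let dom0 u : 0 <= edge_dominant u.
Proof. by rewrite /edge_dominant mulr_ge0 ?expR_ge0// divr_ge0// sqr_ge0. Qed.

Lemma integrable_expRN_open (c k C : R) : 0 < k ->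
  mu.-integrable `]c, +oo[%classic (EFin \o (fun u => C * expR (- k * u))).
Proof.
move=> k0; have mc : measurable (`]c, +oo[%classic : set R) by exact: measurable_itv.
rewrite (_ : EFin \o _ = fun u => (C%:E * (expR (- k * u))%:E)%E); last first.
  by apply/funext => u; rewrite /= EFinM.
apply: (@integrableZl _ _ _ mu _ mc).
apply: (@integrableS _ _ _ mu `[c, +oo[%classic _ _ (measurable_itv _) mc).
  by move=> x; rewrite /= !in_itv /= !andbT => /ltW.
exact: integrable_expRN.
Qed.

Let idom : mu.-integrable D (EFin \o edge_dominant).
Proof. exact: integrable_expRN_open. Qed.

(** The ratio q = exp(- 2/a) satisfies q / (1 - q) <= a/2. *)
Lemma geometric_edge (a : R) N : 0 < a -> a^-1 * \sum_(i < N) expR (- 2 * (i.+1%:R / a)) <= 2^-1.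
Proof.
move=> a0; pose q := expR (- 2 / a); have q0 : 0 < q by exact: expR_gt0.
have qa : q * (2 / a + 1) <= 1.
  have h : 1 + 2 / a <= expR (2 / a) by exact: expR_ge1Dx.
  rewrite addrC (le_trans (ler_wpM2l (ltW q0) h))// /q -expRD.
  by rewrite mulNr addNr expR0.
have geo : (1 - q) * \sum_(i < N) q ^+ i.+1 <= q.
  suff -> : (1 - q) * \sum_(i < N) q ^+ i.+1 = q - q ^+ N.+1.
    by rewrite gerBl exprn_ge0 // ltW.
  elim: N => [|N ih]; first by rewrite big_ord0 mulr0 expr1 subrr.
  by rewrite big_ord_recr /= mulrDr ih !exprS; ring.
have -> : \sum_(i < N) expR (- 2 * (i.+1%:R / a)) = \sum_(i < N) q ^+ i.+1.
  apply: eq_bigr => i _; rewrite /q -expRM_natl; congr expR; ring.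
set S := \sum_(i < N) _ in geo *.
have S0 : 0 <= S by apply: sumr_ge0 => i _; rewrite exprn_ge0// ltW.
have ia : 0 < a^-1 by rewrite invr_gt0.
have q1 : q < 1 by rewrite expR_lt1 mulNr oppr_lt0 divr_gt0.
have h1 : q * (2 / a) <= 1 - q by rewrite mulrDr mulr1 in qa; lra.
have g1 : q * (a^-1 * S) = 2^-1 * (q * (2 / a) * S) by field; rewrite gt_eqF.
rewrite -(ler_pM2l q0) g1 [leRHS]mulrC ler_pM2l ?invr_gt0//.
exact: le_trans (ler_wpM2r S0 h1) geo.
Qed.

(** The kernel for N particles. The factor a is the density of cells, which
    makes the kernel converge as the scale grows. *)
Definition edge_kernel (a : R) (N p q : nat) : R := a * gram_kernel (edge_wave a) N p q.

Lemma edge_kernel_diag a N u : 1 <= a -> y < u ->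
  edge_kernel a N (cell y a u) (cell y a u) <= edge_dominant u.
Proof.
move=> a1 yu; have a0 : 0 < a by exact: lt_le_trans a1.
have -> : edge_kernel a N (cell y a u) (cell y a u) =
    a^-1 * \sum_(i < N) `|a * edge_wave a i (cell y a u)| ^+ 2.
  rewrite /edge_kernel /gram_kernel !big_distrr; apply: eq_bigr => i _ /=.
  by rewrite -normrX ger0_norm ?sqr_ge0//; field; rewrite gt_eqF.
apply: (@le_trans _ _ (a^-1 * \sum_(i < N) ((edge_mass * expR (- u)) ^+ 2 *
   expR (- 2 * (i.+1%:R / a))))).
  rewrite ler_wpM2l ?invr_ge0 ?(ltW a0)//; apply: ler_sum => i _.
  rewrite (_ : expR (- 2 * _) = expR (- (i.+1%:R / a)) ^+ 2); last first.
    by rewrite -expRM_natl; congr expR; ring.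
  rewrite -exprMn ler_sqr ?nnegrE ?normr_ge0 ?(mulr_ge0 (mu0 _) (expR_ge0 _))//.
  exact: edge_wave_le.
rewrite -mulr_sumr mulrCA /edge_dominant.
rewrite (_ : (edge_mass * expR (- u)) ^+ 2 = edge_mass ^+ 2 * expR (- 2 * u)); last first.
  by rewrite exprMn -expRM_natl; congr (_ * expR _); ring.
rewrite [leRHS]mulrAC; apply: ler_wpM2l; last exact: geometric_edge.
exact: mulr_ge0 (sqr_ge0 _) (expR_ge0 _).
Qed.

(** Stated for all w below the edge waves, to cover waves that are cut off. *)
Let wave_det_dom a (w : nat -> nat -> R) N n (v : n.-tuple R) : 1 <= a ->
  (forall i p, `|w i p| <= `|edge_wave a i p|) -> (forall x, x \in v -> D x) ->
  `|\det (\matrix_(i < n, j < n)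
     (a * gram_kernel w N (cell y a (tnth v i)) (cell y a (tnth v j))))|
  <= \prod_(x <- v) edge_dominant x.
Proof.
move=> a1 ww Dv; have a0 : 0 <= a by rewrite (le_trans ler01).
have gE p q : a * gram_kernel w N p q = gram_kernel (fun i p => Num.sqrt a * w i p) N p q.
  rewrite /gram_kernel big_distrr; apply: eq_bigr => i _ /=.
  by rewrite mulrACA -expr2 sqr_sqrtr.
rewrite (_ : \matrix_(i < n, j < n) _ = \matrix_(i < n, j < n)
   gram_kernel (fun i p => Num.sqrt a * w i p) N
     (cell y a (tnth v i)) (cell y a (tnth v j))); last first.
  by apply/matrixP => i j; rewrite !mxE gE.
apply: (le_trans (gram_kernel_det _ _ (fun i => cell y a (tnth v i)))).
rewrite big_tuple; apply: ler_prod => i _; rewrite -gE.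
rewrite mulr_ge0//=; last by rewrite sumr_ge0// => l _; rewrite -expr2 sqr_ge0.
have yv : y < tnth v i by have := Dv _ (mem_tnth i v); rewrite /D /= in_itv /= andbT.
apply: le_trans (edge_kernel_diag N a1 yv).
rewrite ler_wpM2l//; apply: ler_sum => l _.
by rewrite -!expr2 -[leLHS]real_normK ?num_real// -[leRHS]real_normK ?num_real// ler_sqr.
Qed.

Let disc a : 1 <= a -> discretizes D (cell y a).
Proof. by move=> a1; apply: discretizes_cell; exact: lt_le_trans a1. Qed.

Definition edge_matrix (a : R) (L N : nat) : 'M[R]_(L, N) := \matrix_(p, i) edge_wave a i p.

(** Sylvester's identity passes from size N to size L, where the determinant is
    the Fredholm determinant of the kernel cut off after L cells. *)
Lemma edge_det_cvg a N : 1 <= a ->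
  \det (1%:M - (edge_matrix a L N)^T *m edge_matrix a L N) @[L --> \oo] -->
  fredholm_det (fun u v => edge_kernel a N (cell y a u) (cell y a v)) D.
Proof.
move=> a1; have a0 : 0 < a by exact: lt_le_trans a1.
pose wL L i p := if (p < L)%N then edge_wave a i p else 0.
have E L : \det (1%:M - (edge_matrix a L N)^T *m edge_matrix a L N) =
    fredholm_det (fun u v => a * gram_kernel (wL L) N (cell y a u) (cell y a v)) D.
  rewrite (@fredholm_det_cell R y a a0 _ L); last first.
    move=> p q Lp; rewrite /gram_kernel big1// => i _.
    by rewrite /wL ltnNge Lp /= mul0r.
  rewrite -mulNmx (@det_1Dmul R N L) mulmxN; congr (\det (_ - _)).
  apply/matrixP => p q; rewrite !mxE; apply: eq_bigr => i _.
  by rewrite !mxE /wL !ltn_ord.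
under eq_fun do rewrite E.
apply: (@fredholm_det_cvg R D edge_dominant mD dom0 idom
  (fun L p q => a * gram_kernel (wL L) N p q) (fun=> cell y a)).
- by move=> _; exact: disc.
- move=> L n v Dv; apply: wave_det_dom => // i p.
  by rewrite /wL; case: ifP => // _; rewrite normr0.
move=> u v _ _; apply: cvg_near_cst.
exists (maxn (cell y a u) (cell y a v)).+1 => // L /=; rewrite gtn_max => /andP[uL vL].
congr (_ * _); apply: eq_bigr => i _; by rewrite /wL uL vL.
Qed.

(** As the number of particles grows, the kernel becomes the integral of the
    product of two translates of the step function below. *)
Definition edge_step (a : R) (p : nat) (s : R) : R := a * edge_wave a (cell 0 a s) p.

Definition edge_kernel_lim (a : R) (p q : nat) : R :=
  (\int[mu]_(s in P) (edge_step a p s * edge_step a q s))%R.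

Let step_bound a u v s : 1 <= a -> y < u -> y < v -> 0 < s ->
  `|edge_step a (cell y a u) s * edge_step a (cell y a v) s| <=
  edge_mass * expR (- u) * (edge_mass * expR (- v)) * expR (- 2 * s).
Proof.
move=> a1 yu yv s0; have a0 : 0 < a by exact: lt_le_trans a1.
have e : expR (- ((cell 0 a s).+1%:R / a)) <= expR (- s).
  rewrite ler_expR lerN2; have /andP[h _] := cell_itv a0 s0.
  rewrite -[(cell 0 a s).+1]addn1 natrD mulrDl mul1r; lra.
have h w : y < w -> `|edge_step a (cell y a w) s| <= edge_mass * expR (- w) * expR (- s).
  move=> yw; apply: (le_trans (edge_wave_le _ a1 yw)).
  exact: ler_wpM2l (mu0 _) _ _ e.
rewrite normrM (le_trans (ler_pM _ _ (h u yu) (h v yv)))//.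
rewrite (_ : - 2 * s = - s + - s) ?expRD; last by ring.
by rewrite mulrACA.
Qed.

Let measurable_step a p q : 1 <= a ->
  measurable_fun P (fun s => edge_step a p s * edge_step a q s).
Proof.
move=> a1; have a0 : 0 < a by exact: lt_le_trans a1.
exact: (@discretizes_cell R 0 a a0 (fun i => a * edge_wave a i p * (a * edge_wave a i q))).
Qed.

Let edge_kernel_cvg a u v : 1 <= a -> y < u -> y < v ->
  edge_kernel a N (cell y a u) (cell y a v) @[N --> \oo] -->
  edge_kernel_lim a (cell y a u) (cell y a v).
Proof.
move=> a1 yu yv; have a0 : 0 < a by exact: lt_le_trans a1.
set p := cell y a u; set q := cell y a v.
pose F N i := if (i < N)%N then a * edge_wave a i p * (a * edge_wave a i q) else 0.
have E N : edge_kernel a N p q = (\int[mu]_(s in P) F N (cell 0 a s))%R.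
  rewrite (@integral_cell R 0 a a0 (F N) N); last by move=> i Ni; rewrite /F ltnNge Ni.
  rewrite /edge_kernel /gram_kernel !big_distrr; apply: eq_bigr => i _.
  by rewrite /F ltn_ord /=; field; rewrite gt_eqF.
under eq_fun do rewrite E.
apply: (dominated_Rintegral (g := fun s => edge_mass * expR (- u) * (edge_mass * expR (- v)) *
   expR (- 2 * s)) _ _ _ _ _).2 => //.
- by move=> N; exact: (@discretizes_cell R 0 a a0 (F N)).
- move=> s _; apply: cvg_near_cst; exists (cell 0 a s).+1 => // N /= sN.
  by rewrite /F sN.
- exact: integrable_expRN_open.
- move=> N s; rewrite /P /= in_itv /= andbT => s0; rewrite /F; case: ifP => _.
    exact: step_bound.
  by rewrite normr0 (mulr_ge0 (mulr_ge0 (mu0 _) (mu0 _)) (expR_ge0 _)).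
Qed.

Let edge_kernel_lim_dom a n (v : n.-tuple R) : 1 <= a -> (forall x, x \in v -> D x) ->
  `|\det (\matrix_(i < n, j < n) edge_kernel_lim a (cell y a (tnth v i)) (cell y a (tnth v j)))|
  <= \prod_(x <- v) edge_dominant x.
Proof.
move=> a1 Dv.
have yv i : y < tnth v i by have := Dv _ (mem_tnth i v); rewrite /D /= in_itv /= andbT.
have h : `|\det (\matrix_(i < n, j < n) edge_kernel a N (cell y a (tnth v i)) (cell y a (tnth v j)))|
  @[N --> \oo] --> `|\det (\matrix_(i < n, j < n)
    edge_kernel_lim a (cell y a (tnth v i)) (cell y a (tnth v j)))|.
  apply: cvg_norm; apply: cvg_det => i j; rewrite mxE; under eq_fun do rewrite mxE.
  exact: edge_kernel_cvg.
move/cvgr_to_le: h; apply; apply: nearW => N.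
exact: wave_det_dom.
Qed.

Definition edge_det (a : R) : R :=
  fredholm_det (fun u v => edge_kernel_lim a (cell y a u) (cell y a v)) D.

Lemma edge_det_cvg_particles a : 1 <= a ->
  fredholm_det (fun u v => edge_kernel a N (cell y a u) (cell y a v)) D @[N --> \oo] -->
  edge_det a.
Proof.
move=> a1; apply: (@fredholm_det_cvg R D edge_dominant mD dom0 idom
  (edge_kernel a) (fun=> cell y a)).
- by move=> _; exact: disc.
- by move=> N n v Dv; exact: wave_det_dom.
by move=> u v; rewrite /D /= !in_itv /= !andbT => yu yv; exact: edge_kernel_cvg.
Qed.

(** The step functions converge to translates of the Airy function, hence the
    kernel to the Gram integral of the Airy function. *)
Lemma edge_det_cvg_airy (a : nat -> R) : (forall k, 1 <= a k) ->
  (a k)^-1 @[k --> \oo] --> (0 : R) -> edge_det (a k) @[k --> \oo] --> F2 y.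
Proof.
move=> a1 ay.
apply: (@fredholm_det_cvg R D edge_dominant mD dom0 idom
  (fun k => edge_kernel_lim (a k)) (fun k => cell y (a k))).
- by move=> k; exact: disc.
- by move=> k n v Dv; exact: edge_kernel_lim_dom.
move=> u v; rewrite /D /= !in_itv /= !andbT => yu yv.
rewrite airy_kernelE /airy_gram -Rintegral_itv_obnd_cbnd; last first.
  apply: (@integrableS _ _ _ mu `[0, +oo[%classic _ _ (measurable_itv _) mP).
    by move=> x; rewrite /P /= !in_itv /= !andbT => /ltW.
  exact: integrable_gram.
have wave w s : y < w -> 0 < s ->
    edge_step (a k) (cell y (a k) w) s @[k --> \oo] --> airy_shift (w + s).
  move=> yw s0; apply: (@bessel_edge_cvg R a _ _ (y - 1)) => //; last first.
    move=> k; have /andP[h _] := edge_position (cell 0 (a k) s).+1 (a1 k) yw.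
    apply: le_trans h; have ak0 : 0 < a k by exact: lt_le_trans (a1 k).
    have : (a k)^-1 <= 1 by rewrite invf_le1.
    have : 0 <= (cell 0 (a k) s).+1%:R / a k by rewrite divr_ge0// ltW.
    by lra.
  have lo : w + s - (a k)^-1 @[k --> \oo] --> w + s.
    by rewrite -[X in _ --> X]subr0; apply: cvgB => //; exact: cvg_cst.
  have hi : w + s + ((a k)^-1 + (a k)^-1) @[k --> \oo] --> w + s.
    rewrite -[X in _ --> X]addr0 -[X in _ --> _ + X](addr0 0).
    by apply: cvgD; [exact: cvg_cst|exact: cvgD].
  apply: squeeze_cvgr lo hi; apply: nearW => k.
  have ak0 : 0 < a k by exact: lt_le_trans (a1 k).
  have /andP[h1 h2] := edge_position (cell 0 (a k) s).+1 (a1 k) yw.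
  have /andP[s1 s2] := cell_itv ak0 s0.
  move: h1 h2; rewrite -[(cell 0 (a k) s).+1]addn1 natrD mulrDl mul1r => h1 h2.
  by apply/andP; split; lra.
apply: (dominated_Rintegral (g := fun s => edge_mass * expR (- u) * (edge_mass * expR (- v)) *
   expR (- 2 * s)) _ _ _ _ _).2 => //.
- by move=> k; exact: measurable_step.
- move=> s; rewrite /P /= in_itv /= andbT => s0.
  by apply: cvgM; exact: wave.
- exact: integrable_expRN_open.
- by move=> k s; rewrite /P /= in_itv /= andbT => s0; exact: step_bound.
Qed.

End edge_kernel.

(** * Ordered positions of the particles *)

Section positions.
Variable N : nat.
Implicit Types (X Y Z : config N) (j k : int).

Definition positions X : seq int := sort <=%R (val X).

Lemma mem_positions X k : (k \in positions X) = (k \in val X).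
Proof. by rewrite /positions mem_sort. Qed.

Lemma size_positions X : size (positions X) = N.
Proof. by rewrite /positions size_sort; exact/eqP/(valP X). Qed.

Lemma lt_sorted_positions X : sorted <%R (positions X).
Proof.
rewrite /positions sort_lt_sorted; exact: fset_uniq.
Qed.

Lemma positions_uniq X : uniq (positions X).
Proof. by rewrite /positions sort_uniq fset_uniq. Qed.

Lemma positionsP X (s : seq int) : sorted <%R s -> s =i val X -> positions X = s.
Proof.
move=> ss sX; apply: lt_sorted_eq => //; first exact: lt_sorted_positions.
by move=> k; rewrite mem_positions sX.
Qed.

(** A boundary bond never carries two particles, so that the exchange preserves
    the order of the particles. *)
Lemma positions_swap j X : boundary j X ->
  positions (swap j X) = [seq exchange j k | k <- positions X].
Proof.
move=> bj; apply: positionsP; last first.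
  move=> k; rewrite mem_swap -mem_positions; apply/mapP/idP.
    by move=> [l lX ->]; rewrite exchangeK.
  by move=> kX; exists (exchange j k); rewrite ?exchangeK.
rewrite sorted_map.
have := lt_sorted_positions X; apply: (@sub_in_sorted _ [pred k | k \in val X]).
  move=> k l; rewrite !inE => kX lX kl /=.
  move: bj; rewrite /boundary /exchange.
  have [kj|kj] := eqVneq k j.
    have [lj|lj] := eqVneq l j; first by move=> _; move: kl; rewrite kj lj ltxx.
    have [lj1|lj1] := eqVneq l (j + 1); last by move=> _; lia.
    by rewrite -kj in lj1 *; rewrite kX -lj1 lX.
  move=> _; have [lj|lj] := eqVneq l j.
    by have [kj1|kj1] := eqVneq k (j + 1); lia.
  by have [kj1|kj1] := eqVneq k (j + 1); have [lj1|lj1] := eqVneq l (j + 1); lia.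
by apply/allP => k; rewrite mem_positions.
Qed.

Definition position X (i : 'I_N) : int := nth 0 (positions X) i.

Lemma position_in X i : position X i \in val X.
Proof. by rewrite -mem_positions mem_nth// size_positions. Qed.

Lemma position_inj X : injective (position X).
Proof.
move=> i j /eqP; rewrite nth_uniq ?size_positions// ?positions_uniq//.
by move/eqP/val_inj.
Qed.

Lemma big_positions (V : nmodType) X (G : int -> V) :
  \sum_(x <- val X) G x = \sum_(i < N) G (position X i).
Proof.
have -> : \sum_(x <- val X) G x = \sum_(x <- positions X) G x.
  by apply: perm_big; rewrite /positions perm_sym perm_sort.
by rewrite (big_nth 0) size_positions big_mkord.
Qed.

Definition jump (s : 'I_N -> int) (i : 'I_N) (e : int) : 'I_N -> int :=
  fun l => if l == i then s l + e else s l.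

Lemma position_swap_right X i : position X i + 1 \notin val X ->
  position (swap (position X i) X) = jump (position X) i 1.
Proof.
move=> iX; apply/funext => k; rewrite /jump.
have b : boundary (position X i) X by rewrite /boundary position_in (negbTE iX).
rewrite {1}/position positions_swap// (nth_map 0) ?size_positions// -/(position X k).
rewrite /exchange (inj_eq (@position_inj X)); case: eqP => [->//|ki].
case: eqP => // e; by rewrite -e position_in in iX.
Qed.

Lemma position_swap_left X i : position X i - 1 \notin val X ->
  position (swap (position X i - 1) X) = jump (position X) i (- 1).
Proof.
move=> iX; apply/funext => k; rewrite /jump.
have b : boundary (position X i - 1) X.
  by rewrite /boundary subrK position_in (negbTE iX).
rewrite {1}/position positions_swap// (nth_map 0) ?size_positions// -/(position X k).
rewrite /exchange subrK (inj_eq (@position_inj X)).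
case: eqP => [e|_]; first by rewrite -e position_in in iX.
by case: eqP => // ->.
Qed.

(** A boundary bond carries one particle, either at its left end or at its
    right end, which splits the sum into G1 and G2. *)
Lemma fsum_bonds (V : zmodType) X (G : int -> V) :
  \sum_(j \in [set: int]) (if boundary j X then G j else 0) =
  \sum_(i < N) ((if position X i + 1 \in val X then 0 else G (position X i)) +
                (if position X i - 1 \in val X then 0 else G (position X i - 1))).
Proof.
pose G1 j := if (j \in val X) && (j + 1 \notin val X) then G j else 0.
pose G2 j := if (j \notin val X) && (j + 1 \in val X) then G j else 0.
have -> : \sum_(j \in [set: int]) (if boundary j X then G j else 0) =
    \sum_(j \in [set: int]) G1 j + \sum_(j \in [set: int]) G2 j.
  have e1 j : j \notin val X -> G1 j = 0 by rewrite /G1 => /negbTE ->.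
  pose A : {fset int} := (val X `|` [fset x - 1 | x in val X])%fset.
  have A2 j : j + 1 \in val X -> j \in A.
    move=> jX; rewrite inE; apply/orP; right; apply/imfsetP; exists (j + 1) => //.
    by rewrite addrK.
  have A1 j : j \in val X -> j \in A by move=> jX; rewrite inE jX.
  rewrite (fsbigTE A) => [|j jA]; last first.
    rewrite /boundary; case: ifP => // h.
    by case/negP: jA; move: h; case jX : (j \in val X); [rewrite A1|case jX1: (j + 1 \in val X) => // _; rewrite A2].
  rewrite (fsbigTE A) => [|j jA]; last first.
    by rewrite /G1; case: ifP => // /andP[/A1 h _]; rewrite h in jA.
  rewrite (fsbigTE A) => [|j jA]; last first.
    by rewrite /G2; case: ifP => // /andP[_ /A2 h]; rewrite h in jA.
  rewrite -big_split; apply: eq_bigr => j _ /=; rewrite /boundary /G1 /G2.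
  by case: (j \in val X); case: (j + 1 \in val X); rewrite ?addr0 ?add0r.
rewrite (fsbigTE (val X)) => [|j /negbTE jX]; last by rewrite /G1 jX.
rewrite (fsbigTE [fset x - 1 | x in val X]%fset) => [|j jX]; last first.
  rewrite /G2; case: ifP => // /andP[_ h]; case/negP: jX.
  by apply/imfsetP; exists (j + 1) => //; rewrite addrK.
rewrite big_imfset /=; last by move=> x z _ _ /addIr.
rewrite !big_positions -big_split; apply: eq_bigr => i _ /=.
rewrite /G1 /G2 subrK position_in andbT /=.
by case: (position X i + 1 \in val X); case: (position X i - 1 \in val X).
Qed.

End positions.

(** * Transition amplitudes as determinants *)

Section derive_det.
Context {R : realType}.

Lemma is_derive_big_sum (I : Type) (r : seq I) (f : I -> R -> R) (df : I -> R) (t : R) :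
  (forall i, is_derive t 1 (f i) (df i)) ->
  is_derive t 1 (fun s => \sum_(i <- r) f i s) (\sum_(i <- r) df i).
Proof.
move=> d; elim: r => [|i r ih].
  by under eq_fun do rewrite big_nil; rewrite big_nil; exact: is_derive_cstR.
by under eq_fun do rewrite big_cons; rewrite big_cons; exact: is_derive_addR.
Qed.

Lemma is_derive_big_prod (I : eqType) (r : seq I) (f : I -> R -> R) (df : I -> R) (t : R) :
  uniq r -> (forall i, is_derive t 1 (f i) (df i)) ->
  is_derive t 1 (fun s => \prod_(i <- r) f i s)
    (\sum_(i <- r) \prod_(k <- r) (if k == i then df k else f k t)).
Proof.
move=> + d; elim: r => [_|i r ih /= /andP[ir ur]].
  by under eq_fun do rewrite big_nil; rewrite big_nil; exact: is_derive_cstR.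
under eq_fun do rewrite big_cons.
apply: (is_derive_eq (is_derive_mulR (d i) (ih ur))).
rewrite big_cons big_cons eqxx; congr (_ * _ + _).
  by apply: eq_big_seq => k kr; case: eqP => // e; rewrite -e kr in ir.
rewrite mulr_sumr; apply: eq_big_seq => l lr; rewrite big_cons.
by case: eqP => // e; rewrite e lr in ir.
Qed.

Lemma is_derive_det n (A : R -> 'M[R]_n) (dA : 'M[R]_n) (t : R) :
  (forall i j, is_derive t 1 (fun s => A s i j) (dA i j)) ->
  is_derive t 1 (fun s => \det (A s))
    (\sum_i \det (\matrix_(k, j) if k == i then dA k j else A t k j)).
Proof.
move=> d; rewrite /determinant exchange_big /=.
apply: is_derive_big_sum => s; rewrite -mulr_sumr.
have dp := is_derive_big_prod (f := fun i u => A u i (s i)) (df := fun i => dA i (s i))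
  (index_enum_uniq _) (fun i => d i (s i)).
apply: (is_derive_eq (is_derive_mulR (is_derive_cstR t ((-1) ^+ s)) dp)).
rewrite mul0r add0r; congr (_ * _).
by apply: eq_bigr => i _; apply: eq_bigr => k _; rewrite mxE.
Qed.

End derive_det.

Section amplitude.
Context {R : realType}.
Variable N : nat.
Implicit Types (X Y : config N) (t : R).

(** The positions may coincide, so that all jumps are allowed in the evolution
    equation below. *)
Definition free_amplitude (s : 'I_N -> int) t : R :=
  \det (\matrix_(i < N, j < N) bessel (j.+1%:Z - s i) t).

Lemma is_derive_free_amplitude s t : is_derive t 1 (free_amplitude s)
  (\sum_i (free_amplitude (jump s i 1) t - free_amplitude (jump s i (- 1)) t)).
Proof.
have h := @is_derive_det R N (fun t => \matrix_(i < N, j < N) bessel (j.+1%:Z - s i) t)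
  (\matrix_(i < N, j < N) (bessel (j.+1%:Z - s i - 1) t - bessel (j.+1%:Z - s i + 1) t)) t.
apply: (is_derive_eq (h _)) => [i j|].
  rewrite mxE; under eq_fun do rewrite mxE; exact: is_derive_bessel.
apply: eq_bigr => i _.
rewrite /free_amplitude (@determinant_multilinear _ _ _
  (\matrix_(k < N, j < N) bessel (j.+1%:Z - jump s i 1 k) t)
  (\matrix_(k < N, j < N) bessel (j.+1%:Z - jump s i (- 1) k) t) i 1 (- 1)).
- by rewrite mul1r mulN1r.
- apply/rowP => j; rewrite !mxE /jump eqxx mul1r mulN1r.
  by rewrite !opprD opprK !addrA.
- apply/matrixP => k j; rewrite !mxE /jump.
  by rewrite eq_sym (negbTE (neq_lift i k)).
- apply/matrixP => k j; rewrite !mxE /jump.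
  by rewrite eq_sym (negbTE (neq_lift i k)).
Qed.

Lemma free_amplitude_eq0 s t i k : i != k -> s i = s k -> free_amplitude s t = 0.
Proof.
move=> ik sik; apply: (determinant_alternate ik) => j; by rewrite !mxE sik.
Qed.

Definition amplitude X t : R := free_amplitude (position X) t.

(** The operator - i H in the gauge that makes it real. *)
Definition drift (f : config N -> R) X : R := \sum_(i < N)
  ((position X i + 1 \notin val X)%:R * f (swap (position X i) X) -
   (position X i - 1 \notin val X)%:R * f (swap (position X i - 1) X)).

Lemma position_surj X k : k \in val X -> exists i, position X i = k.
Proof.
rewrite -mem_positions => /(nthP 0)[l]; rewrite size_positions => lN <-.
by exists (Ordinal lN).
Qed.

(** Exclusion is automatic: a jump onto an occupied site gives a determinant
    with two equal rows. *)
Lemma is_derive_amplitude X t :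
  is_derive t 1 (amplitude X) (drift (amplitude ^~ t) X).
Proof.
apply: (is_derive_eq (is_derive_free_amplitude (position X) t)).
have jump0 i e : e != 0 -> position X i + e \in val X ->
    free_amplitude (jump (position X) i e) t = 0.
  move=> e0 h; have [k kE] := position_surj h.
  have ik : i != k.
    apply/eqP => ik; move: kE e0; rewrite ik => /eqP.
    by rewrite -subr_eq0 opprD addNKr oppr_eq0 => ->.
  by apply: (free_amplitude_eq0 _ ik); rewrite /jump eqxx eq_sym (negbTE ik) kE.
apply: eq_bigr => i _; congr (_ - _).
  case: (boolP (position X i + 1 \in val X)) => h; first by rewrite jump0// mul0r.
  by rewrite mul1r /amplitude position_swap_right.
case: (boolP (position X i - 1 \in val X)) => h; first by rewrite jump0// mul0r.
by rewrite mul1r /amplitude position_swap_left.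
Qed.

Lemma mem_initial (k : int) : (k \in val (initial N)) = (1 <= k <= N%:Z).
Proof.
apply/imfsetP/idP => /= [[l]|kN].
  by rewrite mem_iota => /andP[_ lN] ->; lia.
exists `|k - 1|%N; last by lia.
by rewrite mem_iota; lia.
Qed.

Lemma position_initial i : position (initial N) i = i.+1%:Z.
Proof.
rewrite /position (@positionsP _ _ [seq k.+1%:Z | k <- iota 0 N]).
- by rewrite (nth_map 0%N) ?size_iota// nth_iota.
- rewrite sorted_map; apply: (sub_sorted _ (iota_ltn_sorted 0 N)).
  by move=> k l /=; rewrite ltz_nat ltnS.
- move=> k; rewrite mem_initial; apply/mapP/idP => [[l]|kN].
    by rewrite mem_iota => lN ->; lia.
  by exists `|k - 1|%N; [rewrite mem_iota; lia|lia].
Qed.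

Lemma amplitude0 X : amplitude X 0 = (X == initial N)%:R.
Proof.
rewrite /amplitude /free_amplitude; case: eqVneq => [->|XI].
  rewrite -[RHS](det1 _ N); congr (\det _); apply/matrixP => i j.
  rewrite !mxE bessel0 position_initial subr_eq0 eqz_nat eqSS.
  by rewrite eq_sym -val_eqE.
have [i iX] : exists i, position X i \notin val (initial N).
  apply/not_existsP => h; case/negP: XI; apply/eqP/val_inj/eqP.
  rewrite eqEfcard (eqP (valP X)) (eqP (valP (initial N))) leqnn andbT.
  apply/fsubsetP => k /position_surj[l <-].
  by apply/negPn/negP; exact: h.
rewrite (expand_det_row _ i) big1// => j _; rewrite mxE bessel0.
case: eqP => [e|_]; last by rewrite mul0r.
by case/negP: iX; rewrite mem_initial; have := ltn_ord j; lia.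
Qed.

Lemma amplitude_le X t : `|amplitude X t| <= N`!%:R.
Proof.
have b1 n : `|bessel n t| <= 1.
  by apply: (le_trans (bessel_le n t 0)); rewrite mulr0 sinh0 normr0 mulr0 addr0 expR0.
apply: (le_trans (ler_norm_sum _ _ _)).
apply: (@le_trans _ _ (\sum_(s : 'S_N) 1)); last by rewrite sumr_const card_Sn.
apply: ler_sum => s _; rewrite normrM normrX normrN normr1 expr1n mul1r.
by rewrite normr_prod; apply: prodr_ile1 => i _; rewrite mxE normr_ge0 b1.
Qed.

Let walk n := iter n drift (fun X => (X == initial N)%:R).

(** The partial sums of the exponential series of t times the drift. *)
Definition walk_sum (m : nat) X t : R := \sum_(n < m) t ^+ n / n`!%:R * walk n X.

Let drift_sum m (c : nat -> R) (f : nat -> config N -> R) X :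
  drift (fun Z => \sum_(n < m) c n * f n Z) X = \sum_(n < m) c n * drift (f n) X.
Proof.
rewrite /drift; under [RHS]eq_bigr do rewrite mulr_sumr.
rewrite exchange_big /=; apply: eq_bigr => i _.
by rewrite !mulr_sumr -sumrB; apply: eq_bigr => n _; ring.
Qed.

Lemma is_derive_walk_sum m X t :
  is_derive t 1 (walk_sum m.+1 X) (drift (walk_sum m ^~ t) X).
Proof.
have d n : is_derive t 1 (fun s => s ^+ n.+1 / (n.+1)`!%:R * walk n.+1 X)
    (t ^+ n / n`!%:R * walk n.+1 X).
  is_derive_tac; rewrite /= factS natrM.
  by field; rewrite nat1r !pnatr_eq0 -lt0n fact_gt0.
have -> : walk_sum m.+1 X = fun s => s ^+ 0 / 0`!%:R * walk 0 X +
    \sum_(n < m) s ^+ n.+1 / (n.+1)`!%:R * walk n.+1 X.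
  by apply/funext => s; rewrite /walk_sum big_ord_recl; congr (_ + _).
have d0 : is_derive t 1 (fun s => s ^+ 0 / 0`!%:R * walk 0 X) 0.
  by under eq_fun do rewrite expr0; exact: is_derive_cstR.
apply: (is_derive_eq (is_derive_addR d0 (is_derive_big_sum _ (fun n : 'I_m => d n)))).
rewrite add0r; symmetry.
exact: (drift_sum m (fun n => t ^+ n / n`!%:R) walk X).
Qed.

Lemma walk_sum0 m X : walk_sum m.+1 X 0 = (X == initial N)%:R.
Proof.
rewrite /walk_sum big_ord_recl expr0 fact0 divr1 mul1r big1 ?addr0// => n _.
by rewrite lift0 expr0n !mul0r.
Qed.

Lemma drift_le (f : config N -> R) (B : R) X : (forall Z, `|f Z| <= B) ->
  `|drift f X| <= (2 * N)%:R * B.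
Proof.
move=> fB; have B0 : 0 <= B by exact: le_trans (fB X).
apply: (le_trans (ler_norm_sum _ _ _)).
apply: (@le_trans _ _ (\sum_(i < N) (B + B))); last first.
  by rewrite sumr_const card_ord -mulr2n -mulrnA mulr_natl.
apply: ler_sum => i _; apply: (le_trans (ler_normB _ _)).
have h (b : bool) Z : `|b%:R * f Z| <= B.
  by case: b; rewrite ?mul1r ?mul0r ?normr0.
exact: lerD.
Qed.

(** Both sides solve the same linear system, one with the exact amplitudes and
    one with the truncated series, so the error after m steps is the m-th term
    of an exponential series. *)
Lemma amplitude_walk_sum m X t : 0 <= t ->
  `|amplitude X t - walk_sum m X t| <= N`!%:R * exp_coeff ((2 * N)%:R * t) m.
Proof.
move=> t0; elim: m X t t0 => [|m ih] X t t0.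
  rewrite /walk_sum big_ord0 subr0 /exp_coeff /= expr0 fact0 divr1 mulr1.
  exact: amplitude_le.
have df (s : R) := is_derive_addR (is_derive_amplitude X s)
  (is_derive_oppR (is_derive_walk_sum m X s)).
pose c : R := (2 * N)%:R.
have dg (s : R) : is_derive s 1 (fun s => N`!%:R * ((c * s) ^+ m.+1 / (m.+1)`!%:R))
    (c * (N`!%:R * exp_coeff (c * s) m)).
  is_derive_tac; rewrite /exp_coeff /= factS natrM.
  by field; rewrite nat1r !pnatr_eq0 -lt0n fact_gt0.
have h := derive_bound t0 df dg.
rewrite amplitude0 walk_sum0 subrr subr0 mulr0 expr0n mul0r mulr0 subr0 in h.
apply: h => s /andP[s0 st].
have -> : drift (amplitude ^~ s) X + - drift (walk_sum m ^~ s) X =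
    drift (fun Z => amplitude Z s - walk_sum m Z s) X.
  by rewrite /drift -sumrB; apply: eq_bigr => i _; ring.
by apply: drift_le => Z; exact: ih.
Qed.

Lemma walk_sum_cvg X t : 0 <= t -> walk_sum m X t @[m --> \oo] --> amplitude X t.
Proof.
move=> t0; apply/subr_cvg0; apply: norm_cvg0.
have c0 : N`!%:R * exp_coeff ((2 * N)%:R * t) m @[m --> \oo] --> (0 : R).
  rewrite -[X in _ --> X](mulr0 N`!%:R); apply: cvgM; first exact: cvg_cst.
  by apply: cvg_series_cvg_0; exact: is_cvg_series_exp_coeff.
apply: (squeeze_cvgr _ (cvg_cst 0) c0); apply: nearW => m.
by rewrite normr_ge0 distrC /= amplitude_walk_sum.
Qed.

End amplitude.

(** * From the Hamiltonian to real amplitudes *)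

Section gauge.
Context {R : realType}.
Variable N : nat.
Local Open Scope complex_scope.
Implicit Types (X Y : config N) (t : R) (z w : R[i]).

Lemma sqmodM z w : sqmod (z * w) = sqmod z * sqmod w.
Proof. by case: z w => [a b] [c d]; rewrite /sqmod /=; ring. Qed.

Lemma sqmodR (r : R) : sqmod r%:C = r ^+ 2.
Proof. by rewrite /sqmod /= expr0n addr0. Qed.

Lemma sqmod1 : sqmod (1 : R[i]) = 1.
Proof. by have := sqmodR 1; rewrite expr1n. Qed.

Lemma sqmod_i : sqmod ('i : R[i]) = 1.
Proof. by rewrite /sqmod /= expr0n expr1n add0r. Qed.

Lemma sqmodV z : sqmod z = 1 -> sqmod z^-1 = 1.
Proof.
have [->|z0 z1] := eqVneq z 0.
  by rewrite /sqmod /= expr0n /= addr0 => /eqP; rewrite eq_sym oner_eq0.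
by have := sqmodM z z^-1; rewrite mulfV// sqmod1 z1 mul1r.
Qed.

Lemma sqmod_eq0 z : sqmod z = 0 -> z = 0.
Proof.
case: z => a b; rewrite /sqmod /= => /eqP.
by rewrite paddr_eq0 ?sqr_ge0// !sqrf_eq0 => /andP[/eqP -> /eqP ->].
Qed.

Lemma sqmod_ge0 z : 0 <= sqmod z.
Proof. by rewrite addr_ge0 ?sqr_ge0. Qed.

Lemma sqmodB z w u : sqmod (z - w) <= 2 * sqmod (u - z) + 2 * sqmod (u - w).
Proof.
case: z w u => [a b] [c d] [e f]; rewrite /sqmod /=.
have := sqr_ge0 ((e - a) + (e - c)); have := sqr_ge0 ((f - b) + (f - d)).
by nra.
Qed.

(** The phase i^(x_1 + ... + x_N). *)
Definition gauge X : R[i] := \prod_(l < N) ('i : R[i]) ^ position X l.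

Let i_neq0 : ('i : R[i]) != 0.
Proof. by apply/eqP => -[/eqP]; rewrite oner_eq0. Qed.

Lemma gauge_neq0 X : gauge X != 0.
Proof. by apply/prodf_neq0 => l _; exact: expfz_neq0. Qed.

Lemma sqmod_gauge X : sqmod (gauge X) = 1.
Proof.
rewrite /gauge; apply: (big_ind (fun z => sqmod z = 1)); first exact: sqmod1.
  by move=> z w z1 w1; rewrite sqmodM z1 w1 mulr1.
move=> l _; have h n : sqmod (('i : R[i]) ^+ n) = 1.
  by elim: n => [|n ih]; rewrite ?expr0 ?sqmod1// exprS sqmodM ih sqmod_i mulr1.
by case: (position X l) => n; [exact: h|rewrite NegzE -exprnN; apply: sqmodV; exact: h].
Qed.

Lemma gauge_jump X Y l (e : int) : position Y = jump (position X) l e ->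
  gauge Y = gauge X * ('i : R[i]) ^ e.
Proof.
move=> YX; rewrite /gauge (bigD1 l)//= [in RHS](bigD1 l)//= YX {1}/jump eqxx.
rewrite expfzDr// -!mulrA; congr (_ * _); rewrite mulrC; congr (_ * _).
by apply: eq_bigr => k kl; rewrite /jump (negbTE kl).
Qed.

Lemma hamiltonian0E (f : config N -> R[i]) X : hamiltonian 0 f X = \sum_(l < N)
  ((position X l + 1 \notin val X)%:R * f (swap (position X l) X) +
   (position X l - 1 \notin val X)%:R * f (swap (position X l - 1) X)).
Proof.
rewrite /hamiltonian /local_hamiltonian.
under eq_fsbigr do rewrite oppr0 mul0r add0r.
rewrite fsum_bonds; apply: eq_bigr => l _.
by case: ifP; case: ifP; rewrite ?mul0r ?mul1r.
Qed.

(** A particle moving one site to the right contributes -i * i = 1 and one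
    moving to the left -i / i = -1. *)
Lemma iter_hamiltonian n X :
  (- 'i) ^+ n * iter n (hamiltonian 0) (Defs.basis (initial N)) X =
  gauge X / gauge (initial N) * (iter n (@drift R N) (fun Z => (Z == initial N)%:R) X)%:C.
Proof.
elim: n X => [|n ih] X /=.
  rewrite expr0 mul1r /Defs.basis eq_sym; case: eqVneq => [->|_]; last by rewrite mulr0.
  by rewrite mulfV ?gauge_neq0// mulr1.
rewrite hamiltonian0E mulr_sumr /drift rmorph_sum mulr_sumr; apply: eq_bigr => l _.
rewrite mulrDr rmorphB mulrBr !rmorphM !rmorph_nat; congr (_ + _).
  case: (boolP (position X l + 1 \in val X)) => h; first by rewrite !mul0r !mulr0.
  rewrite !mul1r exprS -mulrA ih (gauge_jump (position_swap_right h)) expr1z.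
  rewrite !mulrA [- 'i * gauge X]mulrC -!mulrA; congr (_ * _).
  by rewrite !mulrA mulNr -expr2 sqr_i opprK mul1r.
case: (boolP (position X l - 1 \in val X)) => h; first by rewrite !mul0r !mulr0 oppr0.
rewrite !mul1r exprS -mulrA ih (gauge_jump (position_swap_left h)) -mulrN.
rewrite !mulrA [- 'i * gauge X]mulrC -!mulrA; congr (_ * _).
by rewrite !mulrA mulNr (_ : ('i : R[i]) ^ (- 1) = 'i^-1)// mulfV// mulN1r mulNr mulrN.
Qed.

Lemma exp_partial_gauge t m X : exp_partial 0 t (Defs.basis (initial N)) m X =
  gauge X / gauge (initial N) * (walk_sum m X t)%:C.
Proof.
rewrite /exp_partial /walk_sum rmorph_sum mulr_sumr; apply: eq_bigr => n _.
rewrite -mulNr exprMn.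
have -> : (- 'i) ^+ n * t%:C ^+ n / n`!%:R * iter n (hamiltonian 0) (Defs.basis (initial N)) X =
  (t%:C ^+ n / n`!%:R) * ((- 'i) ^+ n * iter n (hamiltonian 0) (Defs.basis (initial N)) X) by ring.
rewrite iter_hamiltonian mulrCA; congr (_ * _).
by rewrite !rmorphM rmorphXn fmorphV rmorph_nat.
Qed.

(** Convergence of the exponential series in the l^2 norm gives convergence at
    X, where the limit is the amplitude up to a phase. *)
Lemma sqmod_psi t X : 0 <= t -> sqmod (psi 0 t (initial N) X) = amplitude X t ^+ 2.
Proof.
move=> t0; set Y := initial N; pose c := gauge X / gauge Y.
have c1 : sqmod c = 1 by rewrite /c sqmodM sqmodV ?sqmod_gauge ?mulr1.
suff -> : psi 0 t Y X = c * (amplitude X t)%:C by rewrite sqmodM c1 mul1r sqmodR.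
pose a m := exp_partial 0 t (Defs.basis Y) m X.
have h1 : sqmod (a m - psi 0 t Y X) @[m --> \oo] --> 0.
  have := @evolution_cvg R N 0 t Y => he.
  have h : (sqmod (a m - psi 0 t Y X))%:E @[m --> \oo] --> 0%E.
    apply: (squeeze_cvge _ (cvg_cst 0%E) he); apply: nearW => m.
    rewrite lee_fin sqmod_ge0 /=; apply: esum_ge; exists [set X]; first by split.
    by rewrite fsbig_set1.
  by move/fine_cvg: h.
have h2 : sqmod (a m - c * (amplitude X t)%:C) @[m --> \oo] --> 0.
  rewrite (_ : (fun m => _) = fun m => (walk_sum m X t - amplitude X t) ^+ 2); last first.
    by apply/funext => m; rewrite /a exp_partial_gauge -/c -mulrBr -rmorphB sqmodM c1 mul1r sqmodR.
  have h : walk_sum m X t - amplitude X t @[m --> \oo] --> 0.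
    by apply/subr_cvg0; exact: walk_sum_cvg.
  rewrite -[X in _ --> X](mulr0 0); under eq_fun do rewrite expr2.
  exact: cvgM.
apply/eqP; rewrite -subr_eq0; apply/eqP/sqmod_eq0/eqP; rewrite eq_le sqmod_ge0 andbT.
have h3 : 2 * sqmod (a m - psi 0 t Y X) + 2 * sqmod (a m - c * (amplitude X t)%:C)
    @[m --> \oo] --> (0 : R).
  rewrite -[X in _ --> X]addr0 -[X in _ --> X + _](mulr0 2) -[X in _ --> _ + X](mulr0 2).
  by apply: cvgD; apply: cvgM => //; exact: cvg_cst.
by apply: (cvgr_to_ge h3); apply: nearW => m; exact: sqmodB.
Qed.

End gauge.

(** * Configurations in a half-line *)

Section window.
Context {R : realType}.
Variables (N : nat) (x0 : int) (t : R).
Implicit Types (X : config N).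

(** The one-particle amplitudes from 1, ..., N to the sites x0, ..., x0 + L -
    1. *)
Definition window_matrix L : 'M[R]_(L, N) :=
  \matrix_(p, j) bessel (j.+1%:Z - (x0 + p%:Z)) t.

Definition in_window L X : Prop := forall k, k \in val X -> x0 <= k < x0 + L%:Z.

Definition in_half_line X : Prop := forall k, k \in val X -> x0 <= k.

Let sites L (S : {set 'I_L}) : {fset int} := [fset (x0 + p%:Z)%R | p : 'I_L in S]%fset.

Let card_sites L (S : {set 'I_L}) : #|` sites S| = #|S|.
Proof.
rewrite card_imfset /=; last by move=> p q /addrI [] /val_inj.
by rewrite cardE.
Qed.

Definition window_config L (S : {set 'I_L}) : config N := insubd (initial N) (sites S).

Let val_window_config L (S : {set 'I_L}) : #|S| == N -> val (window_config S) = sites S.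
Proof. by move=> cS; rewrite /window_config val_insubd card_sites cS. Qed.

Let mem_sites L (S : {set 'I_L}) (p : 'I_L) : (x0 + p%:Z \in sites S) = (p \in S).
Proof.
apply/imfsetP/idP => /= [[q qS /addrI [] /val_inj ->]//|pS].
by exists p.
Qed.

Lemma window_config_bij L :
  set_bij [set S : {set 'I_L} | #|S| == N] (in_window L) (@window_config L).
Proof.
split.
- move=> S /= cS k; rewrite (val_window_config cS) => /imfsetP[p /= _ ->].
  by have := ltn_ord p; lia.
- move=> S T; rewrite !inE => cS cT e; apply/setP => p.
  by rewrite -!mem_sites -(val_window_config cS) -(val_window_config cT) e.
- move=> X wX; pose S := [set p : 'I_L | x0 + p%:Z \in val X]%SET.
  have eS : sites S = val X.
    apply/fsetP => k; apply/imfsetP/idP => /= [[p]|kX]; first by rewrite inE => ? ->.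
    have /andP[k0 kL] := wX k kX; have pL : (`|k - x0|%N < L)%N by lia.
    have kE : k = x0 + (Ordinal pL)%:Z by rewrite /=; lia.
    by exists (Ordinal pL) => //; rewrite inE -kE.
  have cS : #|S| == N by rewrite -card_sites eS; exact: (valP X).
  by exists S => //; apply/val_inj; rewrite (val_window_config cS).
Qed.

Let minors L := window_matrix L *m (window_matrix L)^T.

Lemma amplitude_sqr_minor L (S : {set 'I_L}) : #|S| == N ->
  amplitude (window_config S) t ^+ 2 = \det (rows_from (minors L) S).
Proof.
move=> cS; set X := window_config S.
have fP (i : 'I_N) : {p : 'I_L | position X i = x0 + p%:Z}.
  apply: cid; have := position_in X i; rewrite (val_window_config cS).
  by move=> /imfsetP[p /= _ ->]; exists p.
pose f i := sval (fP i); have fE i : position X i = x0 + (f i)%:Z := svalP (fP i).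
have f_inj : injective f by move=> i j ij; apply: (@position_inj _ X); rewrite !fE ij.
have <- : [set f i | i : 'I_N]%SET = S.
  apply/eqP; rewrite eqEcard card_imset// card_ord (eqP cS) leqnn andbT.
  apply/fintype.subsetP => _ /imsetP[i _ ->].
  by rewrite -mem_sites -fE -(val_window_config cS) position_in.
rewrite -det_mxsub_inj//.
have -> : mxsub f f (minors L) = rowsub f (window_matrix L) *m (rowsub f (window_matrix L))^T.
  by apply/matrixP => i j; rewrite !mxE; apply: eq_bigr => k _; rewrite !mxE.
rewrite det_mulmx det_tr -expr2; congr (\det _ ^+ 2).
by apply/matrixP => i j; rewrite !mxE fE.
Qed.

(** Cauchy-Binet for the configurations contained in a finite window. *)
Lemma sum_window L :
  (\esum_(X in in_window L) (amplitude X t ^+ 2)%:E)%E =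
  (\det ((window_matrix L)^T *m window_matrix L))%:E.
Proof.
rewrite (reindex_esum _ _ _ _ (window_config_bij L)).
have fP : finite_set [set S : {set 'I_L} | #|S| == N] by exact: finite_finset.
rewrite esum_fset//; last by move=> S _; rewrite lee_fin sqr_ge0.
rewrite (@fsbigE _ _ _ _ _ [seq S : {set 'I_L} <- enum {: {set 'I_L}} | #|S| == N]) => [|||S /= cS]; last first.
- by rewrite mem_filter cS mem_enum.
- by move=> S /=; rewrite mem_filter => /andP[].
- by rewrite filter_uniq// enum_uniq.
rewrite big_filter_cond big_enum_cond /= sumEFin; congr EFin.
have n0 : N`!%:R != 0 :> R by rewrite pnatr_eq0 -lt0n fact_gt0.
apply: (mulfI n0); rewrite -andreief.
transitivity (\sum_(f : {ffun 'I_N -> 'I_L}) \det (mxsub f f (minors L))); last first.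
  apply: eq_bigr => f _.
  have -> : mxsub f f (minors L) = rowsub f (window_matrix L) *m (rowsub f (window_matrix L))^T.
    by apply/matrixP => i j; rewrite !mxE; apply: eq_bigr => k _; rewrite !mxE.
  by rewrite det_mulmx det_tr expr2.
rewrite sum_minors; congr (_ * _); apply: eq_big => [S|S /andP[cS _]].
  by case: (boolP (#|S| == N)) => cS //=; rewrite mem_set.
exact: amplitude_sqr_minor.
Qed.

(** The windows exhaust the half-line, and every finite set of configurations
    in the half-line lies in one of them. *)
Lemma sum_half_line (l : R) :
  \det ((window_matrix L)^T *m window_matrix L) @[L --> \oo] --> l ->
  (\esum_(X in in_half_line)
     (amplitude X t ^+ 2)%:E)%E = l%:E.
Proof.
move=> cl; set v := fun L => \det ((window_matrix L)^T *m window_matrix L) in cl.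
have a0 X : (0 <= (amplitude X t ^+ 2)%:E)%E by rewrite lee_fin sqr_ge0.
have vE L : (v L)%:E = (\esum_(X in in_window L) (amplitude X t ^+ 2)%:E)%E by rewrite sum_window.
have mono (A B : set (config N)) : A `<=` B -> (\esum_(X in A) (amplitude X t ^+ 2)%:E <=
    \esum_(X in B) (amplitude X t ^+ 2)%:E)%E.
  move=> AB; apply: ge_ereal_sup => _ [F [finF FA] <-].
  by apply: esum_ge; exists F => //; split => // X /FA /AB.
have vle L : v L <= l.
  have nd : nondecreasing_seq v.
    apply/nondecreasing_seqP => n; rewrite -lee_fin !vE; apply: mono => X wX k kX.
    by have := wX k kX; lia.
  rewrite -(cvg_lim _ cl)//; apply: nondecreasing_cvgn_le => //.
  by apply/cvg_ex; exists l.
apply/eqP; rewrite eq_le; apply/andP; split.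
  apply: ge_ereal_sup => _ [F [finF FA] <-].
  pose L := \max_(X <- fset_set F) \max_(k <- val X) `|k - x0|.+1.
  have FL : F `<=` in_window L.
    move=> X FX k kX; have /(_ k kX) x0k := FA X FX.
    have XF : X \in fset_set F by rewrite in_fset_set// mem_set.
    have h1 : (`|k - x0|.+1 <= \max_(k <- val X) `|k - x0|.+1)%N.
      by apply: (leq_bigmax_seq (F := fun k : int => `|k - x0|.+1)).
    have h2 : (\max_(k <- val X) `|k - x0|.+1 <= L)%N.
      by apply: (leq_bigmax_seq (F := fun X : config N => \max_(k <- val X) `|k - x0|.+1)).
    by lia.
  apply: (@le_trans _ _ (v L)%:E); last by rewrite lee_fin.
  by rewrite vE; apply: esum_ge; exists F.
have h : (v L)%:E @[L --> \oo] --> l%:E by apply: cvg_EFin; [exact: nearW|].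
apply: (cvge_to_le h); apply: nearW => L.
by rewrite vE; apply: mono => X wX k kX; have /andP[] := wX k kX.
Qed.

End window.

(** * The law of the left-most particle *)

Section leftmost.
Context {R : realType}.
Variable y : R.

Lemma edge_gram_cvg (a : R) (i j : nat) :
  cvgn (series (fun p => edge_wave y a i p * edge_wave y a j p)).
Proof.
pose c : R := expR (- (edge_site y a)%:~R + 2 * `|a ^+ 3| * sinh 1).
have s1 : 0 <= sinh 1 :> R by rewrite (le_trans ler01)// sinh_ge.
have we k p : `|edge_wave y a k p| <= c * expR (- 1) ^+ p.
  rewrite /edge_wave (le_trans (bessel_le _ _ 1))// (ger0_norm s1) /c -expRM_natl -expRD ler_expR.
  by rewrite !rmorphD /= mulr1; have : 0 <= k.+1%:R :> R by []; lra.
pose q : R := expR (- 1) * expR (- 1).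
have q1 : `|q| < 1.
  by rewrite ger0_norm ?mulr_ge0 ?expR_ge0// /q -expRD expR_lt1; lra.
apply: normed_cvg; apply: (@series_le_cvg _ _ (geometric (c * c) q)) => //.
- by move=> p /=.
- by move=> p; rewrite /geometric /= mulr_ge0 ?exprn_ge0 ?mulr_ge0 ?expR_ge0.
- move=> p; rewrite /= normrM (le_trans (ler_pM _ _ (we i p) (we j p)))//.
  by rewrite /geometric /= /q exprMn mulrACA.
- exact: is_cvg_geometric_series.
Qed.

(** By orthogonality of the Bessel sequence, the Gram matrix of the sites of
    the half-line is the identity minus the Gram matrix of the other sites. *)
Lemma window_det_cvg (a : R) N : 1 <= a ->
  \det ((window_matrix N (1 - edge_site y a) (a ^+ 3) L)^T *m
        window_matrix N (1 - edge_site y a) (a ^+ 3) L) @[L --> \oo] -->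
  fredholm_det (fun u v => edge_kernel y a N (cell y a u) (cell y a v)) `]y, +oo[.
Proof.
move=> a1; have t0 : 0 <= a ^+ 3 by rewrite exprn_ge0// (le_trans ler01).
pose M : 'M[R]_N := \matrix_(i, j) limn (series (fun p => edge_wave y a i p * edge_wave y a j p)).
have gE L i j : ((edge_matrix y a L N)^T *m edge_matrix y a L N) i j =
    series (fun p => edge_wave y a i p * edge_wave y a j p) L.
  rewrite !mxE seriesEord /=; apply: eq_bigr => p _; by rewrite !mxE.
have gM i j : ((edge_matrix y a L N)^T *m edge_matrix y a L N) i j @[L --> \oo] --> M i j.
  by under eq_fun do rewrite gE; rewrite mxE; exact: edge_gram_cvg.
have mB (A B : 'M[R]_N) i j : (A - B) i j = A i j - B i j by rewrite !mxE.
have h1 : \det (1%:M - (edge_matrix y a L N)^T *m edge_matrix y a L N) @[L --> \oo] -->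
    \det (1%:M - M).
  apply: cvg_det => i j; rewrite mB; under eq_fun do rewrite mB.
  by apply: cvgB => //; exact: cvg_cst.
have -> : fredholm_det (fun u v => edge_kernel y a N (cell y a u) (cell y a v)) `]y, +oo[ =
    \det (1%:M - M).
  by rewrite -(cvg_lim _ (@edge_det_cvg R y a N a1))//; exact/cvg_lim.
apply: cvg_det => i j; rewrite mB.
pose I := edge_site y a + i.+1%:Z; pose J := edge_site y a + j.+1%:Z.
have wE L : ((window_matrix N (1 - edge_site y a) (a ^+ 3) L)^T *m
        window_matrix N (1 - edge_site y a) (a ^+ 3) L) i j =
    bessel_window I J L (a ^+ 3) - ((edge_matrix y a L N)^T *m edge_matrix y a L N) i j.
  rewrite !mxE /bessel_window -sumrB; apply: eq_bigr => p _; rewrite !mxE /edge_wave.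
  have e (k : nat) : k.+1%:Z - (1 - edge_site y a + p%:Z) = edge_site y a + k.+1%:Z - 1 - p%:Z by ring.
  have e' (k : nat) : edge_site y a + p%:Z + k.+1%:Z = edge_site y a + k.+1%:Z + p%:Z by ring.
  by rewrite !e !e' addrK.
under eq_fun do rewrite wE; apply: cvgB => //.
have -> : (1%:M : 'M[R]_N) i j = (I == J)%:R.
  by rewrite mxE /I /J (inj_eq (addrI _)) eqz_nat eqSS -val_eqE.
exact: bessel_window_cvg.
Qed.

Lemma leftmost_half_line N (X : config N) (x0 : int) : (0 < N)%N ->
  x0 <= leftmost X <-> in_half_line x0 X.
Proof.
move=> N0; rewrite /leftmost -/(positions X).
have sX : sorted <=%R (positions X) by exact: sort_le_sorted.
have : size (positions X) = N by exact: size_positions.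
have mX := mem_positions X.
case: (positions X) sX mX => [|x s] /= xs mX sN; first by rewrite -sN in N0.
split=> [h k|h]; last by apply: h; rewrite -mX inE eqxx.
rewrite -mX inE => /predU1P[->//|ks]; apply: (le_trans h).
by have /allP := order_path_min le_trans xs; exact.
Qed.

(** Since x is an integer, the rescaled event is that x lies in a half-line
    with integer end point. *)
Lemma edge_event (a : R) (x : int) : 0 < a ->
  (- y <= (x%:~R + 2 * a ^+ 3) / a) = (1 - edge_site y a <= x).
Proof.
move=> a0; rewrite ler_pdivlMr// mulNr.
have -> : (1 - edge_site y a <= x) = (- x <= Num.floor (2 * a ^+ 3 + y * a)).
  by rewrite /edge_site; apply/idP/idP; lia.
by rewrite floor_ge_int mulrNz; apply/idP/idP; lra.
Qed.

Lemma prob_leftmost_edge (a : R) N : 1 <= a -> (0 < N)%N ->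
  prob_leftmost 0 (a ^+ 3) (initial N)
    [set x : int | - y <= (x%:~R + 2 * a ^+ 3) / a] =
  (fredholm_det (fun u v => edge_kernel y a N (cell y a u) (cell y a v)) `]y, +oo[)%:E.
Proof.
move=> a1 N0; have a0 : 0 < a by exact: lt_le_trans a1.
rewrite -(sum_half_line (@window_det_cvg a N a1)) /prob_leftmost.
rewrite (_ : [set X : config N | _] = in_half_line (1 - edge_site y a)); last first.
  apply/seteqP; split=> X /=.
    by rewrite edge_event// => h; apply/(leftmost_half_line _ _ N0).
  by move/(leftmost_half_line _ _ N0); rewrite edge_event.
by apply: eq_esum => X _; rewrite sqmod_psi// exprn_ge0// ltW.
Qed.

Lemma prob_domain_wall_edge (a : R) : 1 <= a ->
  prob_leftmost_domain_wall 0 (a ^+ 3)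
    [set x : int | - y <= (x%:~R + 2 * a ^+ 3) / a] = (edge_det y a)%:E.
Proof.
move=> a1; apply/cvg_lim => //.
have h := @edge_det_cvg_particles R y a a1.
have {}h : (fredholm_det (fun u v => edge_kernel y a N (cell y a u) (cell y a v)) `]y, +oo[)%:E
    @[N --> \oo] --> (edge_det y a)%:E by apply: cvg_EFin; [exact: nearW|].
apply: cvg_trans h; apply: near_eq_cvg; exists 1%N => // N /= N1.
by rewrite prob_leftmost_edge.
Qed.

End leftmost.

Theorem mainTheorem6 (R : realType) (y : R) :
  prob_leftmost_domain_wall 0 t
    [set x : int | - y <= (x%:~R + 2 * t) / t `^ (3^-1)] @[t --> +oo]
  --> (F2 y)%:E.
Proof.
apply/cvge_pinftyP => u uy.
(* The time is a^3 along a sequence going to infinity; the maximum with 1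
   changes only finitely many terms. *)
pose a n : R := Num.max 1 (u n `^ 3^-1).
have a1 n : 1 <= a n by rewrite le_max lexx.
have pow3 (t : R) : 0 <= t -> (t `^ 3^-1) ^+ 3 = t.
  by move=> t0; rewrite -powR_mulrn ?powR_ge0// -powRrM mulVf// powRr1.
have root_ge (A t : R) : 0 <= A -> A ^+ 3 <= t -> A <= t `^ 3^-1.
  move=> A0 At; have t0 : 0 <= t by rewrite (le_trans _ At)// exprn_ge0.
  by rewrite -(@ler_pXn2r _ 3) ?nnegrE ?powR_ge0// pow3.
have ay : (a n)^-1 @[n --> \oo] --> (0 : R).
  apply/gtr0_cvgV0; first by apply: nearW => n; exact: lt_le_trans (a1 n).
  apply/cvgryPge => A; have [N _ hN] : \forall n \near \oo, `|A| ^+ 3 <= u n.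
    by move/cvgryPge: uy; exact.
  exists N => // n /= Nn; rewrite /a le_max; apply/orP; right.
  by rewrite (le_trans (ler_norm A))// root_ge// hN.
have h : (edge_det y (a n))%:E @[n --> \oo] --> (F2 y)%:E.
  by apply: cvg_EFin; [exact: nearW|exact: edge_det_cvg_airy].
apply: cvg_trans h; apply: near_eq_cvg.
have [N _ hN] : \forall n \near \oo, 1 <= u n by move/cvgryPge: uy; exact.
exists N => // n /= Nn; have u1 := hN n Nn.
have aE : a n = u n `^ 3^-1 by apply/max_idPr; rewrite root_ge ?expr1n.
have u0 : 0 <= u n by exact: le_trans u1.
have tE : a n ^+ 3 = u n by rewrite aE pow3.
by have := prob_domain_wall_edge y (a1 n); rewrite tE aE => e; rewrite /= e.
Qed.
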